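(* Let $d\ge2$ and $d'\ge1$ be integers. For $\varphi_{1,d'}\in\mathcal{P}(\mathbb{B}_1\times\mathbb{R}^{d'},|\cdot|,\|\cdot\|)$ define $\varphi_{d,d'}:[0,1)\times[0,\infty)\to\mathbb{R}$ by $$\varphi_{d,d'}(x,t)=\frac{2\,\Gamma(d/2)}{\sqrt{\pi}\,\Gamma((d-1)/2)}\,\frac1x\int_0^x\varphi_{1,d'}(u,t)\left(1-\frac{u^2}{x^2}\right)^{(d-3)/2}du,\qquad 0<x<1,\ t\ge0,$$ and $\varphi_{d,d'}(0,t)=\varphi_{1,d'}(0,t)$. Then the operator $\varphi_{1,d'}\mapsto\varphi_{d,d'}$ is a bijection from the class $\mathcal{P}(\mathbb{B}_1\times\mathbb{R}^{d'},|\cdot|,\|\cdot\|)$ onto the class $\mathcal{P}(\mathbb{B}_d\times\mathbb{R}^{d'},\|\cdot\|,\|\cdot\|)$.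
   Context: $\|\cdot\|$ is the Euclidean norm and $\mathbb{B}_d=\{\boldsymbol{x}\in\mathbb{R}^d:\|\boldsymbol{x}\|<1/2\}$. A kernel $K:X\times X\to\mathbb{R}$ is positive definite if $\sum_{i,j=1}^N a_ia_jK(p_i,p_j)\ge0$ for all $N\in\mathbb{N}$, $a_1,\dots,a_N\in\mathbb{R}$ and $p_1,\dots,p_N\in X$. For positive integers $d,d'$, $\mathcal{P}(\mathbb{B}_d\times\mathbb{R}^{d'},\|\cdot\|,\|\cdot\|)$ is the class of continuous $\varphi:[0,1)\times[0,\infty)\to\mathbb{R}$ with $\varphi(0,0)=1$ such that $((\boldsymbol{x},\boldsymbol{y}),(\boldsymbol{x}',\boldsymbol{y}'))\mapsto\varphi(\|\boldsymbol{x}-\boldsymbol{x}'\|,\|\boldsymbol{y}-\boldsymbol{y}'\|)$ is positive definite on $\mathbb{B}_d\times\mathbb{R}^{d'}$; for $d=1$ the first norm is the absolute value. *)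

(* Defs.v *)
From mathcomp Require Import all_boot all_order all_algebra.
From mathcomp Require Import all_classical all_reals all_analysis.
Import Order.TTheory GRing.Theory Num.Theory.
Import numFieldNormedType.Exports.

Set Implicit Arguments.
Unset Strict Implicit.
Unset Printing Implicit Defensive.

Local Open Scope classical_set_scope.
Local Open Scope ring_scope.

(* The library norm `|x| on 'rV[R]_n is the maximum norm. *)
Definition euclidean_norm (R : realType) (n : nat) (x : 'rV[R]_n) : R :=
  Num.sqrt (\sum_(i < n) x ord0 i ^+ 2).

(* R^1 is 'rV[R]_1, where the Euclidean norm is the absolute value. *)
Lemma euclidean_norm1 (R : realType) (x : 'rV[R]_1) :
  euclidean_norm x = `|x ord0 ord0|.
Proof. by rewrite /euclidean_norm big_ord1 sqrtr_sqr. Qed.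

Definition half_ball (R : realType) (d : nat) : set 'rV[R]_d :=
  [set x | euclidean_norm x < 2^-1].
Arguments half_ball : clear implicits.

Definition positive_definite_on (R : realType) (T : Type) (X : set T)
    (K : T -> T -> R) : Prop :=
  forall (N : nat) (a : 'I_N -> R) (p : 'I_N -> T), (forall i, X (p i)) ->
    0 <= \sum_(i < N) \sum_(j < N) a i * a j * K (p i) (p j).

Definition strip (R : realType) : set (R * R) :=
  [set p | 0 <= p.1 < 1 /\ 0 <= p.2].
Arguments strip : clear implicits.

(* A function strip -> R is encoded as its extension by 0 to R * R, so that
   equality of two encodings is equality of the functions on the strip. *)
Definition class_P (R : realType) (d d' : nat) : set (R * R -> R) :=
  [set phi : R * R -> R |
    [/\ forall p, ~ strip R p -> phi p = 0,
        {within strip R, continuous phi},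
        phi (0, 0) = 1 &
        positive_definite_on (half_ball R d `*` [set: 'rV[R]_d'])
          (fun p q => phi (euclidean_norm (p.1 - q.1),
                           euclidean_norm (p.2 - q.2)))]].
Arguments class_P : clear implicits.

Definition Gamma (R : realType) (s : R) : R :=
  \int[lebesgue_measure]_(t in `]0, +oo[) (t `^ (s - 1) * expR (- t)).

(* For d = 2 the integrand is singular at u = x; its value there (powR gives
   0 `^ (- 2^-1) = 0) does not affect the Lebesgue integral. *)
Definition dimension_lift (R : realType) (d : nat) (phi : R * R -> R) : R * R -> R :=
  (fun p : R * R => let x := p.1 in let t := p.2 in
    if x == 0 then phi (0, t) else
    2 * Gamma (d%:R / 2 : R) / (Num.sqrt pi * Gamma ((d%:R - 1) / 2 : R))
    * x^-1
    * \int[lebesgue_measure]_(u in `[0, x])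
        (phi (u, t) * (1 - u ^+ 2 / x ^+ 2) `^ ((d%:R - 3) / 2)))
  \_ (strip R).

(* Main.v *)
(** Let L be the operator of the theorem and mu_m the factor by which it multiplies x^(2m). By Weierstrass, phi(v, t) is
    close to an even polynomial P(v^2) on [0, x], and then L phi(x, t) is as close to sum_m P_m mu_m x^(2m).

    L phi(|x|, t) is the average of phi(|<xi, x>|, t) over the unit sphere, realised as a limit of finite quadratures;
    so positive definiteness passes from B_1 to B_d. If L g = 0 then L (v^2 g) = 0, because
    mu_{m+1} / mu_m = 1 - (d - 1) / (d + 2m) and the multiplier 1 / (d + 2m) is an average of dilations; hence
    L (P(v^2) g) = 0 for every polynomial P, L (g^2) = 0 and g = 0.

    For surjectivity, the inverse multiplier 1 / mu_m becomes an average of dilations against a bounded signed measure on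
    [-1, 1] after N > d integrations: multiplying x^(2m) by x^(2N) / ((2m+1) ... (2m+2N) mu_m) turns phi(., t) into a
    function E(., t), whose 2N-th order divided difference f_{eps,del}(x, t), a product of two N-th order differences of
    steps eps and del, should approach the preimage. Polarizing E(x - y) expresses f_{eps,del} as a limit of averages
    of (1 + <xi, eta>) phi(|r xi - s eta|, t) over pairs of points of the sphere, so that f_{eps,del}(x - y, |u - w|) is
    a positive definite kernel in the triples (x, eps, u), (y, del, w). Since f_{eps,del}(0, 0) tends to 1, the
    Cauchy-Schwarz inequality makes f_{eps,eps} uniformly Cauchy, and its limit is the preimage of phi. *)

From HB Require Import structures.
Require Import Defs.
From mathcomp Require Import all_boot all_order all_algebra.
From mathcomp Require Import all_classical all_reals all_analysis.
From mathcomp Require Import measurable_realfun.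
From mathcomp Require Import ring lra zify.
Import Order.TTheory GRing.Theory Num.Theory.
Import numFieldNormedType.Exports.

Set Implicit Arguments.
Unset Strict Implicit.
Unset Printing Implicit Defensive.

Local Open Scope classical_set_scope.
Local Open Scope ring_scope.

(** The obstacle is surjectivity. 1 / mu_m grows like m^((d - 1) / 2), so inverting the lift costs
    about (d - 1) / 2 derivatives, which a merely continuous phi(., t) need not have. Dividing by
    enough linear factors in m makes the multiplier bounded; it is positive definiteness that makes
    the differences of the smoothed function converge.

    The weight 1 + <xi, eta> is forced by polarization: (x - y)^(2m) contains odd powers of x and of
    y, whereas the plain mean of |r xi - s eta|^(2m) is even in r and in s. As the Gram kernel of
    the vectors (1, xi), it preserves positive definiteness.

    Two independent steps eps and del are kept because the comparison of f_{eps,eps} with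
    f_{del,del} passes through inner products of vectors with different steps. The division by (eps
    del)^N does no harm at the origin, where the measures of radii have variation of order eps^N and
    del^N. *)

Local Notation leb := (@lebesgue_measure _).

(** * Weierstrass approximation *)

(** The recursion of the binomial distribution. It makes sense over any ring, so that at ['X] it
    yields the Bernstein polynomial itself. *)
Fixpoint bernstein (R : pzRingType) (n k : nat) (x : R) : R :=
  match n, k with
  | 0, 0 => 1
  | 0, _.+1 => 0
  | n'.+1, 0 => (1 - x) * bernstein n' 0 x
  | n'.+1, k'.+1 => x * bernstein n' k' x + (1 - x) * bernstein n' k x
  end.

Lemma bernstein_small (R : pzRingType) (n k : nat) (x : R) :
  (n < k)%N -> bernstein n k x = 0.
Proof.
elim: n k => [|n IH] [|k] //= nk.
by rewrite !IH ?mulr0 ?addr0 //; apply: ltnW.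
Qed.

Lemma bernstein_sumS (R : comPzRingType) (n : nat) (x : R) (g : nat -> R) :
  \sum_(k < n.+2) g k * bernstein n.+1 k x =
  x * (\sum_(k < n.+1) g k.+1 * bernstein n k x)
  + (1 - x) * (\sum_(k < n.+1) g k * bernstein n k x).
Proof.
rewrite big_ord_recl /=.
under eq_bigr => i _.
  have -> : bump 0 i = i.+1 by [].
  rewrite mulrDr.
  over.
rewrite big_split /= addrCA; congr (_ + _).
  by rewrite mulr_sumr; apply: eq_bigr => i _; rewrite mulrCA.
rewrite big_ord_recr /= (@bernstein_small _ n n.+1)// !mulr0 addr0.
rewrite [in RHS]big_ord_recl mulrDr mulrCA; congr (_ + _).
by rewrite mulr_sumr; apply: eq_bigr => i _; rewrite mulrCA.
Qed.

Lemma bernstein_sum1 (R : comPzRingType) (n : nat) (x : R) :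
  \sum_(k < n.+1) bernstein n k x = 1.
Proof.
have H m : \sum_(k < m.+1) bernstein m k x = \sum_(k < m.+1) 1 * bernstein m k x.
  by apply: eq_bigr => i _; rewrite mul1r.
rewrite H; elim: n => [|n IH]; first by rewrite big_ord1 /= mulr1.
by rewrite (bernstein_sumS n x (fun=> 1)) IH !mulr1 addrC subrK.
Qed.

Lemma bernstein_mean (R : comPzRingType) (n : nat) (x : R) :
  \sum_(k < n.+1) k%:R * bernstein n k x = n%:R * x.
Proof.
elim: n => [|n IH]; first by rewrite big_ord1 /= mul0r mul0r.
rewrite (bernstein_sumS n x (fun k => k%:R)) IH.
under eq_bigr => i _ do rewrite -natr1 mulrDl mul1r.
rewrite big_split /= IH bernstein_sum1 -natr1.
ring.
Qed.

(** Variance of the binomial distribution. The two branches of the recursion shift the centre by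
    [1 - x] and by [- x], and [H] gives the second moment about a point at distance [c] from the
    mean. *)
Lemma bernstein_variance (R : comPzRingType) (n : nat) (x : R) :
  \sum_(k < n.+1) (k%:R - n%:R * x) ^+ 2 * bernstein n k x = n%:R * x * (1 - x).
Proof.
elim: n => [|n IH]; first by rewrite big_ord1 /= !mul0r subrr expr0n mul0r.
rewrite (bernstein_sumS n x (fun k => (k%:R - n.+1%:R * x) ^+ 2)).
have H c : \sum_(k < n.+1) (k%:R - n%:R * x + c) ^+ 2 * bernstein n k x =
    n%:R * x * (1 - x) + c ^+ 2.
  under eq_bigr => i _.
    have -> : (i%:R - n%:R * x + c) ^+ 2 * bernstein n i x =
      (i%:R - n%:R * x) ^+ 2 * bernstein n i x
      + ((c * 2) * (i%:R * bernstein n i x)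
         + (c ^+ 2 - c * 2 * n%:R * x) * bernstein n i x) by ring.
    over.
  rewrite big_split /= IH big_split /= -!mulr_sumr bernstein_mean bernstein_sum1.
  ring.
under eq_bigr => i _.
  have -> : i.+1%:R - n.+1%:R * x = i%:R - n%:R * x + (1 - x) by rewrite -!natr1; ring.
  over.
rewrite H.
under eq_bigr => i _.
  have -> : i%:R - n.+1%:R * x = i%:R - n%:R * x + (- x) by rewrite -!natr1; ring.
  over.
rewrite H -natr1; ring.
Qed.

Lemma bernstein_ge0 (R : numDomainType) (n k : nat) (x : R) :
  0 <= x <= 1 -> 0 <= bernstein n k x.
Proof.
move=> /andP[x0 x1]; elim: n k => [|n IH] [|k] //=; rewrite ?ler01//.
  by rewrite mulr_ge0 ?subr_ge0.
by rewrite addr_ge0 // mulr_ge0 ?subr_ge0.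
Qed.

Lemma horner_bernstein (R : comNzRingType) (n k : nat) (x : R) :
  (bernstein n k ('X : {poly R})).[x] = bernstein n k x.
Proof.
by elim: n k => [|n IH] [|k] //=; rewrite ?hornerE // !IH.
Qed.

Lemma within_continuousE (K : realType) (V : pseudoMetricType K) (A : set V) (f : V -> K) :
  {within A, continuous f} <->
  forall x, A x -> forall e : K, 0 < e -> exists2 d : K, 0 < d &
    forall y, A y -> ball x d y -> `|f y - f x| < e.
Proof.
rewrite subspace_continuousP; split => H x Ax.
  move=> e e0; have /cvgrPdist_lt /(_ e e0) := H x Ax.
  rewrite near_withinE => /nbhs_ballP[d /= d0 Hd].
  by exists d => // y Ay xy; rewrite distrC; apply: Hd.
apply/cvgrPdist_lt => e e0; have [d d0 Hd] := H x Ax e e0.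
rewrite near_withinE; apply/nbhs_ballP; exists d => //= y xy Ay.
by rewrite distrC; apply: Hd.
Qed.

Lemma segment_unif_continuous (R : realType) (f : R -> R) (a b : R) :
  {within `[a, b], continuous f} ->
  forall e : R, 0 < e -> exists2 d : R, 0 < d &
    forall x y, a <= x <= b -> a <= y <= b -> `|y - x| < d -> `|f y - f x| < e.
Proof.
move=> /within_continuousE cf e e0.
have := @segment_compact R a b => /compact_near_coveringP.
pose P (d : R) (x : R) := a <= x <= b -> forall y, a <= y <= b -> `|y - x| < d -> `|f y - f x| < e.
move=> /(_ R (0 : R)^'+ P _) [].
  move=> x /= xab.
  have e2 : 0 < e / 2 by lra.
  have [d d0 Hd] := cf x xab (e / 2) e2.
  have d2 : 0 < d / 2 by lra.
  near=> x' t => /= x'ab y yab yx'.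
  have xx' : `|x - x'| < d / 2 by near: x'; apply/nbhs_ballP; exists (d / 2).
  have td : t < d / 2 by near: t; apply: nbhs_right_lt.
  have H1 := Hd x'; rewrite /= in_itv /= in H1.
  have {}H1 := H1 x'ab.
  have {}H1 : `|f x' - f x| < e / 2 by apply: H1; rewrite /ball /=; lra.
  have H2 := Hd y; rewrite /= in_itv /= in H2.
  have {}H2 := H2 yab.
  have {}H2 : `|f y - f x| < e / 2.
    apply: H2; rewrite /ball /=.
    have := ler_distD x' x y; rewrite (distrC x' y); lra.
  by have := ler_distD (f x) (f y) (f x'); rewrite (distrC (f x) (f x')); lra.
move=> d /= d0 H.
exists (d / 2); first by lra.
move=> x y xab yab xy.
apply: (H (d / 2)) => //=; last by lra.
rewrite sub0r normrN gtr0_norm; lra.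
Unshelve. all: by end_near.
Qed.

(** Chebyshev's inequality. Nodes closer to [x] than [d] contribute at most [e / 2] by uniform
    continuity. At a farther node the error is at most 2 M, hence at most 2 M (k/n - x)^2 / d^2, and
    the sum of these is controlled by the variance. *)
Lemma bernstein_cvg (R : realType) (f : R -> R) :
  {within `[0, 1], continuous f} ->
  forall e : R, 0 < e -> exists n0 : nat, forall n, (n0 <= n)%N -> forall x : R, 0 <= x <= 1 ->
   `|f x - \sum_(k < n.+1) f (k%:R / n%:R) * bernstein n k x| <= e.
Proof.
move=> cf e e0.
have [d d0 Hd] := segment_unif_continuous cf (e := e / 2) ltac:(lra).
have [M M0 HM] : exists2 M : R, 0 < M & forall x : R, 0 <= x <= 1 -> `|f x| <= M.
  have /pinfty_ex_gt0[M M0 HM] :=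
    compact_bounded (continuous_compact cf (@segment_compact R 0 1)).
  exists M => // x x01; apply: HM => /=; exists x => //.
have [n0 Hn0] : exists n0 : nat, 4 * M / (d ^+ 2 * e) <= n0%:R.
  exists (Num.bound (4 * M / (d ^+ 2 * e))).
  by apply: ltW; apply: le_lt_trans (archi_boundP _); rewrite ?ler_norm// divr_ge0 ?mulr_ge0 ?ltW ?exprn_gt0.
exists n0.+1 => n n0n x x01.
have n_gt0 : (0 < n)%N by apply: leq_trans n0n.
have nR0 : 0 < n%:R :> R by rewrite ltr0n.
have H4 : 2 * M / d ^+ 2 <= n%:R * (e / 2).
  have : 4 * M / (d ^+ 2 * e) <= n%:R.
    by apply: le_trans Hn0 _; rewrite ler_nat; apply: ltnW.
  rewrite ler_pdivrMr ?mulr_gt0 ?exprn_gt0// => H.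
  rewrite ler_pdivrMr ?exprn_gt0//; lra.
have -> : f x - \sum_(k < n.+1) f (k%:R / n%:R) * bernstein n k x =
  \sum_(k < n.+1) (f x - f (k%:R / n%:R)) * bernstein n k x.
  under [in RHS]eq_bigr => i _ do rewrite mulrBl.
  by rewrite sumrB -mulr_sumr bernstein_sum1 mulr1.
apply: le_trans (ler_norm_sum _ _ _) _.
(* The bound is split into both contributions, so that the comparison can be made node by node. *)
have -> : e = \sum_(k < n.+1) (e / 2 * bernstein n k x) + e / 2.
  rewrite -mulr_sumr bernstein_sum1; lra.
have H5 : \sum_(k < n.+1) ((2 * M / d ^+ 2) / n%:R ^+ 2 * ((k%:R - n%:R * x) ^+ 2 * bernstein n k x)) <= e / 2.
  rewrite -mulr_sumr bernstein_variance.
  have -> : 2 * M / d ^+ 2 / n%:R ^+ 2 * (n%:R * x * (1 - x)) =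
    2 * M / d ^+ 2 * (x * (1 - x)) / n%:R by field; rewrite !gt_eqF.
  rewrite ler_pdivrMr// mulrC [X in _ <= X]mulrC.
  apply: le_trans H4.
  rewrite ler_piMl// ?divr_ge0 ?mulr_ge0 ?ltW ?exprn_gt0//.
  move: x01 => /andP[? ?]; nra.
apply: le_trans (lerD (lexx _) H5); rewrite -big_split /=.
apply: ler_sum => k _.
rewrite normrM (ger0_norm (bernstein_ge0 _ _ x01)) mulrA -mulrDl.
apply: ler_wpM2r; first exact: bernstein_ge0.
have k01 : 0 <= (k%:R / n%:R : R) <= 1.
  rewrite divr_ge0 ?ler0n//= ler_pdivrMr// mul1r ler_nat.
  by have := ltn_ord k; rewrite ltnS.
have [kd|kd] := ltP `|k%:R / n%:R - x| d.
  have := Hd _ _ x01 k01 kd; rewrite distrC => /ltW /le_trans; apply.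
  by rewrite lerDl mulr_ge0 ?sqr_ge0// !divr_ge0 ?mulr_ge0 ?sqr_ge0 ?ltW.
apply: (@le_trans _ _ (2 * M)).
  have := HM _ x01; have := HM _ k01.
  have := ler_normB (f x) (f (k%:R / n%:R)); lra.
apply: (@le_trans _ _ (2 * M / d ^+ 2 / n%:R ^+ 2 * (k%:R - n%:R * x) ^+ 2)); last lra.
have -> : 2 * M / d ^+ 2 / n%:R ^+ 2 * (k%:R - n%:R * x) ^+ 2 =
  2 * M * ((k%:R / n%:R - x) ^+ 2 / d ^+ 2) by field; rewrite !gt_eqF.
rewrite ler_peMr ?mulr_ge0 ?(ltW M0)// ler_pdivlMr ?exprn_gt0// mul1r.
by rewrite -[X in _ <= X]real_normK ?num_real// lerXn2r ?nnegrE ?(ltW d0)//.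
Qed.

Lemma weierstrass (R : realType) (f : R -> R) :
  {within `[0, 1], continuous f} ->
  forall e : R, 0 < e -> exists P : {poly R}, forall x : R, 0 <= x <= 1 ->
   `|f x - P.[x]| <= e.
Proof.
move=> cf e e0; have [n0 H] := bernstein_cvg cf e0.
exists (\sum_(k < n0.+1) f (k%:R / n0%:R) *: bernstein n0 k 'X) => x x01.
have -> : (\sum_(k < n0.+1) f (k%:R / n0%:R) *: bernstein n0 k 'X).[x] =
  \sum_(k < n0.+1) f (k%:R / n0%:R) * bernstein n0 k x.
  by rewrite horner_sum; apply: eq_bigr => i _; rewrite hornerZ horner_bernstein.
exact: H.
Qed.

(** * The multipliers of the lift *)

Lemma FTC2_is_derive (R : realType) (f F : R -> R) (a b : R) : a < b ->
  (forall x : R, a <= x <= b -> is_derive x 1 F (f x)) -> {within `[a, b], continuous f} ->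
  (\int[leb]_(x in `[a, b]) (f x)%:E = (F b - F a)%:E)%E.
Proof.
move=> ab dF cf; rewrite EFinB; apply: continuous_FTC2 => //.
- have cF x : a <= x <= b -> {for x, continuous F}.
    by move=> /dF[dFx _]; apply: differentiable_continuous; apply/derivable1_diffP.
  split.
  + move=> x; rewrite in_itv /= => /andP[ax xb]. 
    by have [] := dF x; rewrite ?ltW.
  + by apply: cvg_at_right_filter; apply: cF; rewrite lexx ltW.
  + by apply: cvg_at_left_filter; apply: cF; rewrite lexx ltW.
- move=> x; rewrite in_itv /= => /andP[ax xb].
  by rewrite derive1E; have [_] := dF x ltac:(by rewrite !ltW); apply.
Qed.

Lemma continuous_itv_integrable (R : realType) (f : R -> R) (a b : R) :
  {within `[a, b], continuous f} -> leb.-integrable `[a, b] (EFin \o f).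
Proof. by move=> cf; apply: continuous_compact_integrable => //; apply: segment_compact. Qed.

Lemma integrable_mul_weight (R : realType) (f w : R -> R) (a b : R) :
  {within `[a, b], continuous f} -> leb.-integrable `[a, b] (EFin \o w) ->
  leb.-integrable `[a, b] (EFin \o (fun u => f u * w u)).
Proof.
move=> cf iw.
have := @integrableMr _ _ R leb `[a, b] _ f (EFin \o w).
move=> -> //.
- by apply: subspace_continuous_measurable_fun.
- have := compact_bounded (continuous_compact cf (@segment_compact R a b)).
  move=> [M [Mr HM]]; exists M; split => // x Mx y /= yab; apply: (HM x Mx) => /=.
  by exists y.
Qed.

Definition weight (R : realType) (a b u : R) : R := (1 - u ^+ 2 / b ^+ 2) `^ a.

Lemma weight2E (R : realType) (b u : R) : 0 <= u < b ->
  weight (- 2^-1) b u = (Num.sqrt (1 - u ^+ 2 / b ^+ 2))^-1.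
Proof.
move=> /andP[u0 ub]; have b0 : 0 < b by lra.
rewrite /weight powRN powR12_sqrt// subr_ge0 ler_pdivrMr ?exprn_gt0// mul1r.
by rewrite lerXn2r ?nnegrE// ltW.
Qed.

Lemma sub1_sqr_gt0 (R : realFieldType) (b u : R) : 0 <= u < b -> 0 < 1 - u ^+ 2 / b ^+ 2.
Proof.
move=> /andP[u0 ub]; have b0 : 0 < b by lra.
rewrite subr_gt0 ltr_pdivrMr ?exprn_gt0// mul1r.
by rewrite ltrXn2r//.
Qed.

Lemma is_derive_sqrt_weight (R : realType) (b u : R) (P : {poly R}) : 0 <= u < b ->
  is_derive u 1 (fun v : R => P.[v] * Num.sqrt (1 - v ^+ 2 / b ^+ 2))
   ((P^`().[u] * (1 - u ^+ 2 / b ^+ 2) - P.[u] * u / b ^+ 2) * weight (- 2^-1) b u).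
Proof.
move=> ub; have h := sub1_sqr_gt0 ub.
have d1 : is_derive u 1 (fun v : R => 1 - v ^+ 2 / b ^+ 2) (- (2 * u / b ^+ 2)).
  apply: is_derive_eq. rewrite /GRing.scale /=; ring.
have d2 := @is_derive1_comp R Num.sqrt (fun v : R => 1 - v ^+ 2 / b ^+ 2) u _ _ (is_derive1_sqrt h) d1.
have d3 := is_deriveM (is_derive_poly P u) d2.
apply: (is_derive_eq d3). 
rewrite weight2E//= /GRing.scale /=.
set s := Num.sqrt _.
have s0 : 0 < s by rewrite sqrtr_gt0.
have hs : 1 - u ^+ 2 / b ^+ 2 = s ^+ 2 by rewrite sqr_sqrtr// ltW.
rewrite hs; field.
by rewrite !gt_eqF//; lra.
Qed.
Lemma weight_ge0 (R : realType) (a b u : R) : 0 <= weight a b u.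
Proof. exact: powR_ge0. Qed.

Lemma measurable_weight (R : realType) (a b : R) (A : set R) : measurable_fun A (weight a b).
Proof.
apply: measurable_funTS; apply: (@measurableT_comp _ _ _ _ _ _ (@powR R ^~ a)) => //.
by apply: measurable_funB => //; apply: measurable_funM.
Qed.

Lemma weight_continuous (R : realType) (a b y : R) : y < b ->
  {within `[0, y], continuous weight a b}.
Proof.
move=> yb; apply: (@derivable_within_continuous _ _ _ `[0, y]) => u.
rewrite in_itv /= => /andP[u0 uy].
have ub : 0 <= u < b by lra.
have d1 : is_derive u 1 (fun v : R => 1 - v ^+ 2 / b ^+ 2) (- (2 * u / b ^+ 2)).
  by apply: is_derive_eq; rewrite /GRing.scale /=; ring.
by have [] := @is_derive1_comp R (@powR R ^~ a) _ u _ _ (is_derive1_powR a (sub1_sqr_gt0 ub)) d1.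
Qed.

Lemma ge0_integrable_fin (R : realType) (A : set R) (f : R -> R) (r : R) :
  measurable A -> measurable_fun A f -> (forall x, A x -> 0 <= f x) ->
  (\int[leb]_(x in A) (f x)%:E = r%:E)%E ->
  leb.-integrable A (EFin \o f) /\ \int[leb]_(x in A) f x = r.
Proof.
move=> mA mf f0 H; split; last by rewrite /Rintegral H.
apply/integrableP; split; first exact/measurable_EFinP.
apply: le_lt_trans (ltry r); rewrite -H le_eqVlt; apply/orP; left; apply/eqP.
by apply: eq_integral => x; rewrite inE => Ax /=; rewrite ger0_norm// f0.
Qed.

(** The integrand is unbounded near [b]. On [0, b sin([th n])], with [th n] increasing to pi/2, the
    primitive b asin(u / b) gives exactly b times [th n], and monotone convergence concludes. *)
Lemma weight_arcsine (R : realType) (b : R) : 0 < b ->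
  leb.-integrable `[0, b] (EFin \o weight (- 2^-1) b) /\
  \int[leb]_(u in `[0, b]) weight (- 2^-1) b u = b * (pi / 2).
Proof.
move=> b0.
have pi0 : 0 < pi :> R := pi_gt0 R.
apply: ge0_integrable_fin => //; [exact: measurable_weight|by move=> x _; exact: weight_ge0|].
rewrite -integral_itv_bndo_bndc; last by apply/measurable_EFinP; exact: measurable_weight.
pose th (n : nat) : R := (pi / 2) * (1 - (n.+2%:R)^-1).
have th_bd n : 0 < th n < pi / 2.
  have h : 0 < n.+2%:R^-1 :> R by rewrite invr_gt0.
  have h2 : n.+2%:R^-1 < 1 :> R by rewrite invf_lt1// ltr1n.
  by rewrite /th; move: h h2; set w := _^-1 => h h2; apply/andP; split; nra.
pose F (n : nat) : set R := `[0, b * sin (th n)]%classic.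
have thm n m : (n <= m)%N -> th n <= th m.
  move=> nm; rewrite /th ler_pM2l; last by lra.
  by rewrite lerB// lef_pV2 ?posrE// ler_nat.
have thcvg : th n @[n --> \oo] --> pi / 2.
  rewrite -[X in _ --> X]mulr1; apply: cvgMl_tmp => //.
  rewrite -[X in _ --> X]subr0; apply: cvgB; first exact: cvg_cst.
  by have := @cvg_harmonic R; rewrite -cvg_shiftS.
have FU : \bigcup_n F n = `[0, b[%classic.
  apply/seteqP; split => u /=.
    move=> [n _]; rewrite /F /= !in_itv /= => /andP[u0 ub].
    rewrite u0 /=; apply: (le_lt_trans ub).
    rewrite gtr_pMr// -sin_pihalf ltr_sin ?in_itv/=; have := th_bd n; lra.
  rewrite in_itv /= => /andP[u0 ub].
  have : sin (th n) @[n --> \oo] --> sin (pi / 2 : R).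
    apply: continuous_cvg; first exact: continuous_sin.
    exact: thcvg.
  rewrite sin_pihalf => /cvgrPdist_lt /(_ (1 - u / b)) []; first by rewrite subr_gt0 ltr_pdivrMr// mul1r.
  move=> N _ /(_ N (leqnn N)) /= hN; exists N => //; rewrite /F /= in_itv /= u0 /=.
  rewrite mulrC -ler_pdivrMr//.
  have := ler_norm (1 - sin (th N)); lra.
have IF n : (\int[leb]_(u in F n) (weight (- 2^-1) b u)%:E = (b * th n)%:E)%E.
  have thn := th_bd n.
  have hs1 : 0 < sin (th n) by apply: sin_gt0_pihalf.
  have hs2 : sin (th n) < 1.
    rewrite -sin_pihalf ltr_sin ?in_itv/=; lra.
  have hb u : 0 <= u <= b * sin (th n) -> 0 <= u < b.
    move=> /andP[u0 ub]; rewrite u0 /=; apply: (le_lt_trans ub).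
    by rewrite gtr_pMr.
  apply: etrans; first apply: (@FTC2_is_derive R (weight (- 2^-1) b) (fun u => b * asin (u / b)) 0 (b * sin (th n))).
  - by rewrite mulr_gt0.
  - move=> u /hb ub.
    have [u0 u1] := andP ub.
    have hub : -1 < u / b < 1.
      rewrite ltr_pdivrMr// mul1r u1 andbT (@lt_le_trans _ _ 0) ?ltrN10// divr_ge0// ltW//.
    have d1 : is_derive u 1 (fun v : R => v / b) b^-1.
      apply: is_derive_eq. rewrite /GRing.scale /=; ring.
    have d2 := @is_derive1_comp R asin (fun v : R => v / b) u _ _ (is_derive1_asin hub) d1.
    have d3 := is_deriveZ b d2.
    apply: (is_derive_eq d3).
    rewrite weight2E// expr_div_n /GRing.scale /=; field.
    by apply/andP; split; rewrite gt_eqF// sqrtr_gt0; exact: sub1_sqr_gt0.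
  - apply: weight_continuous; rewrite gtr_pMr//.
  - have asin0 : asin (0 : R) = 0 by rewrite -{1}sin0 sinK// in_itv/=; apply/andP; split; lra.
    rewrite /= mul0r asin0 mulr0 subr0 mulrAC divff ?gt_eqF// mul1r sinK// in_itv/=; apply/andP; split; lra.
have -> : (\int[leb]_(x in `[0%R, b[) (weight (- 2^-1) b x)%:E)%E =
  limn (fun n => \int[leb]_(u in F n) (weight (- 2^-1) b u)%:E)%E.
  rewrite -FU; apply/esym/cvg_lim => //; apply: ge0_nondecreasing_set_cvg_integral.
  - move=> n m nm; apply/subsetPset => u; rewrite /F /= !in_itv /= => /andP[-> /=] /le_trans; apply.
    rewrite ler_pM2l//; have := th_bd n; have := th_bd m; have := thm _ _ nm.
    by move=> h1 h2 h3; rewrite leNgt ltr_sin ?in_itv/= -?leNgt //; apply/andP; split; lra.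
  - by move=> n; exact: measurable_itv.
  - by move=> n; apply/measurable_EFinP; exact: measurable_weight.
  - by move=> n x _; rewrite lee_fin weight_ge0.
apply/cvg_lim => //.
under eq_fun => n do rewrite IF.
apply: cvg_EFin; first by near=> n.
apply: cvgMl_tmp.
exact: thcvg.
Unshelve. all: by end_near.
Qed.
Lemma FTC2_Rintegral (R : realType) (f F : R -> R) (a b : R) : a < b ->
  (forall x : R, a <= x <= b -> is_derive x 1 F (f x)) -> {within `[a, b], continuous f} ->
  \int[leb]_(x in `[a, b]) f x = F b - F a.
Proof. by move=> ab dF cf; rewrite /Rintegral (FTC2_is_derive ab dF cf). Qed.

Lemma within_continuousM (R : realType) (A : set R) (f g : R -> R) :
  {within A, continuous f} -> {within A, continuous g} ->
  {within A, continuous (fun u => f u * g u)}.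
Proof. by move=> cf cg u; apply: cvgM; [exact: cf|exact: cg]. Qed.

(** P(u) sqrt(1 - u^2 / b^2) is a primitive and vanishes at [b], which leaves its value at 0.
    Because of the singularity at [b], the fundamental theorem is applied on [0, y] and y tends to
    [b] from the left. *)
Lemma weight_arcsine_derive (R : realType) (b : R) (P : {poly R}) : 0 < b ->
  \int[leb]_(u in `[0, b])
    ((P^`().[u] * (1 - u ^+ 2 / b ^+ 2) - P.[u] * u / b ^+ 2) * weight (- 2^-1) b u) = - P.[0].
Proof.
move=> b0.
pose g (u : R) := P^`().[u] * (1 - u ^+ 2 / b ^+ 2) - P.[u] * u / b ^+ 2.
have gE u : g u = (P^`() * (1 - (b ^- 2) *: 'X^2) - (b ^- 2) *: (P * 'X)).[u].
  by rewrite /g !hornerE /=; ring.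
have cg (A : set R) : {within A, continuous g}.
  apply: continuous_subspaceT => u; rewrite (_ : g = horner (P^`() * (1 - (b ^- 2) *: 'X^2) - (b ^- 2) *: (P * 'X))).
    exact: continuous_horner.
  by apply/funext => v; exact: gE.
have [iw _] := weight_arcsine b0.
have ig := integrable_mul_weight (cg `[0, b]%classic) iw.
have := parameterized_integral_cvg_at_left b0 ig.
rewrite /parameterized_integral => H.
pose F (u : R) := P.[u] * Num.sqrt (1 - u ^+ 2 / b ^+ 2).
have cF : {for b, continuous F}.
  apply: cvgM; first exact: continuous_horner.
  apply: (@continuous_comp _ _ _ (fun u : R => 1 - u ^+ 2 / b ^+ 2) Num.sqrt); last exact: sqrt_continuous.
  apply: cvgB; first exact: cvg_cst.
  by apply: cvgMr_tmp; exact: exprn_continuous.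
have H2 : F y - F 0 @[y --> b^'-] --> F b - F 0.
  by apply: cvgB; [exact: cvg_at_left_filter|exact: cvg_cst].
have <- : F b - F 0 = - P.[0].
  by rewrite /F divff ?gt_eqF ?exprn_gt0// subrr sqrtr0 mulr0 sub0r expr0n mul0r subr0 sqrtr1 mulr1.
apply: (cvg_unique _ H).
  exact: Rhausdorff.
apply: cvg_trans H2; apply: near_eq_cvg.
near=> y.
have y0 : 0 < y by near: y; apply: nbhs_left_gt.
have yb : y < b by near: y; apply: nbhs_left_lt.
apply/esym; apply: (@FTC2_Rintegral _ _ F) => //.
- by move=> u uy; apply: is_derive_sqrt_weight; lra.
- apply: within_continuousM => //; exact: weight_continuous.
Unshelve. all: by end_near.
Qed.

Lemma within_continuousD (R : realType) (A : set R) (f g : R -> R) :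
  {within A, continuous f} -> {within A, continuous g} ->
  {within A, continuous (fun u => f u + g u)}.
Proof. by move=> cf cg u; apply: cvgD; [exact: cf|exact: cg]. Qed.

Lemma within_continuous_cst (R : realType) (A : set R) (c : R) :
  {within A, continuous (fun _ : R => c)}.
Proof. by apply: continuous_subspaceT; exact: cst_continuous. Qed.

Lemma continuous_exprn_within (R : realType) (k : nat) (A : set R) :
  {within A, continuous (fun u : R => u ^+ k)}.
Proof. by apply: continuous_subspaceT; exact: exprn_continuous. Qed.

Lemma Rintegral_weightD (R : realType) (w f g : R -> R) (a b c : R) :
  leb.-integrable `[a, b] (EFin \o w) ->
  {within `[a, b], continuous f} -> {within `[a, b], continuous g} ->
  \int[leb]_(u in `[a, b]) ((f u + c * g u) * w u) =
  \int[leb]_(u in `[a, b]) (f u * w u) + c * \int[leb]_(u in `[a, b]) (g u * w u).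
Proof.
move=> iw cf cg.
have cZ : {within `[a, b], continuous (fun u => c * g u)}.
  by apply: within_continuousM => //; apply: continuous_subspaceT; exact: cst_continuous.
under eq_Rintegral do rewrite mulrDl.
rewrite RintegralD//; [|exact: integrable_mul_weight|exact: integrable_mul_weight].
congr (_ + _); under eq_Rintegral do rewrite -mulrA.
by rewrite RintegralZl//; exact: integrable_mul_weight.
Qed.

(** Comes from [weight_arcsine_derive] with P = X^(k+1), for which P(0) = 0: the integrand has two
    monomials, whose integrals must cancel. *)
Lemma weight_arcsine_rec (R : realType) (b : R) (k : nat) : 0 < b ->
  \int[leb]_(u in `[0, b]) (u ^+ k.+2 * weight (- 2^-1) b u) =
  b ^+ 2 * (k.+1%:R / k.+2%:R) * \int[leb]_(u in `[0, b]) (u ^+ k * weight (- 2^-1) b u).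
Proof.
move=> b0; have := weight_arcsine_derive 'X^(k.+1) b0.
have [iw _] := weight_arcsine b0.
have iX j : leb.-integrable `[0, b] (EFin \o (fun u => u ^+ j * weight (- 2^-1) b u)).
  by apply: integrable_mul_weight => //; apply: continuous_subspaceT; exact: exprn_continuous.
rewrite derivXn hornerXn expr0n oppr0.
under eq_Rintegral => u _.
  have -> : (('X^k *+ k.+1 : {poly R}).[u] * (1 - u ^+ 2 / b ^+ 2) - ('X^(k.+1) : {poly R}).[u] * u / b ^+ 2) =
    k.+1%:R * u ^+ k + (- (k.+2%:R / b ^+ 2)) * u ^+ k.+2.
    rewrite hornerMn !hornerXn -mulr_natl !exprS -[k.+2%:R]natr1; ring.
  (* With the summand 0, [Rintegral_weightD] applies twice in its form f + c g. *)
  have -> : k.+1%:R * u ^+ k = 0 + k.+1%:R * u ^+ k by rewrite add0r.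
  over.
have c0 : {within `[0, b], continuous (fun _ : R => 0 : R)} by exact: within_continuous_cst.
have ce k' := @continuous_exprn_within R k' `[0, b]%classic.
rewrite Rintegral_weightD//; last first.
  by apply: within_continuousD => //; apply: within_continuousM => //; exact: within_continuous_cst.
rewrite Rintegral_weightD//.
under eq_Rintegral do rewrite mul0r.
rewrite Rintegral_cst//= mul0r add0r => H.
have k2 : k.+2%:R != 0 :> R by rewrite pnatr_eq0.
move/eqP: H; rewrite mulNr subr_eq0 => /eqP H.
rewrite mulrA -[in RHS]mulrA [k.+2%:R^-1 * _]mulrC.
apply: (mulfI (x := k.+2%:R / b ^+ 2)); first by rewrite mulf_neq0// invr_eq0 expf_neq0// gt_eqF.
rewrite -H; move: k2; move: (k.+2%:R) (k.+1%:R) => K K1 k2; field.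
by rewrite k2 gt_eqF.
Qed.

(** The integral of (1 - u^2)^((e - 1) / 2) over [0, 1], by Wallis' recursion; the dimension is d =
    e + 2. *)
Fixpoint weight_mass (R : realType) (e : nat) : R :=
  match e with
  | 0 => pi / 2
  | 1 => 1
  | e'.+2 => weight_mass R e' * (e'.+1%:R / e'.+2%:R)
  end.

(** The number mu_m of the overview. It is the mean of xi_1^(2m) over the unit sphere of R^d. *)
Definition moment (R : fieldType) (d m : nat) : R :=
  \prod_(i < m) ((2 * i).+1%:R / (d + 2 * i)%:R).

Lemma momentS (R : fieldType) (d m : nat) :
  moment R d m.+1 = moment R d m * ((2 * m).+1%:R / (d + 2 * m)%:R).
Proof. by rewrite /moment big_ord_recr. Qed.

Lemma moment0 (R : fieldType) (d : nat) : moment R d 0 = 1.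
Proof. by rewrite /moment big_ord0. Qed.

(** The denominators of the two products differ by a shift of one index, so their quotient
    telescopes. *)
Lemma moment_dimSS (R : numFieldType) (d m : nat) : (0 < d)%N ->
  moment R d.+2 m = moment R d m * (d%:R / (d + 2 * m)%:R).
Proof.
move=> d0; elim: m => [|m IH]; first by rewrite !moment0 muln0 addn0 divff ?mulr1// pnatr_eq0; lia.
rewrite !momentS IH.
have -> : (d.+2 + 2 * m)%N = (d + 2 * m.+1)%N by lia.
by move: (_ + 2 * _)%:R^-1 (_ + 2 * _)%:R^-1 => x y; ring.
Qed.

(** At u = b > 0 both sides are 0; on the left this rests on 0 < a + 1, since powR 0 0 is 1. *)
Lemma weightSS (R : realType) (a b u : R) : 0 < a + 1 -> 0 <= u <= b ->
  weight (a + 1) b u = (1 - u ^+ 2 / b ^+ 2) * weight a b u.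
Proof.
move=> a1 /andP[u0 ub]; rewrite /weight.
have : 0 <= 1 - u ^+ 2 / b ^+ 2.
  move: ub; rewrite le_eqVlt => /predU1P[->|ub].
    have [->|b0] := eqVneq b 0; first by rewrite expr0n mul0r subr0.
    by rewrite divff ?expf_neq0// subrr.
  by apply/ltW/sub1_sqr_gt0; rewrite u0.
rewrite le_eqVlt => /predU1P[<-|X0]; first by rewrite mul0r powR0// gt_eqF.
by rewrite powRD ?(gt_eqF X0) ?implybT// powRr1 ?(ltW X0)// mulrC.
Qed.

Lemma weight_mass_gt0 (R : realType) (e : nat) : 0 < weight_mass R e.
Proof.
suff [] : 0 < weight_mass R e /\ 0 < weight_mass R e.+1 by [].
elim: e => [|e [IH1 IH2]]; first by rewrite /= ltr01 divr_gt0 ?pi_gt0.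
by split => //=; rewrite mulr_gt0// divr_gt0.
Qed.

(** Induction in steps of two: passing from d to d + 2 multiplies the weight by 1 - u^2 / b^2, so a
    new moment is a combination of two old ones. Integrability is carried along because splitting
    the integral requires it. The base cases are d = 2, the arcsine density, and d = 3, where the
    weight is constant. *)
Lemma weight_moments (R : realType) (e : nat) (b : R) : 0 < b ->
  leb.-integrable `[0, b] (EFin \o weight ((e.+2%:R - 3) / 2) b) /\
  forall m, \int[leb]_(u in `[0, b]) (u ^+ (2 * m) * weight ((e.+2%:R - 3) / 2) b u) =
    weight_mass R e * moment R e.+2 m * b ^+ (2 * m).+1.
Proof.
move=> b0.
pose Q e := leb.-integrable `[0, b] (EFin \o weight ((e.+2%:R - 3) / 2) b) /\
  forall m, \int[leb]_(u in `[0, b]) (u ^+ (2 * m) * weight ((e.+2%:R - 3) / 2) b u) =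
    weight_mass R e * moment R e.+2 m * b ^+ (2 * m).+1.
suff : Q e /\ Q e.+1 by case.
have ce k := @continuous_exprn_within R k `[0, b]%classic.
have cc c := @within_continuous_cst R `[0, b]%classic c.
elim: e => [|e [IH1 IH2]]; last first.
  split => //; case: IH1 => iw IH; rewrite /Q.
  have e3 : (e.+4%:R - 3) / 2 = (e.+2%:R - 3) / 2 + 1 :> R.
    by rewrite -[e.+4%:R]natr1 -[e.+3%:R]natr1; field.
  have e1 : 0 < (e.+2%:R - 3) / 2 + 1 :> R.
    rewrite -[e.+2%:R]natr1 -[e.+1%:R]natr1; have := ler0n R e; lra.
  have iP : {within `[0, b], continuous (fun u : R => 1 + (- b ^- 2) * u ^+ 2)}.
    apply: within_continuousD => //; exact: within_continuousM.
  have wE u : u \in `[0, b]%classic -> weight ((e.+4%:R - 3) / 2) b u =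
      (1 + (- b ^- 2) * u ^+ 2) * weight ((e.+2%:R - 3) / 2) b u.
    rewrite inE /= in_itv /= => ub; rewrite e3 weightSS//; ring.
  split.
    have := integrable_mul_weight iP iw.
    by apply: eq_integrable => // u ub; rewrite /= wE.
  move=> m.
  transitivity (\int[leb]_(u in `[0, b]) ((u ^+ (2 * m) + (- b ^- 2) * u ^+ (2 * m.+1)) * weight ((e.+2%:R - 3) / 2) b u)).
    apply: eq_Rintegral => u ub; rewrite wE// mulrA; congr (_ * _).
    by rewrite mulrDr mulr1 mulrCA -exprD mulnS addnC.
  have wm : weight_mass R e.+2 = weight_mass R e * (e.+1%:R / e.+2%:R) by [].
  rewrite Rintegral_weightD// !IH wm (@moment_dimSS _ e.+2)// (momentS _ e.+2).
  have -> : (2 * m.+1).+1 = ((2 * m).+1 + 2)%N by lia.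
  rewrite exprD.
  have k2 : (e.+2 + 2 * m)%:R != 0 :> R by rewrite pnatr_eq0; lia.
  have k3 : e.+2%:R != 0 :> R by rewrite pnatr_eq0.
  have hb : b != 0 by rewrite gt_eqF.
  have k4 : e.+1%:R = e.+2%:R - 1 :> R by rewrite -natr1; ring.
  have k5 : (2 * m).+1%:R = (e.+2 + 2 * m)%:R - e.+2%:R + 1 :> R by rewrite natrD -natr1; ring.
  rewrite k4 k5; move: k2 k3; move: (e.+2%:R) ((e.+2 + 2 * m)%:R) => K1 K2 k2 k3.
  by field; rewrite k2 k3 gt_eqF.
have h2 : (2%:R - 3) / 2 = - 2^-1 :> R by field.
have h3 : (3%:R - 3) / 2 = 0 :> R by rewrite subrr mul0r.
have w3 u : weight ((3%:R - 3) / 2) b u = 1 by rewrite h3 /weight powRr0.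
split; split; rewrite ?h2.
- by have [] := weight_arcsine b0.
- elim=> [|m IH].
    rewrite moment0 mulr1 muln0 expr1.
    under eq_Rintegral do rewrite expr0 mul1r.
    by have [_ ->] := weight_arcsine b0; rewrite mulrC.
  have -> : (2 * m.+1 = (2 * m).+2)%N by lia.
  rewrite weight_arcsine_rec// IH momentS !exprS.
  have -> : (2 * m).+2 = (2 + 2 * m)%N by lia.
  by move: (_ + _)%:R^-1 => x; ring.
- rewrite (_ : EFin \o _ = EFin \o (fun _ : R => 1)); last by apply/funext => u /=; rewrite w3.
  exact: continuous_itv_integrable.
- move=> m.
  under eq_Rintegral do rewrite w3 mulr1.
  pose P : {poly R} := (2 * m).+1%:R^-1 *: 'X^((2 * m).+1).
  have HF u : 0 <= u <= b -> is_derive u 1 (horner P) (u ^+ (2 * m)).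
    move=> _; apply: (is_derive_eq (is_derive_poly P u)).
    by rewrite /P derivZ derivXn hornerZ hornerMn hornerXn -[X in _ * X]mulr_natl mulrA mulVf ?pnatr_eq0// mul1r.
  rewrite (FTC2_Rintegral b0 HF (ce _)) /P !hornerZ !hornerXn expr0n mulr0 subr0 mul1r; congr (_ * _).
  elim: m {P HF} => [|m IH]; first by rewrite moment0 invr1.
  rewrite momentS -IH; have -> : (2 * m.+1).+1 = (3 + 2 * m)%N by lia.
  by rewrite mulrA mulVf ?mul1r// pnatr_eq0.
Qed.

(** * The Gamma function at half-integers *)

Definition gamma_fun (R : realType) (s t : R) : R := t `^ (s - 1) * expR (- t).

Lemma gamma_fun_ge0 (R : realType) (s t : R) : 0 <= gamma_fun s t.
Proof. by rewrite mulr_ge0 ?powR_ge0 ?expR_ge0. Qed.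

Lemma measurable_gamma_fun (R : realType) (s : R) (A : set R) : measurable_fun A (gamma_fun s).
Proof.
apply: measurable_funTS; apply: measurable_funM.
  exact: (@measurableT_comp _ _ _ _ _ _ (@powR R ^~ (s - 1))).
by apply: (@measurableT_comp _ _ _ _ _ _ (@expR R)).
Qed.

(** Integrated over the positive half-line, this is the functional equation of Gamma. *)
Lemma is_derive_gamma_fun (R : realType) (s t : R) : 0 < t ->
  is_derive t 1 (gamma_fun (s + 1)) (s * gamma_fun s t - gamma_fun (s + 1) t).
Proof.
move=> t0; rewrite /gamma_fun addrK.
have d1 := is_derive1_powR s t0.
have d2 : is_derive t 1 (fun t : R => expR (- t)) (- expR (- t)).
  by apply: is_derive_eq; rewrite /GRing.scale /=; ring.
apply: (is_derive_eq (is_deriveM d1 d2)).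
by rewrite /GRing.scale /=; ring.
Qed.

Lemma gamma_fun_continuous (R : realType) (s a b : R) : 0 < a ->
  {within `[a, b], continuous gamma_fun s}.
Proof.
move=> a0; apply: (@derivable_within_continuous _ _ _ `[a, b]) => u.
rewrite in_itv /= => /andP[u0 uy].
have := @is_derive_gamma_fun R (s - 1) u; rewrite subrK => -[] //.
by apply: lt_le_trans u0.
Qed.

(** The exponent [k] is there for the substitution t = x^2, which carries the exhaustion for k = 1
    to the one for k = 2. *)
Lemma positive_line_exhaustion (R : realType) (k : nat) (f : R -> R) : (0 < k)%N ->
  measurable_fun setT f -> (forall t, 0 <= f t) ->
  (\int[leb]_(t in `[(n.+2%:R ^- k)%R, (n.+2%:R ^+ k)%R]) (f t)%:E)%E @[n --> \oo] -->
  (\int[leb]_(t in `]0%R, +oo[) (f t)%:E)%E.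
Proof.
move=> k0 mf f0.
pose F (n : nat) : set R := `[n.+2%:R ^- k, n.+2%:R ^+ k]%classic.
have nk n : n.+2%:R <= n.+2%:R ^+ k :> R.
  by rewrite -[X in X <= _]expr1 ler_weXn2l// ler1n.
have FU : \bigcup_n F n = `]0, +oo[%classic.
  apply/seteqP; split => t /=.
    move=> [n _]; rewrite /F /= !in_itv /= andbT => /andP[t0 _].
    by apply: lt_le_trans t0; rewrite invr_gt0 exprn_gt0.
  rewrite in_itv /= andbT => t0.
  pose N := (Num.bound t + Num.bound t^-1)%N.
  exists N => //; rewrite /F /= in_itv /=.
  have h1 : t < (Num.bound t)%:R by apply: archi_boundP; exact: ltW.
  have h2 : t^-1 < (Num.bound t^-1)%:R by apply: archi_boundP; rewrite invr_ge0 ltW.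
  have h3 : N%:R <= N.+2%:R :> R by rewrite ler_nat; lia.
  have := nk N.
  move: h3; rewrite {1}/N natrD => h3 h6.
  have h4 := ler0n R (Num.bound t); have h5 := ler0n R (Num.bound t^-1).
  apply/andP; split; last by lra.
  rewrite -[X in _ <= X]invrK lef_pV2 ?posrE ?invr_gt0 ?exprn_gt0//; lra.
rewrite -FU; apply: ge0_nondecreasing_set_cvg_integral.
- move=> n m nm; apply/subsetPset => u; rewrite /F /= !in_itv /= => /andP[h1 h2]; apply/andP; split.
    by apply: le_trans h1; rewrite lef_pV2 ?posrE ?exprn_gt0// lerXn2r ?nnegrE// ler_nat.
  by apply: (le_trans h2); rewrite lerXn2r ?nnegrE// ler_nat.
- by move=> n; exact: measurable_itv.
- by move=> n; apply/measurable_EFinP; exact: measurable_funTS.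
- by move=> n x _; rewrite lee_fin.
Qed.

Lemma invn_pow_lt (R : realType) (k n : nat) : (0 < k)%N -> n.+2%:R ^- k < n.+2%:R ^+ k :> R.
Proof.
move=> k0; apply: (@lt_trans _ _ 1).
  by rewrite invf_lt1 ?exprn_gt0// exprn_egt1 ?ltr1n// -lt0n.
by rewrite exprn_egt1 ?ltr1n// -lt0n.
Qed.

(** Stated with the extended integral, so that finiteness is part of it; in [Gamma] an infinite
    integral would become a default value. *)
Definition Gamma_value (R : realType) (s g : R) :=
  (\int[leb]_(t in `]0%R, +oo[) (gamma_fun s t)%:E = g%:E)%E.

Lemma Gamma_valueE (R : realType) (s g : R) : Gamma_value s g -> Gamma s = g.
Proof. by move=> H; rewrite /Gamma /Rintegral H. Qed.

(** For m >= s - 1, the bound e^t >= t^(m+1) / (m+1)! makes the integrand O(1/t). *)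
Lemma gamma_fun_at_infinity (R : realType) (s : R) :
  gamma_fun s n.+2%:R @[n --> \oo] --> (0 : R).
Proof.
pose m := Num.bound `|s - 1|.
have sm : s - 1 <= m%:R.
  by apply: (le_trans (ler_norm _)); apply/ltW/archi_boundP.
have H n : 0 <= gamma_fun s (n.+2%:R : R) <= (m.+1)`!%:R * n.+1%:R^-1.
  rewrite gamma_fun_ge0 /=.
  set t : R := n.+2%:R.
  have t0 : 0 < t by rewrite ltr0n.
  have t1 : 1 <= t by rewrite ler1n.
  have h1 : t `^ (s - 1) <= t ^+ m by rewrite -powR_mulrn ?(ltW t0)//; apply: ler_powR.
  have h2 : t ^+ m.+1 <= (m.+1)`!%:R * expR t.
    have := expR_ge1Dxn m (ltW t0).
    have f0 : 0 < (m.+1)`!%:R :> R by rewrite ltr0n fact_gt0.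
    move=> h; have {h} : t ^+ m.+1 / (m.+1)`!%:R <= expR t by lra.
    by rewrite ler_pdivrMr// mulrC.
  rewrite /gamma_fun -/t expRN ler_pdivrMr ?expR_gt0//.
  apply: (le_trans h1).
  have h4 : n.+1%:R <= t by rewrite ler_nat.
  rewrite mulrAC ler_pdivlMr ?ltr0n//; apply: le_trans h2; rewrite exprSr.
  by rewrite ler_pM2l ?exprn_gt0.
apply: (@squeeze_cvgr _ _ _ _ (fun=> 0) (fun n => (m.+1)`!%:R * harmonic n)).
- by near=> n; exact: H.
- exact: cvg_cst.
- by rewrite -[X in _ --> X](mulr0 (m.+1)`!%:R); apply: cvgMl_tmp; exact: cvg_harmonic.
Unshelve. all: by end_near.
Qed.

Lemma gamma_fun_at_zero (R : realType) (s : R) : 2^-1 <= s ->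
  gamma_fun (s + 1) n.+2%:R^-1 @[n --> \oo] --> (0 : R).
Proof.
move=> s2.
have H n : 0 <= gamma_fun (s + 1) (n.+2%:R^-1 : R) <= Num.sqrt (harmonic n).
  rewrite gamma_fun_ge0 /= /gamma_fun addrK.
  have t0 : 0 < n.+2%:R^-1 :> R by rewrite invr_gt0.
  have h1 : n.+2%:R^-1 `^ s <= n.+2%:R^-1 `^ 2^-1 :> R.
    by apply: ger_powR => //; rewrite t0 invf_le1 ?ler1n.
  rewrite powR12_sqrt ?(ltW t0)// in h1.
  apply: (@le_trans _ _ (n.+2%:R^-1 `^ s)).
    by rewrite ler_piMr ?powR_ge0// -expR0 ler_expR; lra.
  by apply: (le_trans h1); rewrite ler_wsqrtr// /harmonic/= lef_pV2 ?posrE// ler_nat.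
apply: (@squeeze_cvgr _ _ _ _ (fun=> 0) (fun n => Num.sqrt (harmonic n))).
- by near=> n; exact: H.
- exact: cvg_cst.
- rewrite -[X in _ --> X]sqrtr0; apply: continuous_cvg; [exact: sqrt_continuous|exact: cvg_harmonic].
Unshelve. all: by end_near.
Qed.

Lemma Gamma_value_one (R : realType) : Gamma_value (1 : R) 1.
Proof.
have g1 (t : R) : gamma_fun 1 t = expR (- t) by rewrite /gamma_fun subrr powRr0 mul1r.
have := positive_line_exhaustion (k := 1) isT (@measurable_gamma_fun R 1 setT) (gamma_fun_ge0 1).
have IF n : (\int[leb]_(t in `[(n.+2%:R ^- 1)%R, (n.+2%:R ^+ 1)%R]) (gamma_fun 1 t)%:E =
  (gamma_fun 1 n.+2%:R^-1 - gamma_fun 1 (n.+2%:R : R))%:E)%E.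
  have HF : forall t : R, n.+2%:R ^- 1 <= t <= n.+2%:R ^+ 1 ->
      is_derive t 1 (fun t => - gamma_fun 1 t) (gamma_fun 1 t).
    move=> t /andP[t0 _].
    have {}t0 : 0 < t by apply: lt_le_trans t0; rewrite invr_gt0 exprn_gt0.
    have := @is_derive_gamma_fun R 0 t t0; rewrite add0r mul0r sub0r => d1.
    apply: (is_derive_eq (is_deriveN d1)); exact: opprK.
  rewrite (FTC2_is_derive (invn_pow_lt R n (ltn0Sn 0)) HF).
    by rewrite !expr1 opprK addrC.
  by apply: gamma_fun_continuous; rewrite invr_gt0 exprn_gt0.
under eq_fun do rewrite IF.
move=> H; apply: (cvg_unique _ H); first exact: ereal_hausdorff.
apply: cvg_EFin; first by near=> n.
rewrite -[X in _ --> X]subr0; apply: cvgB; last exact: gamma_fun_at_infinity.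
under eq_fun do rewrite g1.
have h : expR (- (n.+2%:R^-1 : R)) @[n --> \oo] --> expR (- 0 : R).
  apply: continuous_cvg; first exact: continuous_expR.
  by apply: cvgN; have := @cvg_harmonic R; rewrite -cvg_shiftS.
by move: h; rewrite oppr0 expR0.
Unshelve. all: by end_near.
Qed.

Lemma Gamma_valueS (R : realType) (s g : R) : 2^-1 <= s ->
  Gamma_value s g -> Gamma_value (s + 1) (s * g).
Proof.
move=> s2 Hg.
have s0 : 0 < s by lra.
have H1 := positive_line_exhaustion (k := 1) isT (@measurable_gamma_fun R (s + 1) setT) (gamma_fun_ge0 (s + 1)).
have H2 := positive_line_exhaustion (k := 1) isT (@measurable_gamma_fun R s setT) (gamma_fun_ge0 s).
rewrite Hg in H2.
have n0 n : 0 < n.+2%:R ^- 1 :> R by rewrite invr_gt0 exprn_gt0.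
have cg c n : {within `[(n.+2%:R ^- 1 : R), n.+2%:R ^+ 1], continuous gamma_fun c}.
  exact: gamma_fun_continuous.
have EF c n : (\int[leb]_(t in `[(n.+2%:R ^- 1)%R, (n.+2%:R ^+ 1)%R]) (gamma_fun c t)%:E)%E =
   (\int[leb]_(t in `[(n.+2%:R ^- 1 : R), n.+2%:R ^+ 1]) gamma_fun c t)%:E.
  rewrite /Rintegral fineK//; apply: integrable_fin_num => //; exact: continuous_itv_integrable.
have IF n : \int[leb]_(t in `[(n.+2%:R ^- 1 : R), n.+2%:R ^+ 1]) (gamma_fun (s + 1) t) =
  s * \int[leb]_(t in `[(n.+2%:R ^- 1 : R), n.+2%:R ^+ 1]) gamma_fun s t
  + (gamma_fun (s + 1) n.+2%:R^-1 - gamma_fun (s + 1) n.+2%:R).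
  have HF : forall t : R, n.+2%:R ^- 1 <= t <= n.+2%:R ^+ 1 ->
      is_derive t 1 (gamma_fun (s + 1)) (s * gamma_fun s t - gamma_fun (s + 1) t).
    by move=> t /andP[t0 _]; apply: is_derive_gamma_fun; apply: lt_le_trans t0.
  have := FTC2_Rintegral (invn_pow_lt R n (ltn0Sn 0)) HF.
  rewrite RintegralB//; last exact: continuous_itv_integrable.
    rewrite RintegralZl//; last exact: continuous_itv_integrable.
    have h1 : {within `[(n.+2%:R ^- 1 : R), n.+2%:R ^+ 1], continuous (fun t => s * gamma_fun s t)}.
      by apply: within_continuousM => //; exact: within_continuous_cst.
    have h2 : {within `[(n.+2%:R ^- 1 : R), n.+2%:R ^+ 1], continuous (fun t => s * gamma_fun s t - gamma_fun (s + 1) t)}.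
      by move=> u; apply: cvgB; [exact: h1|exact: cg].
    by move=> /(_ h2) h; rewrite !expr1 in h *; rewrite -(opprB (gamma_fun (s + 1) n.+2%:R)) -h; ring.
  apply: continuous_itv_integrable; apply: within_continuousM => //; exact: within_continuous_cst.
move: H1; under eq_fun do rewrite EF.
move: H2; under eq_fun do rewrite EF.
move=> /fine_cvg; rewrite /= => H2.
under eq_fun do rewrite IF.
move=> H1; apply: (cvg_unique _ H1); first exact: ereal_hausdorff.
apply: cvg_EFin; first by near=> n.
rewrite -[X in _ --> X]addr0; apply: cvgD; first by apply: cvgMl_tmp.
rewrite -[X in _ --> X]subr0; apply: cvgB; [exact: gamma_fun_at_zero|exact: gamma_fun_at_infinity].
Unshelve. all: by end_near.
Qed.

(** The substitution t = x^2 turns the integrand into twice the Gaussian function. *)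
Lemma Gamma_value_half (R : realType) : Gamma_value (2^-1 : R) (Num.sqrt pi).
Proof.
have H1 := positive_line_exhaustion (k := 2) isT (@measurable_gamma_fun R 2^-1 setT) (gamma_fun_ge0 2^-1).
have H2 := positive_line_exhaustion (k := 1) isT (@measurable_gauss_fun R) (@gauss_fun_ge0 R).
have : (\int[leb]_(t in `]0%R, +oo[) (@gauss_fun R t)%:E = (Num.sqrt pi / 2)%:E)%E.
  rewrite -integral0y_gauss integral_itv_obnd_cbnd//.
  by apply/measurable_EFinP; apply: measurable_funTS; exact: measurable_gauss_fun.
move=> G; rewrite G in H2.
have SUB (a b : R) : 0 < a -> a < b ->
  (\int[leb]_(t in `[(a ^+ 2)%R, (b ^+ 2)%R]) (gamma_fun 2^-1 t)%:E =
  2%:E * \int[leb]_(t in `[a, b]) (@gauss_fun R t)%:E)%E.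
  move=> a0 ab.
  have dF (x : R) : is_derive x 1 (fun x : R => x ^+ 2) (2 * x).
    by apply: is_derive_eq; rewrite /GRing.scale /=; ring.
  have F' : (fun x : R => x ^+ 2)^`()%classic = (fun x => 2 * x).
    by apply/funext => x; rewrite derive1E; have [_] := dF x.
  have cF (x : R) : {for x, continuous (fun x : R => x ^+ 2)} by exact: exprn_continuous.
  have cF' (x : R) : {for x, continuous (fun x : R => 2 * x)}.
    by apply: cvgMl_tmp; exact: cvg_id.
  rewrite (@integration_by_substitution_increasing _ (fun x : R => x ^+ 2) _ a b (ltW ab)).
  - rewrite -ge0_integralZl//=.
    + apply: eq_integral => x; rewrite inE /= in_itv /= => /andP[ax xb].
      have x0 : 0 < x by apply: lt_le_trans ax.
      rewrite F' -EFinM; congr (_%:E).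
      rewrite /gamma_fun /gauss_fun (_ : 2^-1 - 1 = - 2^-1 :> R); last by field.
      transitivity ((x ^+ 2) `^ (- 2^-1) * expR (- x ^+ 2) * (2 * x)) => //.
      rewrite powRN powR12_sqrt ?sqr_ge0// sqrtr_sqr gtr0_norm//.
      by field; rewrite gt_eqF.
    + by apply/measurable_EFinP; apply: measurable_funTS; exact: measurable_gauss_fun.
    + by move=> x _; rewrite lee_fin gauss_fun_ge0.
  - move=> x y; rewrite !in_itv /= => /andP[x0 _] /andP[y0 _] xy.
    by rewrite ltrXn2r ?nnegrE//; apply: le_trans (ltW a0) _.
  - by move=> x _; rewrite F'; exact: cF'.
  - by rewrite F'; apply/cvg_ex; exists (2 * a); apply: cvg_at_right_filter; exact: cF'.
  - by rewrite F'; apply/cvg_ex; exists (2 * b); apply: cvg_at_left_filter; exact: cF'.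
  - split; [|by apply: cvg_at_right_filter; exact: cF|by apply: cvg_at_left_filter; exact: cF].
    by move=> x _; have [] := dF x.
  - by apply: gamma_fun_continuous; rewrite exprn_gt0.
have IF n := SUB _ _ _ (invn_pow_lt R n (ltn0Sn 0)).
move: H1; under eq_fun => n.
  have -> : n.+2%:R ^- 2 = (n.+2%:R ^- 1) ^+ 2 :> R by rewrite expr1 exprVn.
  have -> : n.+2%:R ^+ 2 = (n.+2%:R ^+ 1) ^+ 2 :> R by rewrite expr1.
  rewrite IF ?invr_gt0 ?exprn_gt0//.
  over.

move=> H1; apply: (cvg_unique _ H1); first exact: ereal_hausdorff.
rewrite (_ : (Num.sqrt pi)%:E = (2%:E * (Num.sqrt pi / 2)%:E)%E); last first.
  by rewrite -EFinM mulrC divfK.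
exact: cvgeZl.
Qed.

Lemma Gamma_half_integer (R : realType) (k : nat) :
  exists2 g : R, 0 < g & Gamma_value (k.+1%:R / 2) g.
Proof.
suff [] : (exists2 g : R, 0 < g & Gamma_value (k.+1%:R / 2) g) /\
  (exists2 g : R, 0 < g & Gamma_value (k.+2%:R / 2) g) by [].
elim: k => [|k [[g g0 IH1] IH2]].
  split; first by exists (Num.sqrt pi); [rewrite sqrtr_gt0 pi_gt0|rewrite mul1r; exact: Gamma_value_half].
  by exists 1 => //; rewrite divff//; exact: Gamma_value_one.
split => //; exists (k.+1%:R / 2 * g); first by rewrite mulr_gt0// divr_gt0.
have -> : k.+3%:R / 2 = k.+1%:R / 2 + 1 :> R by rewrite -[k.+3%:R]natr1 -[k.+2%:R]natr1; field.
apply: Gamma_valueS => //.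
rewrite -[X in X <= _]mul1r ler_pM2r ?invr_gt0//; by rewrite ler1n.
Qed.

Lemma GammaS_half_integer (R : realType) (k : nat) :
  Gamma (k.+3%:R / 2 : R) = k.+1%:R / 2 * Gamma (k.+1%:R / 2 : R).
Proof.
have [g g0 H] := Gamma_half_integer R k.
have -> : k.+3%:R / 2 = k.+1%:R / 2 + 1 :> R by rewrite -[k.+3%:R]natr1 -[k.+2%:R]natr1; field.
have k2 : 2^-1 <= k.+1%:R / 2 :> R.
  rewrite -[X in X <= _]mul1r ler_pM2r ?invr_gt0//; by rewrite ler1n.
by rewrite (Gamma_valueE (Gamma_valueS k2 H)) (Gamma_valueE H).
Qed.

Lemma Gamma_half_integer_gt0 (R : realType) (k : nat) : 0 < Gamma (k.+1%:R / 2 : R).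
Proof. by have [g g0 /Gamma_valueE ->] := Gamma_half_integer R k. Qed.

(** Makes the lift an average against a probability density. When d grows by 2, the Gamma quotient
    and [weight_mass] change by reciprocal factors; d = 2 and d = 3 are computed directly. *)
Lemma lift_constant_mass (R : realType) (e : nat) :
  2 * Gamma (e.+2%:R / 2 : R) / (Num.sqrt pi * Gamma ((e.+2%:R - 1) / 2 : R)) * weight_mass R e = 1.
Proof.
have -> : (e.+2%:R - 1) = e.+1%:R :> R by rewrite -natr1; ring.
have sp : Num.sqrt pi != 0 :> R by rewrite gt_eqF// sqrtr_gt0 pi_gt0.
have G1 : Gamma (1 : R) = 1 by exact: Gamma_valueE (Gamma_value_one R).
have G2 : Gamma (2^-1 : R) = Num.sqrt pi by exact: Gamma_valueE (Gamma_value_half R).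
pose Q e := 2 * Gamma (e.+2%:R / 2 : R) / (Num.sqrt pi * Gamma (e.+1%:R / 2 : R)) * weight_mass R e = 1.
suff [] : Q e /\ Q e.+1 by [].
have k2 k : k.+1%:R != 0 :> R by rewrite pnatr_eq0.
elim: e => [|e [IH1 IH2]]; last first.
  split => //; rewrite /Q !GammaS_half_integer; apply: etrans IH1 => /=.
  have g0 := Gamma_half_integer_gt0 R e.
  have gn0 : Gamma (e.+1%:R / 2 : R) != 0 by rewrite gt_eqF.
  move: gn0 sp (k2 e) (k2 e.+1).
  move: (Gamma (e.+1%:R / 2)) (Gamma (e.+2%:R / 2)) => y z.
  move: (Num.sqrt pi) (e.+1%:R) (e.+2%:R) (weight_mass R e) => p a b w hy hp ha hb; field.
  by rewrite ha hb hy hp.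
have G3 : Gamma (3%:R / 2 : R) = 2^-1 * Num.sqrt pi by rewrite (GammaS_half_integer R 0) mul1r G2.
have hp : Num.sqrt pi ^+ 2 = pi :> R by rewrite sqr_sqrtr// pi_ge0.
split; rewrite /Q /=.
  have -> : pi / 2 = Num.sqrt pi ^+ 2 / 2 :> R by rewrite hp.
  rewrite divff// mul1r G1 G2; move: (Num.sqrt pi) sp => p hp0; by field.
by rewrite G3 divff// G1; field.
Qed.

(** * The lift on even polynomials *)

Definition even_apply (R : fieldType) (mu : nat -> R) (P : {poly R}) (x : R) : R :=
  \sum_(m < size P) P`_m * mu m * x ^+ (2 * m).

Lemma Rintegral_weight_sum (R : realType) (w : R -> R) (a b : R) (n : nat) (c : nat -> R) (f : nat -> R -> R) :
  leb.-integrable `[a, b] (EFin \o w) ->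
  (forall m, {within `[a, b], continuous f m}) ->
  \int[leb]_(u in `[a, b]) ((\sum_(m < n) c m * f m u) * w u) =
  \sum_(m < n) c m * \int[leb]_(u in `[a, b]) (f m u * w u).
Proof.
move=> iw cf.
have cs k : {within `[a, b], continuous (fun u => \sum_(m < k) c m * f m u)}.
  elim: k => [|k IH].
    by under [X in {within _, continuous X}]eq_fun do rewrite big_ord0; exact: within_continuous_cst.
  under [X in {within _, continuous X}]eq_fun do rewrite big_ord_recr.
  apply: within_continuousD => //; apply: within_continuousM => //; exact: within_continuous_cst.
elim: n => [|n IH].
  rewrite big_ord0; under eq_Rintegral do rewrite big_ord0 mul0r.
  by rewrite Rintegral_cst//= mul0r.
under eq_Rintegral do rewrite big_ord_recr.
by rewrite Rintegral_weightD// IH big_ord_recr.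
Qed.

Lemma le_Rintegral_weight (R : realType) (w f : R -> R) (a b eta : R) :
  leb.-integrable `[a, b] (EFin \o w) -> (forall u, 0 <= w u) ->
  {within `[a, b], continuous f} -> (forall u, a <= u <= b -> `|f u| <= eta) ->
  `|\int[leb]_(u in `[a, b]) (f u * w u)| <= eta * \int[leb]_(u in `[a, b]) w u.
Proof.
move=> iw w0 cf feta.
have ifw := integrable_mul_weight cf iw.
apply: (le_trans (le_normr_Rintegral _ ifw)); first exact: measurable_itv.
rewrite -RintegralZl//; apply: le_Rintegral => //.
- exact: integrable_norm.
- by apply: integrable_mul_weight => //; exact: within_continuous_cst.
- move=> u /=; rewrite in_itv /= => ub; rewrite normrM (ger0_norm (w0 u)).
  by rewrite ler_wpM2r// feta.
Qed.

Lemma dimension_liftE (R : realType) (e : nat) (phi : R * R -> R) (x t : R) : 0 < x < 1 -> 0 <= t ->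
  dimension_lift e.+2 phi (x, t) =
  (weight_mass R e * x)^-1 * \int[leb]_(u in `[0, x]) (phi (u, t) * weight ((e.+2%:R - 3) / 2) x u).
Proof.
move=> /andP[x0 x1] t0; rewrite /dimension_lift patchE /= mem_set; last by rewrite /strip /= (ltW x0).
rewrite gt_eqF// -mulrA; have := lift_constant_mass R e.
have m0 := weight_mass_gt0 R e; move: (_ / (_ * Gamma _)) => c h.
have -> : c = (weight_mass R e)^-1 by apply: (mulIf (x := weight_mass R e)); rewrite ?gt_eqF// h mulVf// gt_eqF.
by rewrite [(weight_mass R e * x)^-1]invfM -[RHS]mulrA.
Qed.

Lemma dimension_lift0 (R : realType) (d : nat) (phi : R * R -> R) (t : R) : 0 <= t ->
  dimension_lift d phi (0, t) = phi (0, t).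
Proof. by move=> t0; rewrite /dimension_lift patchE /= mem_set ?eqxx// /strip /= lexx ltr01. Qed.

(** Being an average, the lift does not increase the sup norm over [0, x], and by [weight_moments]
    it multiplies u^(2m) by mu_m. At x = 0 both sides reduce to values at 0, because mu_0 = 1. *)
Lemma dimension_lift_approx (R : realType) (d : nat) (phi : R * R -> R) (x t eta : R) (P : {poly R}) :
  (2 <= d)%N -> 0 <= x < 1 -> 0 <= t ->
  {within `[0, x], continuous (fun u => phi (u, t))} ->
  (forall u, 0 <= u <= x -> `|phi (u, t) - P.[u ^+ 2]| <= eta) ->
  `|dimension_lift d phi (x, t) - even_apply (moment R d) P x| <= eta.
Proof.
case: d => [|[|e]]// _ /andP[x0 x1] t0 cphi H.
move: x0; rewrite le_eqVlt => /predU1P[x0|x0].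
  subst x; rewrite dimension_lift0//; have := H 0; rewrite lexx expr0n => /(_ isT).
  suff -> : even_apply (moment R e.+2) P 0 = P.[0] by [].
  rewrite /even_apply horner_coef0; case: (size P) (nth_default 0 (s := P)) => [|n].
    by rewrite big_ord0 => /(_ 0) ->.
  move=> _; rewrite big_ord_recl moment0 muln0 expr0 !mulr1 big1 ?addr0// => i _.
  by rewrite expr0n mulr0.
have [iw mw] := weight_moments e x0.
have m0 := weight_mass_gt0 R e.
have mx0 : 0 < weight_mass R e * x by rewrite mulr_gt0.
have hP : even_apply (moment R e.+2) P x =
   (weight_mass R e * x)^-1 * \int[leb]_(u in `[0, x]) (P.[u ^+ 2] * weight ((e.+2%:R - 3) / 2) x u).
  under eq_Rintegral do rewrite horner_coef.
  transitivity ((weight_mass R e * x)^-1 * \int[leb]_(u in `[0, x])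
     ((\sum_(m < size P) P`_m * u ^+ (2 * m)) * weight ((e.+2%:R - 3) / 2) x u)).
    rewrite (@Rintegral_weight_sum _ _ 0 x _ (fun m => P`_m) (fun m u => u ^+ (2 * m)) iw); last by move=> m; exact: continuous_exprn_within.
    rewrite mulr_sumr; apply: eq_bigr => m _; rewrite mw exprS.
    field; by rewrite !gt_eqF.
  congr (_ * _); apply: eq_Rintegral => u _; congr (_ * _).
  by apply: eq_bigr => m _; rewrite exprM.
have cP : {within `[0, x], continuous (fun u : R => P.[u ^+ 2])}.
  by apply: continuous_subspaceT => u; apply: (@continuous_comp _ _ _ (fun u : R => u ^+ 2) (horner P)); [exact: exprn_continuous|exact: continuous_horner].
rewrite hP dimension_liftE ?x0// -mulrBr -RintegralB//; first last.
- exact: integrable_mul_weight.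
- exact: integrable_mul_weight.
under eq_Rintegral do rewrite -mulrBl.
have cd : {within `[0, x], continuous (fun u => phi (u, t) - P.[u ^+ 2])}.
  by move=> u; apply: cvgB; [exact: cphi|exact: cP].
rewrite normrM gtr0_norm ?invr_gt0// mulrC ler_pdivrMr//.
have -> : weight_mass R e * x = \int[leb]_(u in `[0, x]) weight ((e.+2%:R - 3) / 2) x u.
  have := mw 0%N; rewrite moment0 mulr1 muln0 expr1 => <-.
  by apply: eq_Rintegral => u _; rewrite expr0 mul1r.
by apply: le_Rintegral_weight => // u; exact: weight_ge0.
Qed.

(** * Multipliers given by bounded signed measures *)

Lemma cvgn_ext (R : realType) (u v : nat -> R) (l : R) : u =1 v ->
  u n @[n --> \oo] --> l -> v n @[n --> \oo] --> l.
Proof. by move=> /funext ->. Qed.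

(* A finitely supported signed measure is a list of pairs (weight, node). *)
Definition wsum (R : pzRingType) (T : Type) (l : seq (R * T)) (f : T -> R) : R :=
  \sum_(p <- l) p.1 * f p.2.

(** Integrating the Bernstein polynomial of f instead of f gives the nodes k/n, weighted by the
    integrals of the basis polynomials against [w]. These weights are nonnegative and have the total
    mass of [w] for every n. *)
Lemma weight_realization (R : realType) (w : R -> R) :
  leb.-integrable `[0, 1] (EFin \o w) -> (forall u, 0 <= w u) ->
  exists l : nat -> seq (R * R),
    [/\ forall n p, p \in l n -> 0 <= p.1 /\ 0 <= p.2 <= 1,
        forall n, wsum (l n) (fun=> 1) = \int[leb]_(u in `[0, 1]) w u &
        forall f : R -> R, {within `[0, 1], continuous f} ->
          wsum (l n) f @[n --> \oo] --> \int[leb]_(u in `[0, 1]) (f u * w u)].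
Proof.
move=> iw w0.
pose I (f : R -> R) := \int[leb]_(u in `[0, 1]) (f u * w u).
have cb n k : {within `[0, 1], continuous (fun u : R => bernstein n k u)}.
  rewrite (_ : (fun u => _) = horner (bernstein n k 'X)).
    by apply: continuous_subspaceT; exact: continuous_horner.
  by apply/funext => u; rewrite horner_bernstein.
have IE n (f : R -> R) : I (fun u => \sum_(k < n.+1) f (k%:R / n%:R) * bernstein n k u) =
   \sum_(k < n.+1) f (k%:R / n%:R) * I (bernstein n k).
  exact: (@Rintegral_weight_sum _ _ 0 1 _ (fun k => f (k%:R / n%:R)) (fun k u => bernstein n k u) iw (cb n)).
pose l (n : nat) : seq (R * R) := [seq (I (bernstein n k), (k%:R / n%:R)) | k <- index_iota 0 n.+1].
have lE n (f : R -> R) : wsum (l n) f = \sum_(k < n.+1) f (k%:R / n%:R) * I (bernstein n k).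
  by rewrite /wsum big_map big_mkord; apply: eq_bigr => k _; rewrite mulrC.
exists l; split.
- move=> n p /mapP[k]; rewrite mem_index_iota => /andP[_ kn] -> /=; split.
    apply: Rintegral_ge0 => u /=; rewrite in_itv /= => u01.
    by rewrite mulr_ge0 ?w0 ?bernstein_ge0.
  rewrite divr_ge0//=; case: n kn => [|n] kn; first by rewrite invr0 mulr0.
  by rewrite ler_pdivrMr ?ltr0n// mul1r ler_nat.
- move=> n; rewrite lE -(IE n (fun=> 1)); apply: eq_Rintegral => u _.
  under eq_bigr do rewrite mul1r.
  by rewrite bernstein_sum1 mul1r.
- move=> f cf; apply/cvgrPdist_le => e e0.
  pose W := \int[leb]_(u in `[0, 1]) w u.
  have W0 : 0 <= W by apply: Rintegral_ge0.
  (* [W] may be 0, hence the denominator [W + 1]. *)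
  have e1 : 0 < e / (W + 1) by rewrite divr_gt0//; lra.
  have [n0 Hn0] := bernstein_cvg cf e1.
  exists n0 => // n /= n0n; rewrite lE -IE.
  have cB : {within `[0, 1], continuous (fun u : R => \sum_(k < n.+1) f (k%:R / n%:R) * bernstein n k u)}.
    rewrite (_ : (fun u => _) = horner (\sum_(k < n.+1) f (k%:R / n%:R) *: bernstein n k 'X)).
      by apply: continuous_subspaceT; exact: continuous_horner.
    apply/funext => u; rewrite horner_sum; apply: eq_bigr => k _.
    by rewrite hornerZ horner_bernstein.
  rewrite -RintegralB//; [|exact: integrable_mul_weight|exact: integrable_mul_weight].
  under eq_Rintegral do rewrite -mulrBl.
  apply: (@le_trans _ _ (e / (W + 1) * W)).
    apply: le_Rintegral_weight => //; last by move=> u; exact: Hn0.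
    by move=> u; apply: cvgB; [exact: cf|exact: cB].
  rewrite -mulrA ler_piMr ?(ltW e0)// mulrC ler_pdivrMr; lra.
Qed.

(** The moment sequences of signed measures on [-1, 1], a measure being given as a limit of finitely
    supported ones of uniformly bounded variation. *)
Definition bounded_moments (R : realType) (a : nat -> R) : Prop :=
  exists (l : nat -> seq (R * R)) (C : R),
    [/\ forall n, \sum_(p <- l n) `|p.1| <= C,
        forall n p, p \in l n -> `|p.2| <= 1 &
        forall j, wsum (l n) (fun s => s ^+ j) @[n --> \oo] --> a j].

Lemma bounded_moments_ext (R : realType) (a b : nat -> R) : a =1 b -> bounded_moments a -> bounded_moments b.
Proof. by move=> /funext ->. Qed.

Lemma bounded_moments1 (R : realType) : bounded_moments (fun _ => 1 : R).
Proof.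
exists (fun _ => [:: (1, 1)]), 1; split=> [n|n p|j].
- by rewrite big_seq1 normr1.
- by rewrite inE => /eqP -> /=; rewrite normr1.
- by under eq_fun do rewrite /wsum big_seq1 expr1n mulr1; exact: cvg_cst.
Qed.

(** The multiplicative convolution of the two measures. *)
Lemma bounded_momentsM (R : realType) (a b : nat -> R) : bounded_moments a -> bounded_moments b ->
  bounded_moments (fun j => a j * b j).
Proof.
move=> [l [C [lC l1 la]]] [k [D [kD k1 kb]]].
exists (fun n => [seq (p.1 * q.1, p.2 * q.2) | p <- l n, q <- k n]), (C * D); split=> [n|n p|j].
- rewrite big_allpairs_dep /=.
  under eq_bigr => p _ do under eq_bigr do rewrite normrM.
  under eq_bigr do rewrite -mulr_sumr.
  rewrite -mulr_suml; apply: ler_pM => //.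
  + by apply: sumr_ge0.
  + by apply: sumr_ge0.
- move=> /allpairsP[[u v] /= [ul vk ->]] /=; rewrite normrM.
  by rewrite mulr_ile1//; [exact: l1 ul|exact: k1 vk].
- apply: cvgn_ext (cvgM (la j) (kb j)) => n.
  rewrite /wsum big_allpairs_dep /= mulr_suml; apply: eq_bigr => p _.
  by rewrite mulr_sumr; apply: eq_bigr => q _; rewrite exprMn; ring.
Qed.

Lemma bounded_momentsD (R : realType) (a b : nat -> R) : bounded_moments a -> bounded_moments b ->
  bounded_moments (fun j => a j + b j).
Proof.
move=> [l [C [lC l1 la]]] [k [D [kD k1 kb]]].
exists (fun n => l n ++ k n), (C + D); split=> [n|n p|j].
- by rewrite big_cat lerD.
- by rewrite mem_cat => /orP[]; [exact: l1|exact: k1].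
- apply: cvgn_ext (cvgD (la j) (kb j)) => n.
  by rewrite /wsum big_cat.
Qed.

Lemma bounded_momentsZ (R : realType) (c : R) (a : nat -> R) : bounded_moments a -> bounded_moments (fun j => c * a j).
Proof.
move=> [l [C [lC l1 la]]].
exists (fun n => [seq (c * p.1, p.2) | p <- l n]), (`|c| * C); split=> [n|n p|j].
- rewrite big_map /=; under eq_bigr do rewrite normrM.
  by rewrite -mulr_sumr ler_wpM2l.
- by move=> /mapP[q ql -> /=]; exact: l1 ql.
- apply: cvgn_ext (cvgM (cvg_cst c) (la j)) => n.
  by rewrite /wsum big_map mulr_sumr; apply: eq_bigr => p _ /=; rewrite mulrA.
Qed.

(** The measure is multiplied by its variable, which is at most 1 in absolute value. *)
Lemma bounded_moments_shift (R : realType) (a : nat -> R) : bounded_moments a -> bounded_moments (fun j => a j.+1).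
Proof.
move=> [l [C [lC l1 la]]].
exists (fun n => [seq (p.1 * p.2, p.2) | p <- l n]), C; split=> [n|n p|j].
- apply: le_trans (lC n); rewrite big_map /= big_seq [X in _ <= X]big_seq; apply: ler_sum => p pl.
  by rewrite normrM ler_piMr//; exact: l1 pl.
- by move=> /mapP[q ql -> /=]; exact: l1 ql.
- apply: cvgn_ext (la j.+1) => n.
  by rewrite /wsum big_map; apply: eq_bigr => p _ /=; rewrite exprS mulrA.
Qed.

Lemma bounded_moments_reflect (R : realType) (a : nat -> R) : bounded_moments a -> bounded_moments (fun j => (-1) ^+ j * a j).
Proof.
move=> [l [C [lC l1 la]]].
exists (fun n => [seq (p.1, - p.2) | p <- l n]), C; split=> [n|n p|j].
- by rewrite big_map.
- by move=> /mapP[q ql -> /=]; rewrite normrN; exact: l1 ql.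
- apply: cvgn_ext (cvgM (cvg_cst ((-1) ^+ j : R)) (la j)) => n.
  rewrite /wsum big_map mulr_sumr; apply: eq_bigr => p _ /=; by rewrite [X in _ = _ * X]exprNn mulrCA.
Qed.

(** The even and odd parts of a measure isolate its even and odd moments, so a sequence may be
    prescribed on each parity separately. *)
Lemma bounded_moments_parity (R : realType) (a b : nat -> R) : bounded_moments a -> bounded_moments b ->
  bounded_moments (fun j => if odd j then a j else b j).
Proof.
move=> ga gb.
have h1 := bounded_momentsZ (2^-1) (bounded_momentsD ga (bounded_momentsZ (-1) (bounded_moments_reflect ga))).
have h2 := bounded_momentsZ (2^-1) (bounded_momentsD gb (bounded_moments_reflect gb)).
apply: bounded_moments_ext (bounded_momentsD h1 h2) => j /=.
by rewrite -signr_odd; case: (odd j); rewrite ?expr0 ?expr1; field.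
Qed.

Lemma Rintegral_exprn (R : realType) (b : R) (k : nat) : 0 < b ->
  \int[leb]_(u in `[0, b]) (u ^+ k) = b ^+ k.+1 / k.+1%:R.
Proof.
move=> b0; pose P : {poly R} := k.+1%:R^-1 *: 'X^(k.+1).
have HF u : 0 <= u <= b -> is_derive u 1 (horner P) (u ^+ k).
  move=> _; apply: (is_derive_eq (is_derive_poly P u)).
  by rewrite /P derivZ derivXn hornerZ hornerMn hornerXn -[X in _ * X]mulr_natl mulrA mulVf ?pnatr_eq0// mul1r.
rewrite (FTC2_Rintegral b0 HF); last exact: continuous_exprn_within.
by rewrite /P !hornerZ !hornerXn expr0n mulr0 subr0 mulrC.
Qed.

Lemma bounded_moments_weight (R : realType) (w : R -> R) :
  leb.-integrable `[0, 1] (EFin \o w) -> (forall u, 0 <= w u) ->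
  bounded_moments (fun j => \int[leb]_(u in `[0, 1]) (u ^+ j * w u)).
Proof.
move=> iw w0; have [l [l1 l2 l3]] := weight_realization iw w0.
exists l, (\int[leb]_(u in `[0, 1]) w u); split=> [n|n p|j].
- rewrite -(l2 n) /wsum big_seq [X in _ <= X]big_seq; apply: ler_sum => p pl.
  by rewrite mulr1 ger0_norm//; have [] := l1 _ _ pl.
- by move=> /l1[_ /andP[p0 p1]]; rewrite ger0_norm.
- by apply: l3; exact: continuous_exprn_within.
Qed.

Lemma bounded_moments_inv (R : realType) (i : nat) : bounded_moments (fun j => (j + i).+1%:R^-1 : R).
Proof.
elim: i => [|i IH].
  have h : leb.-integrable `[0, 1] (EFin \o (fun _ : R => 1 : R)).
    by apply: continuous_itv_integrable; exact: within_continuous_cst.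
  apply: bounded_moments_ext (bounded_moments_weight h _) => // j.
  under eq_Rintegral do rewrite mulr1.
  by rewrite Rintegral_exprn// expr1n mul1r addn0.
by apply: bounded_moments_ext (bounded_moments_shift IH) => j; rewrite addSnnS.
Qed.

Lemma bounded_moments_prod (R : realType) (N i : nat) :
  bounded_moments (fun j => (\prod_(k < N) (j + k + i).+1%:R)^-1 : R).
Proof.
elim: N => [|N IH].
  by apply: bounded_moments_ext (bounded_moments1 R) => j; rewrite big_ord0 invr1.
apply: bounded_moments_ext (bounded_momentsM IH (bounded_moments_inv R (N + i))) => j.
by rewrite big_ord_recr /= invfM addnA.
Qed.

Definition smoothed_inverse (R : realType) (d N m : nat) : R :=
  (moment R d m * \prod_(k < N) (2 * m + k).+1%:R)^-1.

Lemma moment_gt0 (R : numFieldType) (d m : nat) : (0 < d)%N -> 0 < moment R d m.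
Proof.
by move=> d0; apply: prodr_gt0 => i _; rewrite divr_gt0// ltr0n; lia.
Qed.

Lemma moment1 (R : numFieldType) (m : nat) : moment R 1 m = 1.
Proof.
elim: m => [|m IH]; first exact: moment0.
by rewrite momentS IH mul1r add1n divff// pnatr_eq0.
Qed.

(* Wallis' integrals. *)
Lemma arcsine_odd_moment (R : realType) (m : nat) :
  \int[leb]_(u in `[0, 1]) (u ^+ (2 * m).+1 * weight (- 2^-1) 1 u) =
  (moment R 2 m * (2 * m).+1%:R)^-1.
Proof.
elim: m => [|m IH].
  rewrite moment0 muln0 mulr1 invr1.
  have := weight_arcsine_derive 1 (ltr01 : 0 < 1 :> R).
  rewrite derivC hornerC => h; apply: oppr_inj; rewrite -h.
  under [RHS]eq_Rintegral do rewrite horner0 mul0r sub0r hornerC mul1r expr1n divr1 mulNr -mulN1r.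
  rewrite RintegralZl//; last first.
    by apply: integrable_mul_weight; [exact: (@continuous_exprn_within R 1)|have [] := weight_arcsine (ltr01 : 0 < 1 :> R)].
  by rewrite mulN1r.
have -> : (2 * m.+1).+1 = (2 * m).+3 by lia.
rewrite weight_arcsine_rec// IH expr1n mul1r momentS.
have -> : (2 * m).+2 = (2 + 2 * m)%N by lia.
have h1 : moment R 2 m != 0 by rewrite gt_eqF// moment_gt0.
have h2 : (2 + 2 * m)%:R != 0 :> R by rewrite pnatr_eq0.
have h3 : (2 * m).+1%:R != 0 :> R by rewrite pnatr_eq0.
have h4 : (2 + 2 * m).+1%:R != 0 :> R by rewrite pnatr_eq0.
move: h1 h2 h3 h4; move: (moment R 2 m) ((2 + 2 * m)%:R) ((2 * m).+1%:R) ((2 + 2 * m).+1%:R) => x y z w h1 h2 h3 h4.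
by field; rewrite h1 h2 h3 h4.
Qed.

(** Induction on d in steps of two. Raising d by 2 multiplies 1 / mu_m by a factor linear in m,
    which two more linear factors in the denominator outweigh. The base cases are d = 1, where mu_m
    = 1, and d = 2, where the odd moments of the arcsine density supply 1 / (mu_m (2m + 1)). *)
Lemma bounded_smoothed_inverse (R : realType) (d N : nat) : (0 < d <= N)%N ->
  exists2 a : nat -> R, bounded_moments a & forall m, a (2 * m)%N = smoothed_inverse R d N m.
Proof.
pose Q d := forall N, (d <= N)%N ->
  exists2 a : nat -> R, bounded_moments a & forall m, a (2 * m)%N = smoothed_inverse R d N m.
suff H : forall d, Q d.+1 /\ Q d.+2.
  by case: d => // d /andP[_ dN]; have [h _] := H d; exact: h.
move=> {d N}; elim=> [|d [IH1 IH2]]; last first.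
  split => // -[|[|N]]// dN; have [a ga aE] := IH1 N ltac:(lia).
  (* Partial fractions of (2m + d + 1) / ((2m + N + 1) (2m + N + 2)), read at j = 2m. *)
  exists (fun j => d.+1%:R^-1 * (a j * ((j + N.+1).+1%:R^-1 * (1 + (d.+1%:R - N.+1%:R) * (j + N).+1%:R^-1)))).
    apply: bounded_momentsZ; apply: bounded_momentsM => //; apply: bounded_momentsM.
      exact: bounded_moments_inv.
    apply: bounded_momentsD; first exact: bounded_moments1.
    by apply: bounded_momentsZ; exact: bounded_moments_inv.
  move=> m; rewrite aE /smoothed_inverse (@moment_dimSS _ d.+1)// !big_ord_recr /=.
  have h0 : \prod_(k < N) (2 * m + k).+1%:R != 0 :> R.
    by rewrite prodf_seq_neq0; apply/allP => k _; rewrite pnatr_eq0.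
  have h1 : moment R d.+1 m != 0 by rewrite gt_eqF// moment_gt0.
  have h2 : d.+1%:R != 0 :> R by rewrite pnatr_eq0.
  have h3 : (2 * m + N.+1).+1%:R != 0 :> R by rewrite pnatr_eq0.
  have h4 : (2 * m + N).+1%:R != 0 :> R by rewrite pnatr_eq0.
  have h5 : (d.+1 + 2 * m)%:R != 0 :> R by rewrite pnatr_eq0.
  have -> : N.+1%:R = (2 * m + N).+1%:R - (d.+1 + 2 * m)%:R + d.+1%:R :> R.
    by rewrite -[in RHS]addnS !natrD; ring.
  move: h0 h1 h2 h3 h4 h5.
  move: (\prod_(_ < _) _) (moment R d.+1 m) (2 * m + N.+1).+1%:R (2 * m + N).+1%:R (d.+1 + 2 * m)%:R => p x y z w.
  move: (d.+1%:R) => v h0 h1 h2 h3 h4 h5; field.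
  by rewrite h0 h1 h2 h3 h4 h5.
split => N dN.
  exists (fun j => (\prod_(k < N) (j + k + 0).+1%:R)^-1); first exact: bounded_moments_prod.
  move=> m; rewrite /smoothed_inverse moment1 mul1r; congr (_^-1).
  by apply: eq_bigr => k _; rewrite addn0.
case: N dN => // N dN.
have [iw _] := weight_arcsine (ltr01 : 0 < 1 :> R).
exists (fun j => (\int[leb]_(u in `[0, 1]) (u ^+ j.+1 * weight (- 2^-1) 1 u)) * (\prod_(k < N) (j + k + 1).+1%:R)^-1).
  apply: bounded_momentsM; last exact: bounded_moments_prod.
  apply: bounded_moments_shift (bounded_moments_weight iw _) => u; exact: weight_ge0.
move=> m; rewrite arcsine_odd_moment /smoothed_inverse big_ord_recl /= addn0 mulrA [in RHS]invfM.
congr (_ * _^-1); apply: eq_bigr => k _; congr (_.+1%:R); rewrite /bump /=; lia.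
Qed.

(* The multiplier of N-fold integration followed by the inverse of the lift, with the convention
   mu_{ceil(j/2)} for the odd powers v^j. *)
Definition smoothing_moment (R : realType) (d N j : nat) : R :=
  (moment R d (uphalf j) * \prod_(k < N) (j + k).+1%:R)^-1.

(** For odd j, one of the N factors is j + 1, and what remains is the even case at j + 1 with N - 1
    factors. Hence the strict inequality d < N. *)
Lemma bounded_smoothing_moment (R : realType) (d N : nat) : (0 < d < N)%N ->
  bounded_moments (smoothing_moment R d N).
Proof.
case: N => [|N] /andP[d0 dN]; first by rewrite ltn0 in dN.
have [a ga aE] := @bounded_smoothed_inverse R d N.+1 ltac:(lia).
have [b gb bE] := @bounded_smoothed_inverse R d N ltac:(lia).
have := bounded_moments_parity (bounded_momentsM (bounded_moments_inv R 0) (bounded_moments_shift gb)) ga.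
apply: bounded_moments_ext => j; have := odd_double_half j; rewrite -mul2n.
case: (odd j) => /= [|]; rewrite ?add0n ?add1n => jE.
  have uj : uphalf j = (j./2).+1 by rewrite -{1}jE uphalf_half/=; lia.
  have j1 : j.+1 = (2 * (j./2).+1)%N by lia.
  rewrite j1 bE /smoothed_inverse /smoothing_moment uj big_ord_recl /= addn0 -invfM; congr (_^-1).
  rewrite mulrCA; congr (_ * (_ * _)).
  by apply: eq_bigr => k _; congr (_.+1%:R); rewrite /bump /=; lia.
have uj : uphalf j = j./2 by rewrite -{1}jE uphalf_half/=; lia.
by rewrite -{1}jE aE /smoothed_inverse /smoothing_moment uj jE.
Qed.

(** * Quadrature on the sphere *)

Definition dotp (R : pzRingType) (d : nat) (x y : 'rV[R]_d) : R :=
  \sum_(i < d) x ord0 i * y ord0 i.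

(* sphere_moment d m |y|^2 is the mean of <xi, y>^m over the unit sphere of R^d. *)
Definition sphere_moment (R : fieldType) (d m : nat) (q : R) : R :=
  if odd m then 0 else moment R d m./2 * q ^+ m./2.

(** With b = sqrt(1 - c^2) and v a unit vector, this is a point of height c on the sphere of one
    dimension more. *)
Definition cons_row (R : pzRingType) (d : nat) (c b : R) (v : 'rV[R]_d) : 'rV[R]_d.+1 :=
  \row_i oapp (fun j => b * v ord0 j) c (unlift ord0 i).

Definition tail_row (R : pzRingType) (d : nat) (y : 'rV[R]_d.+1) : 'rV[R]_d :=
  \row_j y ord0 (lift ord0 j).

Lemma dotp_cons_row (R : pzRingType) (d : nat) (c b : R) (v : 'rV[R]_d) (y : 'rV[R]_d.+1) :
  dotp (cons_row c b v) y = c * y ord0 ord0 + b * dotp v (tail_row y).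
Proof.
rewrite /dotp big_ord_recl !mxE unlift_none /=; congr (_ + _).
rewrite mulr_sumr; apply: eq_bigr => i _.
by rewrite !mxE liftK /= mulrA.
Qed.

Lemma tail_cons_row (R : pzRingType) (d : nat) (c b : R) (v : 'rV[R]_d) :
  tail_row (cons_row c b v) = b *: v.
Proof. by apply/rowP => i; rewrite !mxE liftK. Qed.

Lemma dotp_tail_row (R : pzRingType) (d : nat) (y : 'rV[R]_d.+1) :
  dotp y y = y ord0 ord0 ^+ 2 + dotp (tail_row y) (tail_row y).
Proof.
by rewrite /dotp big_ord_recl expr2; congr (_ + _); apply: eq_bigr => i _; rewrite !mxE.
Qed.

Lemma dotpZr (R : comPzRingType) (d : nat) (a : R) (x y : 'rV[R]_d) : dotp x (a *: y) = a * dotp x y.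
Proof. by rewrite /dotp mulr_sumr; apply: eq_bigr => i _; rewrite mxE mulrCA. Qed.

Lemma dotp_ge0 (R : realDomainType) (d : nat) (x : 'rV[R]_d) : 0 <= dotp x x.
Proof. by apply: sumr_ge0 => i _; rewrite -expr2 sqr_ge0. Qed.

(** A double-factorial product; [moment] is a quotient of two of them. *)
Definition rising2 (R : pzSemiRingType) (c n : nat) : R := \prod_(i < n) (c + 2 * i)%:R.

Lemma rising20 (R : pzSemiRingType) (c : nat) : rising2 R c 0 = 1.
Proof. by rewrite /rising2 big_ord0. Qed.

Lemma rising2S (R : pzSemiRingType) (c n : nat) : rising2 R c n.+1 = rising2 R c n * (c + 2 * n)%:R.
Proof. by rewrite /rising2 big_ord_recr. Qed.

Lemma rising2_gt0 (R : numDomainType) (c n : nat) : (0 < c)%N -> 0 < rising2 R c n.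
Proof. by move=> c0; apply: prodr_gt0 => i _; rewrite ltr0n; lia. Qed.

Lemma momentE (R : fieldType) (d m : nat) : moment R d m = rising2 R 1 m / rising2 R d m.
Proof. by rewrite /moment /rising2 -prodf_div. Qed.

(** A Beta integral, by induction on j: expanding one factor 1 - u^2 gives a difference of two
    integrals with smaller j. *)
Lemma weight_cap_moments (R : realType) (e k j : nat) :
  \int[leb]_(u in `[0, 1]) (u ^+ (2 * k) * (1 - u ^+ 2) ^+ j * weight ((e.+2%:R - 3) / 2) 1 u) =
  weight_mass R e * (rising2 R 1 k * rising2 R e.+1 j / rising2 R e.+2 (k + j)).
Proof.
have [iw mw] := weight_moments e (ltr01 : 0 < 1 :> R).
elim: j k => [|j IH] k.
  under eq_Rintegral do rewrite expr0 mulr1.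
  by rewrite mw expr1n mulr1 momentE addn0 rising20 mulr1.
have cc i : {within `[0, 1], continuous (fun u : R => u ^+ (2 * i) * (1 - u ^+ 2) ^+ j)}.
  rewrite (_ : (fun u => _) = horner ('X^(2 * i) * (1 - 'X^2) ^+ j)).
    by apply: continuous_subspaceT; exact: continuous_horner.
  by apply/funext => u; rewrite !hornerE.
transitivity (\int[leb]_(u in `[0, 1]) ((u ^+ (2 * k) * (1 - u ^+ 2) ^+ j
    + (-1) * (u ^+ (2 * k.+1) * (1 - u ^+ 2) ^+ j)) * weight ((e.+2%:R - 3) / 2) (1 : R) u)).
  apply: eq_Rintegral => u _; congr (_ * _).
  have -> : (2 * k.+1 = 2 * k + 2)%N by lia.
  rewrite exprD exprS; ring.
rewrite Rintegral_weightD// !IH addSn addnS !rising2S.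
have h1 : rising2 R e.+2 (k + j) != 0 by rewrite gt_eqF// rising2_gt0.
have h2 : (e.+2 + 2 * (k + j))%:R != 0 :> R by rewrite pnatr_eq0.
have -> : (e.+1 + 2 * j)%:R = (e.+2 + 2 * (k + j))%:R - (1 + 2 * k)%:R :> R.
  by rewrite -natrB; [congr (_%:R)|]; lia.
move: h1 h2; move: (rising2 R e.+2 (k + j)) (e.+2 + 2 * (k + j))%:R => x y h1 h2.
by field; rewrite h1 h2.
Qed.

Lemma sum_even_indices (R : nmodType) (M : nat) (F : nat -> R) :
  \sum_(i < (2 * M).+1 | ~~ odd i) F i = \sum_(K < M.+1) F (2 * K)%N.
Proof.
elim: M => [|M IH].
  by rewrite big_mkcond /= !big_ord1.
have -> : (2 * M.+1).+1 = (2 * M).+3 by lia.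
rewrite big_mkcond big_ord_recr big_ord_recr /= -big_mkcond IH [RHS]big_ord_recr /=.
rewrite mul2n odd_double /= addr0 -mul2n.
by have -> : (2 * M.+1 = (2 * M).+2)%N by lia.
Qed.

Lemma rising2_fact (R : comPzRingType) (n : nat) :
  rising2 R 1 n * (2 ^+ n * n`!%:R) = (2 * n)`!%:R.
Proof.
elim: n => [|n IH]; first by rewrite rising20 !mul1r muln0.
have -> : (2 * n.+1 = (2 * n).+2)%N by lia.
rewrite rising2S !factS !natrM -IH exprS add1n.
have -> : (2 * n).+2%:R = 2 * n.+1%:R :> R by rewrite -natrM; congr (_%:R); lia.
ring.
Qed.

(** From [rising2_fact], that is, (2n)! = 1 3 ... (2n - 1) 2^n n!, applied to K, J and K + J. *)
Lemma bin_even (R : numDomainType) (K J : nat) :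
  'C(2 * (K + J), 2 * K)%:R * (rising2 R 1 K * rising2 R 1 J) = rising2 R 1 (K + J) * 'C(K + J, K)%:R.
Proof.
have nz : 2 ^+ (K + J) * (K`!%:R * J`!%:R) != 0 :> R.
  by rewrite !mulf_neq0// ?expf_neq0// pnatr_eq0 -lt0n fact_gt0.
apply: (mulIf nz).
have -> : 'C(2 * (K + J), 2 * K)%:R * (rising2 R 1 K * rising2 R 1 J) * (2 ^+ (K + J) * (K`!%:R * J`!%:R)) =
  'C(2 * (K + J), 2 * K)%:R * ((rising2 R 1 K * (2 ^+ K * K`!%:R)) * (rising2 R 1 J * (2 ^+ J * J`!%:R))).
  by rewrite exprD; ring.
have -> : rising2 R 1 (K + J) * 'C(K + J, K)%:R * (2 ^+ (K + J) * (K`!%:R * J`!%:R)) =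
  rising2 R 1 (K + J) * (2 ^+ (K + J) * ('C(K + J, K)%:R * (K`!%:R * J`!%:R))) by ring.
rewrite !rising2_fact -!natrM.
have := @bin_fact (K + J) K (leq_addr _ _); rewrite addKn => ->.
have := @bin_fact (2 * (K + J)) (2 * K); rewrite -mulnBr addKn => -> //; last lia.
by rewrite rising2_fact.
Qed.

(** The mean of |u|^i (1 - u^2)^((m - i) / 2), where u is the first coordinate of a uniform point of
    the unit sphere of R^(e+2). *)
Definition cap_moment (R : realType) (e m i : nat) : R :=
  (weight_mass R e)^-1 *
  \int[leb]_(u in `[0, 1]) (u ^+ i * Num.sqrt (1 - u ^+ 2) ^+ (m - i) * weight ((e.+2%:R - 3) / 2) 1 u).

(* Integrating out the first coordinate of S^{d} recovers the moments of S^{d} from those of S^{d-1}. *)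
Lemma sphere_moment_rec (R : realType) (e m : nat) (b q : R) :
  \sum_(i < m.+1 | ~~ odd i) 'C(m, i)%:R * b ^+ i * cap_moment R e m i * sphere_moment e.+1 (m - i) q =
  sphere_moment e.+2 m (b ^+ 2 + q).
Proof.
rewrite /sphere_moment; case: ifPn => [om|om].
  rewrite big1// => i oi; rewrite (_ : odd (m - i)) ?mulr0// oddB ?om ?(negbTE oi)//.
  by have := ltn_ord i; rewrite ltnS.
have [M mE] : exists M, m = (2 * M)%N.
  by exists m./2; have := odd_double_half m; rewrite (negbTE om) add0n -mul2n.
subst m; rewrite mul2n doubleK -mul2n.
rewrite (sum_even_indices M (fun i => 'C(2 * M, i)%:R * b ^+ i * cap_moment R e (2 * M) i *
  (if odd (2 * M - i) then 0 else moment R e.+1 (2 * M - i)./2 * q ^+ (2 * M - i)./2))).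
rewrite addrC exprDn mulr_sumr; apply: eq_bigr => K _.
have KM : (K <= M)%N by have := ltn_ord K; rewrite ltnS.
have -> : (2 * M - 2 * K = 2 * (M - K))%N by rewrite mulnBr.
rewrite [(2 * (M - K))%N]mul2n odd_double doubleK.
set J := (M - K)%N; have ME : M = (K + J)%N by rewrite subnKC.
have -> : cap_moment R e (2 * M) (2 * K) = rising2 R 1 K * rising2 R e.+1 J / rising2 R e.+2 M.
  rewrite /cap_moment.
  transitivity ((weight_mass R e)^-1 *
    \int[leb]_(u in `[0, 1]) (u ^+ (2 * K) * (1 - u ^+ 2) ^+ J * weight ((e.+2%:R - 3) / 2) (1 : R) u)).
    congr (_ * _); apply: eq_Rintegral => u; rewrite inE /= in_itv /= => /andP[u0 u1].
    rewrite -mulnBr -/J [Num.sqrt _ ^+ _]exprM sqr_sqrtr// subr_ge0.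
    by rewrite -(expr1n _ 2) lerXn2r ?nnegrE.
  by rewrite weight_cap_moments -ME mulKf// gt_eqF// weight_mass_gt0.
rewrite !momentE -!exprM -[X in _ = _ * X]mulr_natr.
have h1 : rising2 R e.+1 J != 0 by rewrite gt_eqF// rising2_gt0.
have h2 : rising2 R e.+2 M != 0 by rewrite gt_eqF// rising2_gt0.
have := @bin_even R K J; rewrite -ME => h3.
move: h1 h2 h3; move: (b ^+ (2 * K)) (q ^+ J) => B Q.
move: ('C(2 * M, 2 * K)%:R) ('C(M, K)%:R) (rising2 R 1 K) (rising2 R 1 J) (rising2 R 1 M) (rising2 R e.+1 J) (rising2 R e.+2 M).
move=> c c' x y z v w h1 h2 h3.
have -> : c * B * (x * v / w) * (y / v * Q) = (c * (x * y)) / w * (B * Q) by field; rewrite h1 h2.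
by rewrite h3; field.
Qed.

Lemma sphere_moment_bound (R : numFieldType) (d m : nat) (q : R) : (0 < d)%N -> 0 <= q <= 1 ->
  `|sphere_moment d m q| <= 1.
Proof.
move=> d0 /andP[q0 q1]; rewrite /sphere_moment; case: ifP => _; first by rewrite normr0.
have m1 k : 0 <= moment R d k <= 1.
  rewrite ltW ?moment_gt0//=; apply: prodr_ile1 => i _.
  rewrite divr_ge0//= ler_pdivrMr ?ltr0n; last by lia.
  by rewrite mul1r ler_nat; lia.
have /andP[h1 h2] := m1 m./2.
by rewrite normrM !ger0_norm ?exprn_ge0// mulr_ile1 ?exprn_ge0// exprn_ile1.
Qed.

(** A finitely supported probability on the sphere. Testing powers of <xi, y> is enough, since the
    limits of averages taken below reduce to polynomials in inner products. *)
Definition sphere_quadrature (R : realType) (d n : nat) (e : R) (s : seq (R * 'rV[R]_d)) : Prop :=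
  [/\ forall p, p \in s -> 0 <= p.1 /\ dotp p.2 p.2 = 1,
      wsum s (fun=> 1) = 1 &
      forall m, (m <= n)%N -> forall y : 'rV[R]_d, dotp y y <= 1 ->
        `|wsum s (fun xi => dotp xi y ^+ m) - sphere_moment d m (dotp y y)| <= e].

(** The heights c and - c get equal weights, so the odd moments in the first coordinate cancel
    exactly although the heights in [l] come from [0, 1]. *)
Definition suspend (R : realType) (d : nat) (l : seq (R * R)) (s : seq (R * 'rV[R]_d)) : seq (R * 'rV[R]_d.+1) :=
  [seq (p.1 * 2^-1 * q.1, cons_row p.2 (Num.sqrt (1 - p.2 ^+ 2)) q.2) | p <- l, q <- s] ++
  [seq (p.1 * 2^-1 * q.1, cons_row (- p.2) (Num.sqrt (1 - p.2 ^+ 2)) q.2) | p <- l, q <- s].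

Lemma wsum_cat (R : comPzRingType) (T : Type) (l k : seq (R * T)) (f : T -> R) :
  wsum (l ++ k) f = wsum l f + wsum k f.
Proof. by rewrite /wsum big_cat. Qed.

Lemma wsumD (R : comPzRingType) (T : Type) (l : seq (R * T)) (f g : T -> R) :
  wsum l (fun t => f t + g t) = wsum l f + wsum l g.
Proof. by rewrite /wsum -big_split; apply: eq_bigr => p _; rewrite mulrDr. Qed.

Lemma wsumZ (R : comPzRingType) (T : Type) (l : seq (R * T)) (c : R) (f : T -> R) :
  wsum l (fun t => c * f t) = c * wsum l f.
Proof. by rewrite /wsum mulr_sumr; apply: eq_bigr => p _; rewrite mulrCA. Qed.

Lemma wsum_sum (R : comPzRingType) (T : Type) (I : Type) (r : seq I) (P : pred I)
    (l : seq (R * T)) (f : I -> T -> R) :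
  wsum l (fun t => \sum_(i <- r | P i) f i t) = \sum_(i <- r | P i) wsum l (f i).
Proof. by rewrite /wsum exchange_big /=; apply: eq_bigr => p _; rewrite mulr_sumr. Qed.

Lemma wsum_allpairs (R : comPzRingType) (T U V : Type) (l : seq (R * T)) (s : seq (R * U)) (c : R)
    (h : T -> U -> V) (f : V -> R) :
  wsum [seq (p.1 * c * q.1, h p.2 q.2) | p <- l, q <- s] f =
  c * wsum l (fun t => wsum s (fun u => f (h t u))).
Proof.
rewrite /wsum big_allpairs_dep /= mulr_sumr; apply: eq_bigr => p _.
by rewrite !mulr_sumr; apply: eq_bigr => q _; ring.
Qed.

Lemma wsum_suspend (R : realType) (d m : nat) (l : seq (R * R)) (s : seq (R * 'rV[R]_d)) (y : 'rV[R]_d.+1) :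
  wsum (suspend l s) (fun xi => dotp xi y ^+ m) =
  \sum_(i < m.+1 | ~~ odd i) 'C(m, i)%:R * y ord0 ord0 ^+ i *
    wsum l (fun c => c ^+ i * Num.sqrt (1 - c ^+ 2) ^+ (m - i)) *
    wsum s (fun xi => dotp xi (tail_row y) ^+ (m - i)).
Proof.
have H c : 2^-1 * (wsum s (fun u => dotp (cons_row c (Num.sqrt (1 - c ^+ 2)) u) y ^+ m)
     + wsum s (fun u => dotp (cons_row (- c) (Num.sqrt (1 - c ^+ 2)) u) y ^+ m)) =
   \sum_(i < m.+1 | ~~ odd i) 'C(m, i)%:R * y ord0 ord0 ^+ i *
    (c ^+ i * Num.sqrt (1 - c ^+ 2) ^+ (m - i)) * wsum s (fun xi => dotp xi (tail_row y) ^+ (m - i)).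
  rewrite /wsum -big_split /= mulr_sumr.
  under [RHS]eq_bigr do rewrite mulr_sumr.
  rewrite exchange_big /=; apply: eq_bigr => p _.
  rewrite !dotp_cons_row; move: (dotp _ _) (y ord0 ord0) (Num.sqrt _) => D b r.
  rewrite ![_ * b + _]addrC !exprDn -mulrDr -big_split /= !mulr_sumr [RHS]big_mkcond.
  have E (z : R) n : z *+ n = n%:R * z by rewrite mulr_natl.
  apply: eq_bigr => i _; rewrite mulNr [(- _) ^+ i]exprNn -signr_odd !exprMn !(E (_ * _)).
  move: ('C(m, i)%:R) (r ^+ (m - i)) (D ^+ (m - i)) (c ^+ i) (b ^+ i) => {E} x1 x2 x3 x4 x5.
  by case: (odd i); rewrite ?expr0 ?expr1 /=; field.
rewrite /suspend wsum_cat (@wsum_allpairs R R _ _ l s 2^-1 (fun c => cons_row c (Num.sqrt (1 - c ^+ 2)))).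
rewrite (@wsum_allpairs R R _ _ l s 2^-1 (fun c => cons_row (- c) (Num.sqrt (1 - c ^+ 2)))).
rewrite -mulrDr -wsumD -wsumZ.
transitivity (wsum l (fun c => \sum_(i < m.+1 | ~~ odd i) 'C(m, i)%:R * y ord0 ord0 ^+ i *
    (c ^+ i * Num.sqrt (1 - c ^+ 2) ^+ (m - i)) * wsum s (fun xi => dotp xi (tail_row y) ^+ (m - i)))).
  by apply: eq_bigr => p _; rewrite -H.
rewrite wsum_sum; apply: eq_bigr => i _.
rewrite mulrAC -wsumZ; apply: eq_bigr => p _; congr (_ * _).
by rewrite mulrAC.
Qed.

Lemma wsum_le (R : realDomainType) (T : eqType) (l : seq (R * T)) (f g : T -> R) :
  (forall p, p \in l -> 0 <= p.1 /\ f p.2 <= g p.2) -> wsum l f <= wsum l g.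
Proof.
move=> H; rewrite /wsum big_seq [X in _ <= X]big_seq; apply: ler_sum => p /H[p0 pfg].
by rewrite ler_wpM2l.
Qed.

Lemma wsum_prob_bound (R : realDomainType) (T : eqType) (l : seq (R * T)) (f : T -> R) (M : R) :
  (forall p, p \in l -> 0 <= p.1 /\ `|f p.2| <= M) -> wsum l (fun=> 1) = 1 -> `|wsum l f| <= M.
Proof.
move=> H l1; rewrite ler_norml; apply/andP; split.
  rewrite -[- M]mulr1 -l1 -wsumZ; apply: wsum_le => p /H[p0]; rewrite ler_norml => /andP[h _].
  by rewrite mulr1.
rewrite -[M]mulr1 -l1 -wsumZ; apply: wsum_le => p /H[p0]; rewrite ler_norml => /andP[_ h].
by rewrite mulr1.
Qed.

(** In each term of the binomial expansion the heights and the old quadrature each contribute an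
    error of at most [eps], and the binomial coefficients sum to 2^m <= 2^n. *)
Lemma sphere_quadrature_step (R : realType) (e n : nat) (eps : R) (s : seq (R * 'rV[R]_e.+1)) :
  0 < eps -> sphere_quadrature n eps s ->
  exists s' : seq (R * 'rV[R]_e.+2), sphere_quadrature n (2 ^+ n * (eps + eps)) s'.
Proof.
move=> eps0 [s0 s1 sn].
have [iw mw] := weight_moments e (ltr01 : 0 < 1 :> R).
have [l [l0 l1 l2]] := weight_realization iw (weight_ge0 _ _).
have m0 := weight_mass_gt0 R e.
pose k N := [seq ((weight_mass R e)^-1 * p.1, p.2) | p <- l N].
have kE N f : wsum (k N) f = (weight_mass R e)^-1 * wsum (l N) f.
  by rewrite /wsum /k big_map mulr_sumr; apply: eq_bigr => p _ /=; rewrite mulrA.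
have k1 N : wsum (k N) (fun=> 1) = 1.
  have w1 : \int[leb]_(u in `[0, 1]) weight ((e.+2%:R - 3) / 2) 1 u = weight_mass R e.
    have := mw 0%N; rewrite moment0 expr1n !mulr1 => <-.
    by apply: eq_Rintegral => u _; rewrite muln0 expr0 mul1r.
  by rewrite kE l1 w1 mulVf// gt_eqF.
have cf m i : {within `[0, 1], continuous (fun u : R => u ^+ i * Num.sqrt (1 - u ^+ 2) ^+ (m - i))}.
  apply: within_continuousM; first exact: continuous_exprn_within.
  apply: continuous_subspaceT => u.
  apply: (@continuous_comp _ _ _ (fun u : R => Num.sqrt (1 - u ^+ 2)) (fun u : R => u ^+ (m - i))); last exact: exprn_continuous.
  apply: (@continuous_comp _ _ _ (fun u : R => 1 - u ^+ 2) Num.sqrt); last exact: sqrt_continuous.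
  by apply: cvgB; [exact: cvg_cst|exact: exprn_continuous].
have kcvg m i : wsum (k N) (fun c => c ^+ i * Num.sqrt (1 - c ^+ 2) ^+ (m - i)) @[N --> \oo] --> cap_moment R e m i.
  apply: cvgn_ext (cvgM (cvg_cst (weight_mass R e)^-1) (l2 _ (cf m i))) => N.
  by rewrite kE.
(* Only finitely many pairs (m, i) occur, so one [N] serves them all. *)
have [N _ HN] : \forall N \near \oo, forall mi : 'I_n.+1 * 'I_n.+1,
   `|cap_moment R e mi.1 mi.2 - wsum (k N) (fun c => c ^+ mi.2 * Num.sqrt (1 - c ^+ 2) ^+ (mi.1 - mi.2))| <= eps.
  by apply: filter_forall => -[m i] /=; have /cvgrPdist_le /(_ eps eps0) := kcvg m i.
have {}HN := HN N (leqnn N).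
have kp p : p \in k N -> 0 <= p.1 /\ 0 <= p.2 <= 1.
  by move=> /mapP[q /l0[q0 q1] -> /=]; rewrite mulr_ge0// invr_ge0 ltW.
exists (suspend (k N) s); split.
- have node c xi : 0 <= c ^+ 2 <= 1 -> dotp xi xi = 1 ->
      dotp (cons_row c (Num.sqrt (1 - c ^+ 2)) xi) (cons_row c (Num.sqrt (1 - c ^+ 2)) xi) = 1 :> R.
    move=> /andP[c0 c1] xi1; rewrite dotp_cons_row tail_cons_row !mxE unlift_none /= dotpZr xi1 mulr1.
    by rewrite -!expr2 sqr_sqrtr ?subr_ge0// addrC subrK.
  move=> p; rewrite mem_cat => /orP[] /allpairsP[[u v] /= [/kp[u0 /andP[u1 u2]] /s0[v0 v1] ->]] /=.
    split; first by rewrite !mulr_ge0// invr_ge0.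
    by apply: node => //; rewrite sqr_ge0 exprn_ile1.
  split; first by rewrite !mulr_ge0// invr_ge0.
  by rewrite -(sqrrN u.2); apply: node => //; rewrite sqrrN sqr_ge0 exprn_ile1.
(* The total mass is the moment of degree 0. *)
- have := wsum_suspend 0 (k N) s 0.
  rewrite big_mkcond big_ord1 /= bin0 expr0 !mul1r.
  rewrite (_ : wsum (suspend _ _) _ = wsum (suspend (k N) s) (fun=> 1))// => ->.
  by rewrite k1 mul1r; exact: s1.
- move=> m mn y y1; rewrite wsum_suspend dotp_tail_row -sphere_moment_rec -sumrB.
  have q01 : 0 <= dotp (tail_row y) (tail_row y) <= 1.
    by rewrite dotp_ge0; move: y1; rewrite dotp_tail_row; have := sqr_ge0 (y ord0 ord0); lra.
  have b1 : `|y ord0 ord0| <= 1.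
    rewrite -(@ler_pXn2r _ 2)// ?nnegrE// expr1n real_normK ?num_real//.
    move: y1; rewrite dotp_tail_row; have := dotp_ge0 (tail_row y); lra.
  apply: (le_trans (ler_norm_sum _ _ _)).
  apply: (@le_trans _ _ (\sum_(i < m.+1) 'C(m, i)%:R * (eps + eps))).
    rewrite big_mkcond /=; apply: ler_sum => i _; case: ifP => _; last by apply: mulr_ge0 => //; lra.
    have im : (i <= m)%N by have := ltn_ord i; rewrite ltnS.
    have m1 : (m < n.+1)%N by rewrite ltnS.
    have i1 : (i < n.+1)%N by lia.
    have := HN (Ordinal m1, Ordinal i1) => /=.
    set A := wsum (k N) _; set B := cap_moment R e m i.
    have := sn (m - i)%N ltac:(lia) (tail_row y) ltac:(by case/andP: q01).
    have := @sphere_moment_bound R e.+1 (m - i) _ isT q01.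
    set T := wsum s _; set S := sphere_moment _ _ _ => S1 TS AB.
    have A1 : `|A| <= 1.
      apply: wsum_prob_bound => // p /kp[p0 /andP[p1 p2]]; split => //.
      have r0 : 0 <= 1 - p.2 ^+ 2 by rewrite subr_ge0 exprn_ile1.
      rewrite normrM !normrX mulr_ile1 ?exprn_ge0// exprn_ile1//; first by rewrite ger0_norm.
        rewrite ger0_norm ?sqrtr_ge0//; apply: (@le_trans _ _ (Num.sqrt 1)); last by rewrite sqrtr1.
      by rewrite ler_wsqrtr// gerBl sqr_ge0.
    clearbody A B T S.
    rewrite -!mulrA -!mulrBr normrM ger0_norm ?ler0n// ler_wpM2l//.
    rewrite normrM; apply: (@le_trans _ _ `|A * T - B * S|).
      by rewrite ler_piMl// normrX exprn_ile1.
    have -> : A * T - B * S = A * (T - S) - (B - A) * S by ring.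
    apply: (le_trans (ler_normB _ _)); rewrite !normrM.
    apply: lerD; first by apply: le_trans TS; rewrite ler_piMl.
    by apply: le_trans AB; rewrite ler_piMr.
  rewrite -mulr_suml ler_wpM2r ?addr_ge0 ?(ltW eps0)//.
  have <- : (1 + 1) ^+ m = \sum_(i < m.+1) 'C(m, i)%:R :> R.
    by rewrite exprDn; apply: eq_bigr => i _; rewrite !expr1n mul1r.
  by rewrite (_ : 1 + 1 = 2)// ler_weXn2l// ler1n.
Qed.

(** In dimension 1 the two points 1 and -1 with weights 1/2 are exact. Each suspension multiplies
    the error by 2^(n+1), which is absorbed in the accuracy asked of the dimension below. *)
Lemma sphere_quadrature_exists (R : realType) (d n : nat) (eps : R) : (0 < d)%N -> 0 < eps ->
  exists s : seq (R * 'rV[R]_d), sphere_quadrature n eps s.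
Proof.
case: d => // d _; elim: d eps => [|d IH] eps eps0.
  exists [:: (2^-1, const_mx 1); (2^-1, const_mx (-1))]; split.
  - move=> p; rewrite !inE => /orP[]/eqP-> /=; (split; first by rewrite invr_ge0);
      rewrite /dotp big_ord1 !mxE ?mulr1// mulrNN mulr1//.
  - by rewrite /wsum !big_cons big_nil addr0 /= mulr1; lra.
  - move=> m mn y _; rewrite /wsum !big_cons big_nil addr0 /=.
    rewrite /dotp !big_ord1 !mxE /= mul1r mulN1r [(- _) ^+ m]exprNn -signr_odd /sphere_moment moment1.
    have := odd_double_half m; case: (odd m) => /= [_|].
      rewrite expr1 [X in `|X|](_ : _ = 0); [by rewrite normr0 ltW|by field].
    rewrite add0n -mul2n expr0 mul1r => mE; rewrite -{1 2}mE exprM expr2.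
    rewrite [X in `|X|](_ : _ = 0); [by rewrite normr0 ltW|by field].
have e1 : 0 < eps / 2 ^+ n.+1 by rewrite divr_gt0 ?exprn_gt0.
have [s /(sphere_quadrature_step e1)[s' Hs']] := IH _ e1.
exists s'; suff -> : eps = 2 ^+ n * (eps / 2 ^+ n.+1 + eps / 2 ^+ n.+1) by [].
by rewrite exprS; field; rewrite expf_neq0.
Qed.

Lemma sphere_quadrature_sequence (R : realType) (d : nat) : (0 < d)%N ->
  exists s : nat -> seq (R * 'rV[R]_d), forall n, sphere_quadrature n (n.+1%:R^-1) (s n).
Proof.
move=> d0.
have H n : exists s : seq (R * 'rV[R]_d), sphere_quadrature n (n.+1%:R^-1) s.
  by apply: sphere_quadrature_exists => //; rewrite invr_gt0.
have [s Hs] := boolp.choice H.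
by exists s.
Qed.

Definition zonal_sequence (R : realType) (d : nat) (s : nat -> seq (R * 'rV[R]_d)) : Prop :=
  forall n, sphere_quadrature n (n.+1%:R^-1) (s n).

Lemma dotpDl (R : pzRingType) (d : nat) (x y z : 'rV[R]_d) : dotp (x + y) z = dotp x z + dotp y z.
Proof. by rewrite /dotp -big_split; apply: eq_bigr => i _; rewrite mxE mulrDl. Qed.

Lemma dotpC (R : comPzRingType) (d : nat) (x y : 'rV[R]_d) : dotp x y = dotp y x.
Proof. by apply: eq_bigr => i _; rewrite mulrC. Qed.

Lemma dotpZl (R : comPzRingType) (d : nat) (a : R) (x y : 'rV[R]_d) : dotp (a *: x) y = a * dotp x y.
Proof. by rewrite dotpC dotpZr dotpC. Qed.

Lemma dotpDr (R : comPzRingType) (d : nat) (x y z : 'rV[R]_d) : dotp x (y + z) = dotp x y + dotp x z.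
Proof. by rewrite dotpC dotpDl !(dotpC x). Qed.

Lemma dotpB_sqr (R : comPzRingType) (d : nat) (r s : R) (xi eta : 'rV[R]_d) : dotp xi xi = 1 -> dotp eta eta = 1 ->
  dotp (r *: xi - s *: eta) (r *: xi - s *: eta) = r ^+ 2 + s ^+ 2 - 2 * (r * s) * dotp xi eta.
Proof.
move=> x1 e1; rewrite -scaleNr !dotpDl !dotpDr !dotpZl !dotpZr x1 e1 (dotpC eta xi).
ring.
Qed.

Lemma dotp_le1 (R : realFieldType) (d : nat) (xi eta : 'rV[R]_d) : dotp xi xi = 1 -> dotp eta eta = 1 ->
  -1 <= dotp xi eta <= 1.
Proof.
move=> x1 e1; have := dotp_ge0 (1 *: xi - 1 *: eta); have := dotp_ge0 (1 *: xi - (-1) *: eta).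
by rewrite !dotpB_sqr//; lra.
Qed.

Lemma eq_wsum (R : pzRingType) (T : Type) (l : seq (R * T)) (f g : T -> R) : f =1 g -> wsum l f = wsum l g.
Proof. by move=> /funext ->. Qed.

Lemma wsum_exchange (R : comPzRingType) (T U : Type) (l : seq (R * T)) (k : seq (R * U)) (f : T -> U -> R) :
  wsum l (fun t => wsum k (f t)) = wsum k (fun u => wsum l (f^~ u)).
Proof.
rewrite /wsum; under eq_bigr do rewrite mulr_sumr.
rewrite exchange_big /=; apply: eq_bigr => p _; rewrite mulr_sumr.
by apply: eq_bigr => q _; rewrite mulrCA.
Qed.

Lemma zonal_moment_cvg (R : realType) (d m : nat) (s : nat -> seq (R * 'rV[R]_d)) (y : 'rV[R]_d) :
  zonal_sequence s -> dotp y y <= 1 ->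
  wsum (s n) (fun xi => dotp xi y ^+ m) @[n --> \oo] --> sphere_moment d m (dotp y y).
Proof.
move=> hs y1; apply/cvgrPdist_le => e e0.
near=> n.
have [_ _ /(_ m _ y y1)] := hs n; rewrite distrC => h; apply: (le_trans (h _)).
  by near: n; exact: nbhs_infty_ge.
have : `|0 - harmonic n| <= e.
  by near: n; have /cvgrPdist_le := @cvg_harmonic R; exact.
by rewrite sub0r normrN /harmonic /= ger0_norm// invr_ge0.
Unshelve. all: by end_near.
Qed.

(* Averaging over one factor replaces a zonal polynomial by its mean up to a uniformly small error. *)
Lemma zonal_double_cvg (R : realType) (d i j : nat) (s : nat -> seq (R * 'rV[R]_d)) : (0 < d)%N ->
  zonal_sequence s ->
  wsum (s n) (fun zeta => wsum (s n) (fun xi => dotp xi zeta ^+ i) * wsum (s n) (fun xi => dotp xi zeta ^+ j))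
   @[n --> \oo] --> sphere_moment d i (1 : R) * sphere_moment d j (1 : R).
Proof.
move=> d0 hs; apply/cvgrPdist_le => e e0.
have e2 : 0 < e / 2 by lra.
near=> n.
have [s0 s1 sn] := hs n.
pose h : R := n.+1%:R^-1.
have he : h <= e / 2.
  have : `|0 - harmonic n| <= e / 2.
    by near: n; have /cvgrPdist_le := @cvg_harmonic R; exact.
  by rewrite sub0r normrN /harmonic /= ger0_norm// invr_ge0.
have ni : (i <= n)%N by near: n; exact: nbhs_infty_ge.
have nj : (j <= n)%N by near: n; exact: nbhs_infty_ge.
set A := sphere_moment d i 1; set B := sphere_moment d j 1.
have -> : A * B = wsum (s n) (fun=> A * B) by rewrite -[LHS]mulr1 -s1 -wsumZ; apply: eq_bigr => p _; rewrite mulr1.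
rewrite -mulN1r -wsumZ -wsumD; apply: wsum_prob_bound => // p ps; have [p0 p1] := s0 _ ps.
split => //.
have b1 k : `|sphere_moment d k (1 : R)| <= 1 by apply: sphere_moment_bound => //; rewrite ler01 lexx.
have a1 k : `|wsum (s n) (fun xi => dotp xi p.2 ^+ k)| <= 1.
  apply: wsum_prob_bound => // q /s0[q0 q1]; split => //.
  by rewrite normrX exprn_ile1// ler_norml dotp_le1.
have := sn _ ni p.2; rewrite p1 lexx -/A => /(_ isT).
have := sn _ nj p.2; rewrite p1 lexx -/B => /(_ isT).
have := a1 i; have := b1 j; rewrite -/B.
move: (wsum _ _) (wsum _ _) => y x B1 x1 yB xA.
have -> : A * B + -1 * (x * y) = - ((x - A) * B) - x * (y - B) by ring.
apply: (le_trans (ler_normB _ _)); rewrite normrN !normrM.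
have h1 : `|x - A| * `|B| <= h by apply: le_trans xA; rewrite ler_piMr.
have h2 : `|x| * `|y - B| <= h by apply: le_trans yB; rewrite ler_piMl.
by lra.
Unshelve. all: by end_near.
Qed.

(** * Means over pairs of points of the sphere *)

Lemma cvgn_sum (R : realType) (I : Type) (r : seq I) (P : pred I) (u : I -> nat -> R) (l : I -> R) :
  (forall i, P i -> u i n @[n --> \oo] --> l i) ->
  \sum_(i <- r | P i) u i n @[n --> \oo] --> \sum_(i <- r | P i) l i.
Proof. by move=> H; apply: cvg_big => //; exact: add_continuous. Qed.

(** The mean of |r xi - s eta|^(2m) over independent uniform points xi, eta of the unit sphere. *)
Definition zonal_even (R : fieldType) (d m : nat) (r s : R) : R :=
  (moment R d m)^-1 * \sum_(k < m.+1)
     'C(2 * m, 2 * k)%:R * (moment R d k * moment R d (m - k)) * (r ^+ (2 * k) * s ^+ (2 * (m - k))).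

Lemma zonal_even_cvg (R : realType) (d m : nat) (r t : R) (s : nat -> seq (R * 'rV[R]_d)) : (0 < d)%N ->
  zonal_sequence s -> `|r| + `|t| <= 1 ->
  wsum (s n) (fun xi => wsum (s n) (fun eta => dotp (r *: xi - t *: eta) (r *: xi - t *: eta) ^+ m))
    @[n --> \oo] --> zonal_even d m r t.
Proof.
move=> d0 hs rt.
pose X n := wsum (s n) (fun xi => wsum (s n) (fun eta => wsum (s n) (fun zeta =>
   dotp zeta (r *: xi - t *: eta) ^+ (2 * m)))).
have XE n : X n = \sum_(j < (2 * m).+1) 'C(2 * m, j)%:R * (r ^+ j * (- t) ^+ (2 * m - j)) *
   wsum (s n) (fun zeta => wsum (s n) (fun xi => dotp xi zeta ^+ j) * wsum (s n) (fun xi => dotp xi zeta ^+ (2 * m - j))).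
  transitivity (wsum (s n) (fun zeta => \sum_(j < (2 * m).+1) 'C(2 * m, j)%:R * (r ^+ j * (- t) ^+ (2 * m - j)) *
      (wsum (s n) (fun xi => dotp xi zeta ^+ j) * wsum (s n) (fun xi => dotp xi zeta ^+ (2 * m - j))))); last first.
    by rewrite wsum_sum; apply: eq_bigr => j _; rewrite wsumZ.
  rewrite /X; under eq_wsum => xi do rewrite wsum_exchange.
  rewrite wsum_exchange; apply: eq_wsum => zeta.
  transitivity (wsum (s n) (fun xi => wsum (s n) (fun eta => \sum_(j < (2 * m).+1)
      'C(2 * m, j)%:R * (r ^+ j * (- t) ^+ (2 * m - j)) * (dotp xi zeta ^+ j * dotp eta zeta ^+ (2 * m - j))))).
    apply: eq_wsum => xi; apply: eq_wsum => eta.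
    rewrite -scaleNr dotpDr !dotpZr addrC exprDn !(dotpC zeta); apply: eq_bigr => j _.
    by rewrite !exprMn -[LHS]mulr_natl; ring.
  under eq_wsum => xi do rewrite wsum_sum.
  rewrite wsum_sum; apply: eq_bigr => j _.
  transitivity (wsum (s n) (fun xi => ('C(2 * m, j)%:R * (r ^+ j * (- t) ^+ (2 * m - j)) *
    wsum (s n) (fun xi => dotp xi zeta ^+ (2 * m - j))) * dotp xi zeta ^+ j)).
    by apply: eq_wsum => xi; rewrite !wsumZ; ring.
  by rewrite wsumZ; ring.
have Xcvg : X n @[n --> \oo] --> moment R d m * zonal_even d m r t.
  have -> : moment R d m * zonal_even d m r t = \sum_(j < (2 * m).+1) 'C(2 * m, j)%:R * (r ^+ j * (- t) ^+ (2 * m - j)) *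
      (sphere_moment d j 1 * sphere_moment d (2 * m - j) 1).
    rewrite /zonal_even mulVKf ?gt_eqF ?moment_gt0//.
    rewrite [RHS](bigID (fun j : 'I__ => ~~ odd j)) /= [X in _ + X]big1 ?addr0; last first.
      by move=> j; rewrite negbK /sphere_moment => ->; rewrite mul0r mulr0.
    rewrite (sum_even_indices m (fun j => 'C(2 * m, j)%:R * (r ^+ j * (- t) ^+ (2 * m - j)) *
      (sphere_moment d j 1 * sphere_moment d (2 * m - j) 1))); apply: eq_bigr => k _.
    rewrite -mulnBr /sphere_moment !mul2n !odd_double !doubleK !expr1n !mulr1 -!mul2n.
    by rewrite [(- t) ^+ _]exprM sqrrN -exprM; ring.
  under eq_fun do rewrite XE.
  apply: cvgn_sum => j _; apply: cvgM; first exact: cvg_cst.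
  exact: zonal_double_cvg.
have m0 : 0 < moment R d m by exact: moment_gt0.
pose Y n := wsum (s n) (fun xi => wsum (s n) (fun eta => dotp (r *: xi - t *: eta) (r *: xi - t *: eta) ^+ m)).
have : X n - moment R d m * Y n @[n --> \oo] --> (0 : R).
  apply/cvgrPdist_le => e e0; near=> n; rewrite sub0r normrN.
  have he : n.+1%:R^-1 <= e.
    have : `|0 - harmonic n| <= e by near: n; have /cvgrPdist_le := @cvg_harmonic R; exact.
    by rewrite sub0r normrN /harmonic /= ger0_norm// invr_ge0.
  apply: le_trans he; have [s0 s1 sn] := hs n.
  have -> : X n - moment R d m * Y n = wsum (s n) (fun xi => wsum (s n) (fun eta => wsum (s n) (fun zeta =>
     dotp zeta (r *: xi - t *: eta) ^+ (2 * m)) - sphere_moment d (2 * m) (dotp (r *: xi - t *: eta) (r *: xi - t *: eta)))).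
    rewrite /X /Y -mulN1r -!wsumZ -wsumD; apply: eq_wsum => xi.
    rewrite -!wsumZ -wsumD; apply: eq_wsum => eta.
    by rewrite /sphere_moment mul2n odd_double doubleK mulN1r.
  have nm : (2 * m <= n)%N by near: n; exact: nbhs_infty_ge.
  apply: wsum_prob_bound => // p /s0[p0 p1]; split => //.
  apply: wsum_prob_bound => // q /s0[q0 q1]; split => //.
  apply: sn => //; rewrite dotpB_sqr//.
  have /andP[h1 h2] := dotp_le1 p1 q1.
  apply: (@le_trans _ _ ((`|r| + `|t|) ^+ 2)); last by rewrite exprn_ile1// addr_ge0.
  rewrite sqrrD !real_normK ?num_real//.
  have := ler_norm (- (r * t * dotp p.2 q.2)); rewrite normrN !normrM.
  have : `|r| * `|t| * `|dotp p.2 q.2| <= `|r| * `|t| by rewrite ler_piMr ?mulr_ge0// ler_norml h1.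
  lra.
move=> /(cvgB Xcvg) H.
rewrite subr0 in H; rewrite -(mulKf (lt0r_neq0 m0) (zonal_even d m r t)).
apply: cvgn_ext (cvgM (cvg_cst (moment R d m)^-1) H) => n.
transitivity ((moment R d m)^-1 * (X n - (X n - moment R d m * Y n))) => //.
by rewrite opprB addrC subrK mulKf ?gt_eqF.
Unshelve. all: by end_near.
Qed.

(** The mean of <xi, eta> |r xi - s eta|^(2m). *)
Definition zonal_odd (R : fieldType) (d m : nat) (r s : R) : R :=
  - ((moment R d m)^-1 * \sum_(k < m)
     'C(2 * m, (2 * k).+1)%:R * (moment R d k.+1 * moment R d (m - k)) * (r ^+ (2 * k).+1 * s ^+ (2 * (m - k.+1)).+1)).

Lemma moment_binE (R : numFieldType) (d k l : nat) : (0 < d)%N ->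
  'C(2 * (k + l), 2 * k)%:R * (moment R d k * moment R d l) / moment R d (k + l) =
  'C(k + l, k)%:R * rising2 R d (k + l) / (rising2 R d k * rising2 R d l).
Proof.
move=> d0; rewrite !momentE.
have h (c n : nat) : (0 < c)%N -> rising2 R c n != 0 by move=> c0; rewrite gt_eqF// rising2_gt0.
have h0 := h 1 (k + l)%N isT.
have h1 := h d k d0; have h2 := h d l d0; have h3 := h d (k + l)%N d0.
have := bin_even R k l.
move: h0 h1 h2 h3.
move: ('C(2 * (k + l), 2 * k)%:R) ('C(k + l, k)%:R) (rising2 R 1 k) (rising2 R 1 l) (rising2 R 1 (k + l)).
move: (rising2 R d k) (rising2 R d l) (rising2 R d (k + l)).
move=> a b c x y u v w h0 h1 h2 h3 E.
have -> : x * (u / a * (v / b)) / (w / c) = (x * (u * v)) * (c / (w * (a * b))) by field; rewrite h0 h1 h2 h3.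
by rewrite E; field; rewrite h0 h1 h2.
Qed.

(** Every term is a rational multiple of [z m i], which reduces the claim to an identity of rational
    functions. Writing m as i + l + 1 encodes i < m. *)
Lemma zonal_coef_identity (R : numFieldType) (d i l : nat) : (0 < d)%N ->
  let z m k := 'C(2 * m, 2 * k)%:R * (moment R d k * moment R d (m - k)) / moment R d m in
  let m := (i + l.+1)%N in
  z m i + z m i.+1 - z m.+1 i.+1 =
  - (2 * ('C(2 * m, (2 * i).+1)%:R * (moment R d i.+1 * moment R d (m - i)) / moment R d m)).
Proof.
move=> d0 z m.
have zE k j : z (k + j)%N k = 'C(k + j, k)%:R * rising2 R d (k + j) / (rising2 R d k * rising2 R d j).
  by rewrite /z addKn moment_binE.
have m1 : m = (i.+1 + l)%N by rewrite /m addSnnS.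
have m2 : m.+1 = (i.+1 + l.+1)%N by rewrite /m addSn.
have h (c n : nat) : (0 < c)%N -> rising2 R c n != 0 by move=> c0; rewrite gt_eqF// rising2_gt0.
have hm n : moment R d n != 0 by rewrite gt_eqF// moment_gt0.
have i1 : i.+1%:R != 0 :> R by rewrite pnatr_eq0.
have di : (d + 2 * i)%:R != 0 :> R by rewrite pnatr_eq0; lia.
have dl : (d + 2 * l)%:R != 0 :> R by rewrite pnatr_eq0; lia.
have C1 : 'C(m, i.+1)%:R = l.+1%:R / i.+1%:R * 'C(m, i)%:R :> R.
  have := mul_bin_left m i; rewrite [in (m - i)%N]/m addKn => /(congr1 (fun n => n%:R : R)).
  by rewrite !natrM => h1; apply: (mulfI i1); rewrite h1 mulrA mulrCA divff// mulr1.
have C2 : 'C(m.+1, i.+1)%:R = m.+1%:R / i.+1%:R * 'C(m, i)%:R :> R.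
  have := mul_bin_diag m.+1 i; rewrite /= => /(congr1 (fun n => n%:R : R)).
  by rewrite !natrM => h1; apply: (mulfI i1); rewrite -h1 mulrA mulrCA divff// mulr1.
have zi1 : z m i.+1 = z m i * ((l.+1%:R / i.+1%:R) * ((d + 2 * l)%:R / (d + 2 * i)%:R)).
  rewrite [in LHS]m1 zE -m1 C1 {3}/m zE -/m !rising2S.
  have h1 := h d i d0; have h2 := h d l d0.
  move: h1 h2 i1 di dl {C1 C2}; move: (rising2 R d i) (rising2 R d l) (rising2 R d m) (i.+1%:R) (l.+1%:R).
  move: (d + 2 * i)%:R (d + 2 * l)%:R ('C(m, i)%:R) => a b c x y w u v h1 h2 h3 h4 h5.
  by field; rewrite h1 h2 h3 h4 h5.
have zi2 : z m.+1 i.+1 = z m i * ((m.+1%:R / i.+1%:R) * ((d + 2 * m)%:R / (d + 2 * i)%:R)).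
  rewrite [in LHS]m2 zE -m2 C2 {3}/m zE -/m !rising2S.
  have h1 := h d i d0; have h2 := h d l d0.
  move: h1 h2 i1 di dl {C1 C2 zi1}; move: (rising2 R d i) (rising2 R d l) (rising2 R d m) (i.+1%:R) (m.+1%:R).
  move: (d + 2 * i)%:R (d + 2 * l)%:R (d + 2 * m)%:R ('C(m, i)%:R) => a b e c x y w u v h1 h2 h3 h4 h5.
  by field; rewrite h1 h2 h3 h4 h5.
have zo : 'C(2 * m, (2 * i).+1)%:R * (moment R d i.+1 * moment R d (m - i)) / moment R d m =
    z m i * ((2 * l.+1%:R) / (d + 2 * i)%:R).
  have k1 : (2 * i).+1%:R != 0 :> R by rewrite pnatr_eq0.
  have C3 : 'C(2 * m, (2 * i).+1)%:R = (2 * l.+1%:R) / (2 * i).+1%:R * 'C(2 * m, 2 * i)%:R :> R.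
    have := mul_bin_left (2 * m) (2 * i); rewrite -mulnBr [in (m - i)%N]/m addKn => /(congr1 (fun n => n%:R : R)).
    by rewrite !natrM => h1; apply: (mulfI k1); rewrite h1 mulrA mulrCA divff// mulr1.
  rewrite C3 momentS /z; have h1 := hm m.
  move: h1 k1 di; move: (moment R d m) (moment R d (m - i)) (moment R d i) ((2 * i).+1%:R) (d + 2 * i)%:R.
  move: (l.+1%:R) ('C(2 * m, 2 * i)%:R) => x1 x2 x3 x4 x5 x6 x7 h1 h2 h3.
  by field; rewrite h1 h2 h3.
rewrite zi1 zi2 zo.
have -> : (d + 2 * m)%:R = (d + 2 * i)%:R + 2 * l.+1%:R :> R by rewrite -natrM -natrD; congr (_%:R); lia.
have -> : (d + 2 * l)%:R = d%:R + 2 * l.+1%:R - 2 :> R.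
  by rewrite -natrM -natrD -natrB; [congr (_%:R)|]; lia.
have -> : m.+1%:R = i.+1%:R + l.+1%:R :> R by rewrite -natrD; congr (_%:R); lia.
have d3 : d%:R = (d + 2 * i)%:R - 2 * i.+1%:R + 2 :> R.
  have -> : 2 * i.+1%:R = (2 * i)%:R + 2 :> R by rewrite -natrM -natrD; congr (_%:R); lia.
  by rewrite natrD; ring.
rewrite d3; move: (z m i) i1 di; move: (i.+1%:R) (d + 2 * i)%:R (l.+1%:R) => x y w u h1 h2.
by field; rewrite h1 h2.
Qed.

(** The mean of the law of cosines r^2 + s^2 - |r xi - s eta|^2 = 2 r s <xi, eta>, multiplied by |r
    xi - s eta|^(2m). It is verified on the coefficients of r^(2(k+1)) s^(2(m-k)). *)
Lemma zonal_odd_identity (R : numFieldType) (d m : nat) (r s : R) : (0 < d)%N ->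
  (r ^+ 2 + s ^+ 2) * zonal_even d m r s - zonal_even d m.+1 r s = 2 * (r * s) * zonal_odd d m r s.
Proof.
move=> d0; rewrite /zonal_even /zonal_odd.
pose z m k := 'C(2 * m, 2 * k)%:R * (moment R d k * moment R d (m - k)) / moment R d m.
have zE n : (moment R d n)^-1 * \sum_(k < n.+1) 'C(2 * n, 2 * k)%:R * (moment R d k * moment R d (n - k)) *
   (r ^+ (2 * k) * s ^+ (2 * (n - k))) = \sum_(k < n.+1) z n k * ((r ^+ 2) ^+ k * (s ^+ 2) ^+ (n - k)).
  rewrite mulr_sumr; apply: eq_bigr => k _; rewrite -!exprM /z.
  by move: (moment R d n)^-1 => x; ring.
rewrite !zE.
have z0 n : z n 0%N = 1.
  by rewrite /z muln0 bin0 moment0 !mul1r subn0 divff// gt_eqF// moment_gt0.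
have zn n : z n n = 1.
  by rewrite /z binn subnn moment0 mulr1 mul1r divff// gt_eqF// moment_gt0.
have -> : (r ^+ 2 + s ^+ 2) * (\sum_(k < m.+1) z m k * ((r ^+ 2) ^+ k * (s ^+ 2) ^+ (m - k))) =
  (s ^+ 2) ^+ m.+1 + \sum_(k < m) (z m k + z m k.+1) * ((r ^+ 2) ^+ k.+1 * (s ^+ 2) ^+ (m - k)) + (r ^+ 2) ^+ m.+1.
  rewrite mulrDl {1}big_ord_recr big_ord_recl /= z0 zn subnn subn0 !expr0 !mul1r !mulr1.
  rewrite !mulrDr -!exprS !mulr_sumr.
  transitivity (\sum_(i < m) (z m i * ((r ^+ 2) ^+ i.+1 * (s ^+ 2) ^+ (m - i))) + (r ^+ 2) ^+ m.+1 +
    ((s ^+ 2) ^+ m.+1 + \sum_(i < m) (z m i.+1 * ((r ^+ 2) ^+ i.+1 * (s ^+ 2) ^+ (m - i))))).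
    congr (_ + _ + (_ + _)); apply: eq_bigr => i _.
      by rewrite [(r ^+ 2) ^+ _.+1]exprS; ring.
    rewrite /bump /= add1n (_ : (m - i = (m - i.+1).+1)%N); last by have := ltn_ord i; lia.
    by rewrite [(s ^+ 2) ^+ (_).+1]exprS; ring.
  under [in RHS]eq_bigr do rewrite mulrDl.
  rewrite big_split /=; ring.
rewrite [X in _ - X]big_ord_recl big_ord_recr /= z0 zn subnn subn0 !expr0 !mul1r !mulr1.
transitivity (\sum_(k < m) (z m k + z m k.+1 - z m.+1 k.+1) * ((r ^+ 2) ^+ k.+1 * (s ^+ 2) ^+ (m - k))).
  under [in RHS]eq_bigr do rewrite mulrBl.
  rewrite sumrB; under [X in _ - (_ + (X + _))]eq_bigr do rewrite /bump /= add1n subSS.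
  ring.
rewrite mulrN mulr_sumr mulr_sumr -sumrN; apply: eq_bigr => k _.
have km := ltn_ord k.
have := @zonal_coef_identity R d k (m - k.+1) d0.
have -> : (k + (m - k.+1).+1 = m)%N by lia.
rewrite -/(z m k) -/(z m k.+1) -/(z m.+1 k.+1) => ->.
rewrite -!exprM (_ : (2 * k.+1 = (2 * k).+2)%N); last by lia.
have -> : (2 * (m - k) = (2 * (m - k.+1)).+2)%N by lia.
rewrite [r ^+ _.+2]exprS [s ^+ _.+2]exprS.
move: (moment R d m)^-1 => x; ring.
Qed.
Lemma cvgnZ (R : realType) (c : R) (u : nat -> R) (l : R) :
  u n @[n --> \oo] --> l -> c * u n @[n --> \oo] --> c * l.
Proof. by move=> H; apply: cvgM => //; exact: cvg_cst. Qed.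

Lemma cvgnB (R : realType) (u v : nat -> R) (l k : R) :
  u n @[n --> \oo] --> l -> v n @[n --> \oo] --> k -> u n - v n @[n --> \oo] --> l - k.
Proof. by move=> H H'; apply: cvgB. Qed.

Lemma cvgnD (R : realType) (u v : nat -> R) (l k : R) :
  u n @[n --> \oo] --> l -> v n @[n --> \oo] --> k -> u n + v n @[n --> \oo] --> l + k.
Proof. by move=> H H'; apply: cvgD. Qed.

Lemma eq_in_wsum (R : pzRingType) (T : eqType) (l : seq (R * T)) (f g : T -> R) :
  (forall p, p \in l -> f p.2 = g p.2) -> wsum l f = wsum l g.
Proof. by move=> H; apply: eq_big_seq => p /H ->. Qed.

(** For r t != 0 the law of cosines expresses <xi, eta> through the distance. For r t = 0 the
    distance is constant and only the mean of <xi, eta> is left, which tends to 0. *)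
Lemma zonal_odd_cvg (R : realType) (d m : nat) (r t : R) (s : nat -> seq (R * 'rV[R]_d)) : (0 < d)%N ->
  zonal_sequence s -> `|r| + `|t| <= 1 ->
  wsum (s n) (fun xi => wsum (s n) (fun eta =>
    dotp xi eta * dotp (r *: xi - t *: eta) (r *: xi - t *: eta) ^+ m)) @[n --> \oo] --> zonal_odd d m r t.
Proof.
move=> d0 hs rt.
have [rt0|rt0] := eqVneq (r * t) 0; last first.
  have nz : 2 * (r * t) != 0 by rewrite mulf_neq0.
  have -> : zonal_odd d m r t = (2 * (r * t))^-1 * ((r ^+ 2 + t ^+ 2) * zonal_even d m r t - zonal_even d m.+1 r t).
    by rewrite zonal_odd_identity// mulKf.
  have H1 := cvgnZ (c := r ^+ 2 + t ^+ 2) (zonal_even_cvg (m := m) d0 hs rt).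
  have H2 := cvgnZ (c := (2 * (r * t))^-1) (cvgnB H1 (zonal_even_cvg (m := m.+1) d0 hs rt)).
  apply: cvgn_ext H2 => n /=.
  apply: (mulfI nz); rewrite mulVKf//.
  rewrite -mulN1r -!wsumZ -wsumD; apply: eq_in_wsum => p ps; have [_ [_ p1] ] := (hs n, let: And3 h _ _ := hs n in h p ps).
  rewrite -!wsumZ -wsumD; apply: eq_in_wsum => q qs; have [_ [_ q1] ] := (hs n, let: And3 h _ _ := hs n in h q qs).
  by rewrite [_ ^+ m.+1]exprS; move: (dotp _ _ ^+ m) => X; rewrite dotpB_sqr//; ring.
have -> : zonal_odd d m r t = 0.
  rewrite /zonal_odd big1 ?mulr0 ?oppr0// => k _.
  by rewrite exprS [t ^+ _.+1]exprS [X in _ * X]mulrACA rt0 mul0r mulr0.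
apply/cvgrPdist_le => e e0; near=> n; rewrite sub0r normrN.
have he : n.+1%:R^-1 <= e.
  have : `|0 - harmonic n| <= e by near: n; have /cvgrPdist_le := @cvg_harmonic R; exact.
  by rewrite sub0r normrN /harmonic /= ger0_norm// invr_ge0.
apply: le_trans he; have [s0 s1 sn] := hs n.
have n1 : (1 <= n)%N by near: n; exact: nbhs_infty_ge.
rewrite wsum_exchange.
apply: wsum_prob_bound => // p /s0[p0 p1]; split => //.
have -> : wsum (s n) (fun xi => dotp xi p.2 * dotp (r *: xi - t *: p.2) (r *: xi - t *: p.2) ^+ m) =
   (r ^+ 2 + t ^+ 2) ^+ m * wsum (s n) (fun xi => dotp xi p.2 ^+ 1).
  rewrite -wsumZ; apply: eq_in_wsum => q /s0[q0 q1].
  by rewrite dotpB_sqr// rt0 mulr0 mul0r subr0 expr1 mulrC.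
have := sn 1%N n1 p.2; rewrite p1 lexx => /(_ isT); rewrite [sphere_moment _ 1 _]/sphere_moment /= subr0 => h.
rewrite normrM; apply: le_trans h; rewrite ler_piMl// normrX exprn_ile1//.
rewrite ger0_norm ?addr_ge0 ?sqr_ge0//.
apply: (@le_trans _ _ ((`|r| + `|t|) ^+ 2)); last by rewrite exprn_ile1// addr_ge0.
rewrite sqrrD !real_normK ?num_real//.
have := mulr_ge0 (normr_ge0 r) (normr_ge0 t); lra.
Unshelve. all: by end_near.
Qed.

Lemma sum_odd_indices (R : nmodType) (M : nat) (F : nat -> R) :
  \sum_(i < (2 * M).+1 | odd i) F i = \sum_(K < M) F (2 * K).+1.
Proof.
elim: M => [|M IH]; first by rewrite big_mkcond /= big_ord1 big_ord0.
have -> : (2 * M.+1).+1 = (2 * M).+3 by lia.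
rewrite big_mkcond big_ord_recr big_ord_recr /= -big_mkcond IH [RHS]big_ord_recr /=.
by rewrite mul2n odd_double /= addr0.
Qed.

(** The mean of (1 + <xi, eta>) |x xi - y eta|^(2m). Even j come from the 1 and odd j from <xi,
    eta>; this is the origin of the convention [uphalf] for odd powers. *)
Definition zonal_kernel (R : fieldType) (d m : nat) (x y : R) : R :=
  (moment R d m)^-1 * \sum_(j < (2 * m).+1) 'C(2 * m, j)%:R * (-1) ^+ j *
    (moment R d (uphalf j) * moment R d (uphalf (2 * m - j))) * (x ^+ j * y ^+ (2 * m - j)).

Lemma zonal_kernelE (R : fieldType) (d m : nat) (x y : R) :
  zonal_kernel d m x y = zonal_even d m x y + zonal_odd d m x y.
Proof.
rewrite /zonal_kernel (bigID (fun j : 'I__ => ~~ odd j)) mulrDr /=; congr (_ + _).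
  rewrite (sum_even_indices m (fun j => 'C(2 * m, j)%:R * (-1) ^+ j *
    (moment R d (uphalf j) * moment R d (uphalf (2 * m - j))) * (x ^+ j * y ^+ (2 * m - j)))).
  congr (_ * _); apply: eq_bigr => k _.
  by rewrite -mulnBr !mul2n !uphalf_double -!mul2n exprM sqrrN expr1n expr1n mulr1.
under eq_bigl do rewrite negbK.
rewrite (sum_odd_indices m (fun j => 'C(2 * m, j)%:R * (-1) ^+ j *
    (moment R d (uphalf j) * moment R d (uphalf (2 * m - j))) * (x ^+ j * y ^+ (2 * m - j)))).
rewrite /zonal_odd -mulrN -sumrN; congr (_ * _); apply: eq_bigr => k _.
have km := ltn_ord k.
have -> : (2 * m - (2 * k).+1 = (2 * (m - k.+1)).+1)%N by lia.
rewrite exprS exprM sqrrN expr1n expr1n.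
have -> : uphalf (2 * k).+1 = k.+1 by rewrite uphalfE mul2n -doubleS doubleK.
have -> : uphalf (2 * (m - k.+1)).+1 = (m - k)%N by rewrite uphalfE mul2n -doubleS doubleK; lia.
ring.
Qed.

Lemma zonal_kernel_cvg (R : realType) (d m : nat) (r t : R) (s : nat -> seq (R * 'rV[R]_d)) : (0 < d)%N ->
  zonal_sequence s -> `|r| + `|t| <= 1 ->
  wsum (s n) (fun xi => wsum (s n) (fun eta =>
    (1 + dotp xi eta) * dotp (r *: xi - t *: eta) (r *: xi - t *: eta) ^+ m)) @[n --> \oo] --> zonal_kernel d m r t.
Proof.
move=> d0 hs rt; rewrite zonal_kernelE.
apply: cvgn_ext (cvgnD (zonal_even_cvg (m := m) d0 hs rt) (zonal_odd_cvg (m := m) d0 hs rt)) => n.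
rewrite -wsumD; apply: eq_wsum => xi; rewrite -wsumD; apply: eq_wsum => eta.
by rewrite mulrDl mul1r.
Qed.

(** * The lift maps the first class into the second *)

Lemma strip_continuousE (R : realType) (phi : R * R -> R) :
  {within strip R, continuous phi} <->
  forall x t, 0 <= x < 1 -> 0 <= t -> forall e : R, 0 < e -> exists2 d : R, 0 < d &
    forall y s, 0 <= y < 1 -> 0 <= s -> `|x - y| < d -> `|t - s| < d -> `|phi (y, s) - phi (x, t)| < e.
Proof.
split=> [/within_continuousE H x t x1 t0 e e0|H].
  have [d d0 h] := H (x, t) (conj x1 t0) e e0; exists d => // y s y1 s0 xy ts.
  by apply: h.
apply/within_continuousE => -[x t] [/= x1 t0] e e0; have [d d0 h] := H x t x1 t0 e e0.
by exists d => // -[y s] [/= y1 s0] [/= xy ts]; apply: h.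
Qed.

Lemma strip_slice_continuous (R : realType) (phi : R * R -> R) (h t : R) :
  {within strip R, continuous phi} -> h < 1 -> 0 <= t ->
  {within `[0, h], continuous (fun u => phi (u, t))}.
Proof.
move=> /strip_continuousE H h1 t0; apply/within_continuousE => x; rewrite /= in_itv /= => /andP[x0 xh] e e0.
have [|d d0 hd] := H x t _ t0 e e0; first by rewrite x0 (le_lt_trans xh).
exists d => // y; rewrite /= in_itv /= => /andP[y0 yh] xy; apply: hd => //; last by rewrite subrr normr0.
by rewrite y0 (le_lt_trans yh).
Qed.

(** The Weierstrass theorem for w |-> g(h sqrt(w)) on [0, 1], followed by w = v^2 / h^2. *)
Lemma even_approximation (R : realType) (g : R -> R) (h : R) : 0 <= h -> {within `[0, h], continuous g} ->
  forall e : R, 0 < e -> exists P : {poly R}, forall v, 0 <= v <= h -> `|g v - P.[v ^+ 2]| <= e.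
Proof.
rewrite le_eqVlt => /predU1P[<- _|h0 cg] e e0.
  exists (g 0)%:P => v /andP[v0 v1]; have -> : v = 0 by apply/le_anti; rewrite v0 v1.
  by rewrite hornerC subrr normr0 ltW.
have cw : {within `[0, 1], continuous (fun w => g (h * Num.sqrt w))}.
  have /within_continuousE H := cg.
  apply/within_continuousE => x; rewrite /= in_itv /= => /andP[x0 x1] a a0.
  have sx (y : R) : 0 <= y -> y <= 1 -> `[0, h]%classic (h * Num.sqrt y).
    by move=> y0 y1; rewrite /= in_itv /= mulr_ge0 ?ler_piMr ?sqrtr_ge0 ?(ltW h0)// -sqrtr1 ler_wsqrtr.
  have [d d0 hd] := H _ (sx x x0 x1) a a0.
  have /cvgrPdist_lt/(_ (d / h)) := @sqrt_continuous R x.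
  rewrite divr_gt0// => /(_ isT) /nbhs_ballP[r /= r0 hr]; exists r => // y; rewrite /= in_itv /= => /andP[y0 y1] xy.
  apply: hd; first exact: sx.
  have := hr _ xy => /=; rewrite ltr_pdivlMr// => h2.
  by rewrite /ball /= -mulrBr normrM gtr0_norm// mulrC.
have [P HP] := weierstrass cw e0.
exists (P \Po ((h ^+ 2)^-1 *: 'X)) => v /andP[v0 vh].
have hn : h ^+ 2 != 0 by rewrite expf_neq0// gt_eqF.
rewrite horner_comp hornerZ hornerX.
have := HP ((h ^+ 2)^-1 * v ^+ 2).
have -> : h ^- 2 * v ^+ 2 = (h^-1 * v) ^+ 2 by rewrite exprMn exprVn.
have vh0 : 0 <= h^-1 * v by rewrite mulr_ge0// invr_ge0 ltW.
rewrite sqrtr_sqr (ger0_norm vh0).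
rewrite mulVKf ?gt_eqF//; apply.
by rewrite sqr_ge0 exprn_ile1// mulrC ler_pdivrMr// mul1r.
Qed.

(** Compactness of [0, h] makes the continuity in t uniform in v. *)
Lemma strip_tube (R : realType) (phi : R * R -> R) (h t : R) :
  {within strip R, continuous phi} -> h < 1 -> 0 <= t ->
  forall e : R, 0 < e -> exists2 d : R, 0 < d &
   forall v s, 0 <= v <= h -> 0 <= s -> `|t - s| < d -> `|phi (v, s) - phi (v, t)| <= e.
Proof.
move=> /strip_continuousE H h1 t0 e e0; have e2 : 0 < e / 2 by lra.
have /compact_near_coveringP/(_ R (nbhs t) (fun s v => 0 <= v <= h -> 0 <= s -> `|phi (v, s) - phi (v, t)| <= e)) := @segment_compact R 0 h.
case=> [x|d /= d0 hd].
  rewrite /= in_itv /= => /andP[x0 xh].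
  have [|d d0 hd] := H x t _ t0 (e / 2) e2; first by rewrite x0 (le_lt_trans xh).
  exists (ball x d, ball t d); first by split; exact: nbhsx_ballx.
  move=> [v s] [/= xv ts] /andP[v0 vh] s0.
  have v1 : 0 <= v < 1 by rewrite v0 (le_lt_trans vh).
  have := hd v s v1 s0 xv ts; have := hd v t v1 t0 xv.
  rewrite subrr normr0 => /(_ d0); have := ler_distD (phi (x, t)) (phi (v, s)) (phi (v, t)).
  rewrite (distrC (phi (x, t))); lra.
exists d => // v s vh s0 ts; apply: (hd s ts v) => //=.
Qed.

Lemma cvgn_by_approx (R : realType) (u : nat -> R) (l : R) :
  (forall e : R, 0 < e -> exists (v : nat -> R) (m : R), [/\ v n @[n --> \oo] --> m, forall n, `|u n - v n| <= e & `|l - m| <= e]) ->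
  u n @[n --> \oo] --> l.
Proof.
move=> H; apply/cvgrPdist_le => e e0; have e3 : 0 < e / 3 by lra.
have [v [m [/cvgrPdist_le/(_ _ e3) vm uv lm]]] := H _ e3.
near=> n; have : `|m - v n| <= e / 3 by near: n.
have := uv n; have := ler_distD m l (u n); have := ler_distD (v n) m (u n).
rewrite (distrC (v n)); lra.
Unshelve. all: by end_near.
Qed.

Lemma cvgn_cauchy (R : realType) (u : nat -> R) :
  (forall e : R, 0 < e -> exists n0, forall m n, (n0 <= m)%N -> (n0 <= n)%N -> `|u m - u n| <= e) ->
  exists l : R, u n @[n --> \oo] --> l.
Proof.
move=> H; exists (lim (u n @[n --> \oo])).
apply/cauchy_cvgP; apply/cauchy_exP => e e0; have e2 : 0 < e / 2 by lra.
have [n0 h] := H _ e2; exists (u n0).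
exists n0 => // n /= n0n; apply: (@le_lt_trans _ _ (e / 2)); last by lra.
exact: h.
Qed.

Lemma cvgn_cauchy_approx (R : realType) (u : nat -> R) :
  (forall e : R, 0 < e -> exists (v : nat -> R) (m : R), v n @[n --> \oo] --> m /\ forall n, `|u n - v n| <= e) ->
  exists l : R, u n @[n --> \oo] --> l.
Proof.
move=> H; apply: cvgn_cauchy => e e0; have e4 : 0 < e / 4 by lra.
have [v [m [/cvgrPdist_le/(_ _ e4) [n0 _ vm] uv]]] := H _ e4.
exists n0 => i j ni nj; have /= := vm i ni; have /= := vm j nj; have := uv i; have := uv j.
have := ler_distD m (u i) (u j); have := ler_distD (v i) (u i) m; have := ler_distD (v j) m (u j).
rewrite (distrC (v i)) (distrC (v j)); lra.
Qed.

Lemma cvgn_norm_le (R : realType) (u : nat -> R) (l a C : R) :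
  (forall n, `|a - u n| <= C) -> u n @[n --> \oo] --> l -> `|a - l| <= C.
Proof.
move=> H ul; apply/ler_addgt0Pr => e e0; have /cvgrPdist_le/(_ _ e0) [n0 _ /(_ n0) /=] := ul.
rewrite leqnn => /(_ isT); have := H n0; have := ler_distD (u n0) a l; rewrite (distrC (u n0)); lra.
Qed.

Lemma cvgn_ge (R : realType) (u : nat -> R) (l a : R) :
  (forall n, a <= u n) -> u n @[n --> \oo] --> l -> a <= l.
Proof. by move=> H ul; apply: (cvgr_to_ge ul); apply: nearW. Qed.

Lemma even_apply_widen (R : fieldType) (n : nat) (mu : nat -> R) (P : {poly R}) (x : R) : (size P <= n)%N ->
  even_apply mu P x = \sum_(m < n) P`_m * mu m * x ^+ (2 * m).
Proof.
move=> Pn; rewrite /even_apply (big_ord_widen n (fun m => P`_m * mu m * x ^+ (2 * m)) Pn) big_mkcond /=.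
by apply: eq_bigr => m _; case: ltnP => // /(nth_default 0) ->; rewrite !mul0r.
Qed.

Lemma even_applyD (R : fieldType) (mu : nat -> R) (P Q : {poly R}) (x : R) :
  even_apply mu (P + Q) x = even_apply mu P x + even_apply mu Q x.
Proof.
have sD := size_polyD P Q; rewrite !(@even_apply_widen _ (maxn (size P) (size Q))) ?leq_maxl ?leq_maxr//.
by rewrite -big_split; apply: eq_bigr => m _; rewrite coefD !mulrDl.
Qed.

Lemma even_applyZ (R : fieldType) (mu : nat -> R) (c : R) (P : {poly R}) (x : R) :
  even_apply mu (c *: P) x = c * even_apply mu P x.
Proof.
rewrite (even_apply_widen mu x (size_scale_leq c P)) /even_apply mulr_sumr.
by apply: eq_bigr => m _; rewrite coefZ !mulrA.
Qed.

Lemma even_applyC (R : fieldType) (mu : nat -> R) (c x : R) : even_apply mu c%:P x = c * mu 0%N.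
Proof.
by rewrite (@even_apply_widen _ 1) ?size_polyC_leq1// big_ord1 coefC eqxx muln0 expr0 mulr1.
Qed.

Lemma even_applyB (R : fieldType) (mu : nat -> R) (P Q : {poly R}) (x : R) :
  even_apply mu (P - Q) x = even_apply mu P x - even_apply mu Q x.
Proof. by rewrite -scaleN1r even_applyD even_applyZ mulN1r. Qed.

Lemma even_apply1 (R : fieldType) (P : {poly R}) (x : R) : even_apply (fun=> 1) P x = P.[x ^+ 2].
Proof. by rewrite /even_apply horner_coef; apply: eq_bigr => m _; rewrite mulr1 -exprM. Qed.

Definition even_multiplier (R : fieldType) (mu : nat -> R) (P : {poly R}) : {poly R} :=
  \poly_(m < size P) (P`_m * mu m).

Lemma horner_even_multiplier (R : fieldType) (mu : nat -> R) (P : {poly R}) (x : R) :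
  (even_multiplier mu P).[x ^+ 2] = even_apply mu P x.
Proof. by rewrite horner_poly; apply: eq_bigr => m _; rewrite -exprM. Qed.

(* A single polynomial serves all parameters t close to a given one, so approximability with uniform constants
   gives joint continuity. *)
Lemma approx_strip_continuous (R : realType) (phi G : R * R -> R) :
  {within strip R, continuous phi} ->
  (forall x0 e, 0 <= x0 < 1 -> 0 < e -> exists h a C (T : {poly R} -> {poly R}), [/\ 0 <= h < 1, x0 < a, 0 <= C &
    forall x t eta P, 0 <= x < a -> 0 <= t -> 0 <= eta -> (forall v, 0 <= v <= h -> `|phi (v, t) - P.[v ^+ 2]| <= eta) ->
    `|G (x, t) - (T P).[x ^+ 2]| <= e + C * eta]) ->
  {within strip R, continuous G}.
Proof.
move=> cphi HG; apply/strip_continuousE => x t x01 t0 e e0.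
have e8 : 0 < e / 8 by lra.
have [h [a [C [T [/andP[h0 h1] xa C0 HT]]]]] := HG x (e / 8) x01 e8.
have D0 : 0 < C + 1 by lra.
pose eta := e / 8 / (C + 1); have eta0 : 0 < eta by rewrite divr_gt0.
have Ce : C * eta <= e / 8 by rewrite mulrCA ler_piMr ?(ltW e8)// ler_pdivrMr// mul1r; lra.
have [P HP] := even_approximation h0 (strip_slice_continuous cphi h1 t0) eta0.
have [d1 d10 Hd1] := strip_tube cphi h1 t0 eta0.
pose W := T P \Po 'X ^+ 2.
have WE y : W.[y] = (T P).[y ^+ 2] by rewrite /W horner_comp hornerXn.
have /cvgrPdist_lt/(_ _ e8) := @continuous_horner R W x.
move=> [d2 /= d20 Hd2].
exists (Num.min (a - x) (Num.min d1 d2)) => [|y s /andP[y0 y1] s0].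
  by rewrite !lt_min d10 d20 !andbT; lra.
rewrite !lt_min => /and3P[xy1 _ xy2] /and3P[_ ts _].
have ya : y < a by move: xy1; rewrite distrC => /ltr_normlW; lra.
have h2 := Hd2 y xy2; rewrite /= !WE in h2.
have H1 : `|G (x, t) - (T P).[x ^+ 2]| <= e / 8 + C * eta.
  by apply: HT => //; [case/andP: x01 => -> | exact: ltW].
have H2 : `|G (y, s) - (T P).[y ^+ 2]| <= e / 8 + C * (2 * eta).
  apply: HT => //; [by rewrite y0 | by rewrite mulr_ge0// ltW|].
  move=> v vh; have := Hd1 v s vh s0 ts; have := HP v vh; have := ler_distD (phi (v, t)) (phi (v, s)) P.[v ^+ 2]; lra.
rewrite mulrCA in H2.
move: h2 H1 H2; move: (T P).[_] (T P).[_] (G _) (G _) (C * eta) Ce => p q g g' z Ce.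
by rewrite !ltr_norml !ler_norml; lra.
Qed.

Lemma dotpBr (R : comPzRingType) (d : nat) (x y z : 'rV[R]_d) : dotp x (y - z) = dotp x y - dotp x z.
Proof. by rewrite -scaleN1r dotpDr dotpZr mulN1r. Qed.

Lemma euclidean_norm_sqr (R : realType) (d : nat) (x : 'rV[R]_d) : euclidean_norm x ^+ 2 = dotp x x.
Proof.
rewrite /euclidean_norm sqr_sqrtr; last by apply: sumr_ge0 => i _; exact: sqr_ge0.
by apply: eq_bigr => i _; rewrite expr2.
Qed.

Lemma euclidean_norm_ge0 (R : realType) (d : nat) (x : 'rV[R]_d) : 0 <= euclidean_norm x.
Proof. exact: sqrtr_ge0. Qed.

Lemma dotp_unit_le (R : realType) (d : nat) (xi x : 'rV[R]_d) : dotp xi xi = 1 -> `|dotp xi x| <= euclidean_norm x.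
Proof.
move=> x1; rewrite -(ler_pXn2r (n := 2)) ?nnegrE ?euclidean_norm_ge0// euclidean_norm_sqr real_normK ?num_real//.
have := dotp_ge0 (x - dotp xi x *: xi).
rewrite -scaleNr dotpDl !dotpDr !dotpZl !dotpZr x1 (dotpC x xi); move: (dotp x x) (dotp xi x) => a b.
by rewrite expr2; lra.
Qed.

Lemma half_ball_diff (R : realType) (d : nat) (x y : 'rV[R]_d) : half_ball R d x -> half_ball R d y ->
  0 <= euclidean_norm (x - y) < 1.
Proof.
rewrite /half_ball /= => x1 y1; rewrite euclidean_norm_ge0 -(ltr_pXn2r (n := 2)) ?nnegrE ?euclidean_norm_ge0//.
have sq (z : 'rV[R]_d) : euclidean_norm z < 2^-1 -> dotp z z < 4^-1.
  move=> z1; rewrite -euclidean_norm_sqr.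
  have -> : 4^-1 = 2^-1 ^+ 2 :> R by field.
  by rewrite ltr_pXn2r ?nnegrE ?euclidean_norm_ge0.
rewrite expr1n euclidean_norm_sqr; have := sq _ x1; have := sq _ y1; have := dotp_ge0 (x + 1 *: y).
rewrite -scaleN1r !dotpDl !dotpDr !dotpZl !dotpZr (dotpC y x); lra.
Qed.

Lemma quadrature_horner_cvg (R : realType) (d : nat) (s : nat -> seq (R * 'rV[R]_d)) (P : {poly R}) (y : 'rV[R]_d) :
  zonal_sequence s -> dotp y y <= 1 ->
  wsum (s n) (fun xi => P.[dotp xi y ^+ 2]) @[n --> \oo] --> even_apply (moment R d) P (euclidean_norm y).
Proof.
move=> hs y1; rewrite /even_apply.
have H (m : 'I_(size P)) (_ : true) :
   P`_m * wsum (s n) (fun xi => dotp xi y ^+ (2 * m)) @[n --> \oo] --> P`_m * moment R d m * euclidean_norm y ^+ (2 * m).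
  rewrite -mulrA; apply: cvgnZ; have := zonal_moment_cvg (m := (2 * m)%N) hs y1.
  by rewrite /sphere_moment mul2n odd_double doubleK -mul2n exprM euclidean_norm_sqr.
apply: (cvgn_ext (u := fun n => \sum_(m < size P) P`_m * wsum (s n) (fun xi => dotp xi y ^+ (2 * m)))); last first.
  by apply: cvgn_sum => m _; exact: H.
move=> n; under eq_bigr do rewrite -wsumZ.
by rewrite -wsum_sum; apply: eq_wsum => xi; rewrite horner_coef; apply: eq_bigr => m _; rewrite -exprM.
Qed.

Lemma quadrature_lift_cvg (R : realType) (d : nat) (s : nat -> seq (R * 'rV[R]_d)) (phi : R * R -> R)
    (y : 'rV[R]_d) (t : R) : (2 <= d)%N -> zonal_sequence s -> {within strip R, continuous phi} ->
  euclidean_norm y < 1 -> 0 <= t ->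
  wsum (s n) (fun xi => phi (`|dotp xi y|, t)) @[n --> \oo] --> dimension_lift d phi (euclidean_norm y, t).
Proof.
move=> d2 hs cphi y1 t0; apply: cvgn_by_approx => e e0.
have cy := strip_slice_continuous cphi y1 t0.
have [P HP] := even_approximation (euclidean_norm_ge0 y) cy e0.
exists (fun n => wsum (s n) (fun xi => P.[dotp xi y ^+ 2])), (even_apply (moment R d) P (euclidean_norm y)); split.
- apply: quadrature_horner_cvg => //.
  by rewrite -euclidean_norm_sqr exprn_ile1// ?euclidean_norm_ge0// ltW.
- move=> n; rewrite -mulN1r -wsumZ -wsumD; have [s0 s1 _] := hs n.
  apply: wsum_prob_bound => // p /s0[p0 p1]; split => //.
  by rewrite mulN1r -(real_normK (num_real (dotp p.2 y))); apply: HP; rewrite normr_ge0 dotp_unit_le.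
- by apply: dimension_lift_approx => //; rewrite euclidean_norm_ge0.
Qed.

Lemma dimension_lift_class (R : realType) (d d' : nat) (phi : R * R -> R) : (2 <= d)%N ->
  class_P R 1 d' phi -> class_P R d d' (dimension_lift d phi).
Proof.
move=> d2 [phi0 cphi phi1 pphi]; split.
- by move=> p np; rewrite /dimension_lift patchE memNset.
- apply: (approx_strip_continuous cphi) => x0 e /andP[x00 x01] e0.
  exists ((1 + x0) / 2), ((1 + x0) / 2), 1, (even_multiplier (moment R d)); split; [lra|lra|exact: ler01|].
  move=> x t eta P /andP[x0' xa] t0 eta0 HP; have x1 : x < 1 by lra.
  rewrite horner_even_multiplier mul1r; apply: (@le_trans _ _ eta); last by lra.
  apply: dimension_lift_approx => //; first by rewrite x0'.
    exact: strip_slice_continuous.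
  by move=> v /andP[v0 vx]; apply: HP; rewrite v0; lra.
- by rewrite dimension_lift0.
- move=> K a p Hp.
  have [s hs] := @sphere_quadrature_sequence R d ltac:(lia).
  have H (i j : 'I_K) : a i * a j * wsum (s n) (fun xi => phi (`|dotp xi ((p i).1 - (p j).1)|, euclidean_norm ((p i).2 - (p j).2)))
    @[n --> \oo] --> a i * a j * dimension_lift d phi (euclidean_norm ((p i).1 - (p j).1), euclidean_norm ((p i).2 - (p j).2)).
    apply: cvgnZ; apply: quadrature_lift_cvg => //; last exact: euclidean_norm_ge0.
    by have [] := andP (half_ball_diff (proj1 (Hp i)) (proj1 (Hp j))).
  apply: cvgn_ge; last by apply: cvgn_sum => i _; apply: cvgn_sum => j _; exact: H.
  move=> n /=; have [s0 s1 _] := hs n.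
  have -> : \sum_(i < K) \sum_(j < K) a i * a j *
      wsum (s n) (fun xi => phi (`|dotp xi ((p i).1 - (p j).1)|, euclidean_norm ((p i).2 - (p j).2))) =
    wsum (s n) (fun xi => \sum_(i < K) \sum_(j < K) a i * a j *
      phi (`|dotp xi ((p i).1 - (p j).1)|, euclidean_norm ((p i).2 - (p j).2))).
    rewrite wsum_sum; apply: eq_bigr => i _; rewrite wsum_sum; apply: eq_bigr => j _.
    by rewrite wsumZ.
  rewrite /wsum big_seq; apply: sumr_ge0 => q /s0[q0 q1]; rewrite mulr_ge0//.
  (* For a fixed node [q.2], projection onto its direction maps the half ball of R^d into that of
     R^1. *)
  have := pphi K a (fun i => (const_mx (dotp q.2 (p i).1), (p i).2)).
  move=> /(_ _)/le_trans; apply.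
    move=> i; split => //; rewrite /half_ball /= euclidean_norm1 mxE.
    by apply: (le_lt_trans (dotp_unit_le _ q1)); have [] := Hp i.
  apply: ler_sum => i _; apply: ler_sum => j _ /=.
  by rewrite euclidean_norm1 !mxE dotpBr.
Qed.

(** * Injectivity *)

Lemma wsum_bound (R : realDomainType) (T : eqType) (l : seq (R * T)) (f : T -> R) (C M : R) : 0 <= M ->
  \sum_(p <- l) `|p.1| <= C -> (forall p, p \in l -> `|f p.2| <= M) -> `|wsum l f| <= C * M.
Proof.
move=> M0 lC H; apply: (@le_trans _ _ ((\sum_(p <- l) `|p.1|) * M)); last exact: ler_wpM2r.
apply: (le_trans (ler_norm_sum _ _ _)); rewrite mulr_suml big_seq [X in _ <= X]big_seq.
by apply: ler_sum => p pl; rewrite normrM ler_wpM2l// H.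
Qed.

Lemma even_apply_norm (R : realFieldType) (mu : nat -> R) (P : {poly R}) (x : R) :
  even_apply mu P `|x| = even_apply mu P x.
Proof. by apply: eq_bigr => m _; rewrite !exprM real_normK ?num_real. Qed.

(* Multiplication by v^2 acts on lifts through mu_{m+1} / mu_m = 1 - (d - 1) / (d + 2 m), and the multiplier
   1 / (d + 2 m) averages dilations. *)
Lemma even_apply_mulX_bound (R : realType) (d : nat) : (0 < d)%N ->
  exists2 K : R, 0 <= K & forall (P : {poly R}) (eta h : R), h <= 1 ->
    (forall x, 0 <= x <= h -> `|even_apply (moment R d) P x| <= eta) ->
    forall x, 0 <= x <= h -> `|even_apply (moment R d) ('X * P) x| <= K * eta.
Proof.
(* This measure has moments 1 / (j + d), hence 1 / (d + 2m) at j = 2m. *)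
move=> d0; have [l [C [lC l1 la]]] := bounded_moments_inv R d.-1.
have C0 : 0 <= C by apply: le_trans (lC 0%N); apply: sumr_ge0.
exists (1 + d%:R * C) => [|P eta h h1 H x /andP[x0 xh]].
  by rewrite addr_ge0// mulr_ge0.
have eta0 : 0 <= eta by apply: le_trans (H x _); rewrite ?normr_ge0// x0.
pose F := even_apply (moment R d) P.
pose S := \sum_(m < size P) P`_m * moment R d m * x ^+ (2 * m) * (2 * m + d)%:R^-1.
have -> : even_apply (moment R d) ('X * P) x = x ^+ 2 * (F x - d.-1%:R * S).
  rewrite (@even_apply_widen _ (size P).+1); last first.
    by rewrite (leq_trans (size_polyMleq _ _))// size_polyX.
  rewrite big_ord_recl coefXM /= !mul0r add0r /F /even_apply /S mulr_sumr -sumrB mulr_sumr.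
  apply: eq_bigr => m _; rewrite coefXM /bump /= add1n momentS mulnS exprD.
  have n0 : (2 * m + d)%:R != 0 :> R by rewrite pnatr_eq0; lia.
  have -> : (2 * m).+1%:R = (2 * m + d)%:R - d.-1%:R :> R by rewrite -natrB; [congr (_%:R)|]; lia.
  rewrite (addnC d); move: n0; move: (2 * m + d)%:R => y n0.
  by field.
have S1 : `|S| <= C * eta.
  rewrite -[S]subr0 distrC; apply: (cvgn_norm_le (u := fun n => wsum (l n) (fun s => F (x * s)))).
    move=> n; rewrite sub0r normrN; apply: wsum_bound => // p pl.
    rewrite /F -even_apply_norm; apply: H; rewrite normr_ge0 normrM (ger0_norm x0).
    by apply: le_trans xh; rewrite ler_piMr// (l1 n).
  apply: (cvgn_ext (u := fun n => \sum_(m < size P) P`_m * moment R d m * x ^+ (2 * m) * wsum (l n) (fun s => s ^+ (2 * m)))).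
    move=> n; under eq_bigr do rewrite -wsumZ.
    rewrite -wsum_sum; apply: eq_wsum => s; apply: eq_bigr => m _.
    by rewrite exprMn; ring.
  apply: cvgn_sum => m _; apply: cvgnZ.
  have := la (2 * m)%N; rewrite -addnS prednK//.
rewrite normrM.
have x2 : `|x ^+ 2| <= 1 by rewrite normrX exprn_ile1// ger0_norm// (le_trans xh).
apply: (@le_trans _ _ `|F x - d.-1%:R * S|); first by rewrite ler_piMl.
apply: (le_trans (ler_normB _ _)); rewrite mulrDl mul1r lerD//; first by apply: H; rewrite x0.
by rewrite normrM normr_nat -mulrA; apply: ler_pM => //; rewrite ler_nat leq_pred.
Qed.

(** By Horner's scheme. The constant depends on Q and not on P, so that P can be chosen after it. *)
Lemma even_applyM_bound (R : realType) (d : nat) (Q : {poly R}) : (0 < d)%N ->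
  exists2 K : R, 0 <= K & forall (P : {poly R}) (eta h : R), h <= 1 ->
    (forall x, 0 <= x <= h -> `|even_apply (moment R d) P x| <= eta) ->
    forall x, 0 <= x <= h -> `|even_apply (moment R d) (Q * P) x| <= K * eta.
Proof.
move=> d0; have [K1 K10 HK1] := even_apply_mulX_bound R d0.
elim/poly_ind: Q => [|Q c [K K0 HK]].
  exists 0 => // P eta h h1 H x _.
  by rewrite mul0r /even_apply size_poly0 big_ord0 normr0 mul0r.
exists (K1 * K + `|c|) => [|P eta h h1 H x xh]; first by rewrite addr_ge0// mulr_ge0.
have -> : (Q * 'X + c%:P) * P = 'X * (Q * P) + c *: P by rewrite mulrDl mul_polyC (mulrC Q) mulrA.
rewrite even_applyD even_applyZ; apply: (le_trans (ler_normD _ _)).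
rewrite mulrDl -mulrA lerD//; first by apply: (HK1 _ _ h) => //; apply: HK.
by rewrite normrM ler_wpM2l// H.
Qed.

(** If f u > 0, continuity keeps f above f u / 2 on an interval of positive length to the right of
    u. Continuity is asked on [0, b] with b < h because the weight of the lift may be singular at
    h. *)
Lemma Rintegral_eq0_ge0 (R : realType) (f : R -> R) (h b u : R) :
  leb.-integrable `[0, h] (EFin \o f) -> (forall x, 0 <= f x) -> \int[leb]_(x in `[0, h]) f x = 0 ->
  b < h -> {within `[0, b], continuous f} -> 0 < u < b -> f u = 0.
Proof.
move=> intf f0 I0 bh /within_continuousE cf /andP[u0 ub]; apply/eqP/negPn/negP => fu0.
have fu : 0 < f u by rewrite lt_neqAle eq_sym fu0 f0.
have ab0 : `[0, b]%classic u by rewrite /= in_itv /= !ltW.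
have f2 : 0 < f u / 2 by lra.
have [r r0 hr] := cf u ab0 _ f2.
pose c := Num.min b (u + r / 2).
have uc : u < c by rewrite /c lt_min ub; lra.
have cb : c <= b by rewrite /c ge_min lexx.
have cr : c <= u + r / 2 by rewrite /c ge_min lexx orbT.
have low x : u <= x <= c -> f u / 2 <= f x.
  move=> /andP[ux xc];   have xb : 0 <= x <= b by apply/andP; split; lra.
  have ur : ball u r x by rewrite /ball /= distrC ger0_norm; lra.
  by have := hr x; rewrite /= in_itv /= => /(_ xb ur); rewrite ltr_norml; lra.
have sub : `[u, c]%classic `<=` `[0, h]%classic.
  by move=> x; rewrite /= !in_itv /= => /andP[ux xc]; lra.
have mf : measurable_fun `[0, h]%classic (EFin \o f) by case/integrableP: intf.
have If : (\int[leb]_(x in `[0%R, h]) (f x)%:E = 0)%E.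
  have /fineK : (\int[leb]_(x in `[0%R, h]) (f x)%:E)%E \is a fin_num by exact: integrable_fin_num.
  by move: I0; rewrite /Rintegral => -> <-.
have : (\int[leb]_(x in `[u, c]) (f x)%:E <= 0)%E.
  rewrite -If; apply: ge0_subset_integral => //; by move=> x _; rewrite lee_fin.
have : ((f u / 2)%:E * leb `[u, c]%classic <= \int[leb]_(x in `[u, c]) (f x)%:E)%E.
  rewrite -integral_cst//; apply: ge0_le_integral => //.
  - by move=> x _; rewrite lee_fin ltW.
  - exact: measurable_funS mf.
rewrite lebesgue_measure_itv /= lte_fin uc => h1 h2.
have := le_trans h1 h2; rewrite -EFinB -EFinM lee_fin leNgt mulr_gt0//; lra.
Qed.

Lemma within_continuousB (R : realType) (A : set R) (f g : R -> R) :
  {within A, continuous f} -> {within A, continuous g} -> {within A, continuous (fun u => f u - g u)}.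
Proof. by move=> cf cg x; apply: cvgB; [exact: cf|exact: cg]. Qed.

Lemma lift_injective_slice (R : realType) (d : nat) (phi psi : R * R -> R) (t : R) : (2 <= d)%N ->
  {within strip R, continuous phi} -> {within strip R, continuous psi} -> 0 <= t ->
  dimension_lift d phi = dimension_lift d psi ->
  forall u, 0 <= u < 1 -> phi (u, t) = psi (u, t).
Proof.
move=> d2 cphi cpsi t0 E u /andP[]; rewrite le_eqVlt => /predU1P[<- _|u0 u1].
  by rewrite -(dimension_lift0 d phi t0) E dimension_lift0.
(* Two margins u < b < h < 1: the functions are approximated on [0, h], and the weight belonging to
   h is continuous on [0, b]. *)
pose b := (u + 1) / 2; pose h := (b + 1) / 2.
have h0 : 0 < h < 1 by rewrite /h /b; lra.
have h00 : 0 <= h by lra.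
have h01 : 0 <= h < 1 by lra.
have c1 := strip_slice_continuous cphi (proj2 (andP h0)) t0.
have c2 := strip_slice_continuous cpsi (proj2 (andP h0)) t0.
pose g v := phi (v, t) - psi (v, t).
have cg : {within `[0, h], continuous g} by exact: within_continuousB.
have cg2 : {within `[0, h], continuous (fun v => g v * g v)} by exact: within_continuousM.
have [P HP] : exists P : R -> {poly R}, forall eta, 0 < eta ->
    (forall v, 0 <= v <= h -> `|g v - (P eta).[v ^+ 2]| <= eta) /\
    (forall x, 0 <= x <= h -> `|even_apply (moment R d) (P eta) x| <= eta).
  have H eta : exists P : {poly R}, 0 < eta ->
    (forall v, 0 <= v <= h -> `|g v - P.[v ^+ 2]| <= eta) /\
    (forall x, 0 <= x <= h -> `|even_apply (moment R d) P x| <= eta).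
    have [eta0|] := ltP 0 eta; last by exists 0.
    have e2 : 0 < eta / 2 by lra.
    have [P1 HP1] := even_approximation h00 c1 e2.
    have [P2 HP2] := even_approximation h00 c2 e2.
    (* Approximating phi and psi separately lets the equality of their lifts bound the lift of the
       difference. *)
    exists (P1 - P2) => _; split=> v /andP[v0 vh].
      have := HP1 v; have := HP2 v; rewrite v0 vh hornerD hornerN => /(_ isT) + /(_ isT).
      rewrite /g; move: (phi _) (psi _) P1.[_] P2.[_] => a b' c e'.
      by rewrite !ler_norml; lra.
    have v1 : v < 1 by lra.
    have cut (w : R) : 0 <= w <= v -> 0 <= w <= h by lra.
    have h1 := dimension_lift_approx d2 (introT andP (conj v0 v1)) t0 (strip_slice_continuous cphi v1 t0)
      (fun w hw => HP1 w (cut w hw)).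
    have h2 := dimension_lift_approx d2 (introT andP (conj v0 v1)) t0 (strip_slice_continuous cpsi v1 t0)
      (fun w hw => HP2 w (cut w hw)).
    rewrite even_applyB; move: h1 h2; rewrite E; move: (dimension_lift _ _ _) (even_apply _ _ _) (even_apply _ _ _) => a b' c.
    by rewrite !ler_norml; lra.
  by have [P HP] := boolp.choice H; exists P.
have [M M0 gM] : exists2 M, 0 <= M & forall v, 0 <= v <= h -> `|g v| <= M.
  have [c _ Hc] := EVT_max h00 cg2.
  exists (g c * g c + 1) => [|v vh]; first by rewrite -expr2 addr_ge0// sqr_ge0.
  have := Hc v; rewrite in_itv /= => /(_ vh); rewrite -!expr2 -(real_normK (num_real (g v))).
  by have := normr_ge0 (g v); move: `|g v| (g c ^+ 2) => y z; nra.
pose G2 (p : R * R) := g p.1 * g p.1.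
have L2 : dimension_lift d G2 (h, t) = 0.
  apply/eqP; rewrite -normr_le0; apply/ler_addgt0Pr => e e0; rewrite add0r.
  have D0 : 0 < M + 1 by lra.
  pose e1 := Num.min 1 (e / 4 / (M + 1)).
  have e10 : 0 < e1 by rewrite lt_min ltr01/= !divr_gt0.
  have e11 : e1 <= 1 by rewrite ge_min lexx.
  have e1M : (M + 1) * e1 <= e / 4.
    apply: (@le_trans _ _ ((M + 1) * (e / 4 / (M + 1)))).
      by apply: ler_wpM2l; [lra|rewrite ge_min lexx orbT].
    by rewrite mulrC divfK ?gt_eqF.
  (* [K] depends on [P e1], so the accuracy [e2] of the second factor is chosen after it. *)
  have [K K0 HK] := @even_applyM_bound R d (P e1) (ltnW d2).
  pose e2 := Num.min e1 (e / 4 / (K + 1)).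
  have e20 : 0 < e2 by rewrite lt_min e10/= !divr_gt0// ltr_wpDl.
  have e21 : e2 <= e1 by rewrite ge_min lexx.
  have e2K : K * e2 <= e / 4.
    apply: (@le_trans _ _ ((K + 1) * (e / 4 / (K + 1)))); last by rewrite mulrC divfK// gt_eqF// ltr_wpDl.
    by apply: ler_pM => //; [exact: ltW|lra|rewrite ge_min lexx orbT].
  have [HQ1 _] := HP _ e10; have [HQ2 HQ3] := HP _ e20.
  have hh : 0 <= h <= h by rewrite h00 lexx.
  have := HK (P e2) e2 h (ltW (proj2 (andP h0))) HQ3 h hh.
  have : `|dimension_lift d G2 (h, t) - even_apply (moment R d) (P e1 * P e2) h| <= 2 * (e / 4).
    apply: dimension_lift_approx => // v vh.
    rewrite hornerM /G2 /=; have := HQ1 v vh; have := HQ2 v vh; have := gM v vh.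
    move: (g v) ((P e1).[_]) ((P e2).[_]) => a q p aM pa qa.
    have -> : a * a - q * p = a * (a - q) + (q - a + a) * (a - p) by ring.
    apply: (le_trans (ler_normD _ _)); rewrite !normrM.
    have n1 := ler_normD (q - a) a; rewrite distrC in qa.
    rewrite (distrC a q).
    have : `|a| * `|q - a| <= (M + 1) * e1 by apply: ler_pM => //; lra.
    have : `|q - a + a| * `|a - p| <= (M + 1) * e1 by apply: ler_pM => //; lra.
    lra.
  move: (even_apply _ _ _) (dimension_lift _ _ _) => a c h1 h2.
  by have := ler_distD a c 0; rewrite !subr0; lra.
have [e de] : exists e, d = e.+2 by by exists (d - 2)%N; rewrite -addn2 subnK.
subst d; have [iw _] := weight_moments e (proj1 (andP h0)).
move: L2; rewrite dimension_liftE// => /eqP; rewrite mulf_eq0 invr_eq0 mulf_eq0.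
rewrite gt_eqF ?weight_mass_gt0//= (gt_eqF (proj1 (andP h0)))/= => /eqP I0.
have := Rintegral_eq0_ge0 (b := b) (u := u) (integrable_mul_weight cg2 iw) _ I0.
have bh : b < h by rewrite /h /b; lra.
move=> /(_ _ bh) H; have : g u * g u * weight ((e.+2%:R - 3) / 2) h u = 0.
  apply: H; last by rewrite /b; lra.
    by move=> x; rewrite mulr_ge0 ?weight_ge0// -expr2 sqr_ge0.
  apply: within_continuousM; last exact: weight_continuous.
  apply: continuous_subspaceW cg2 => x; rewrite /= !in_itv /=; lra.
move/eqP; rewrite mulf_eq0 => /orP[|].
  by rewrite -expr2 sqrf_eq0 subr_eq0 => /eqP.
rewrite /weight powR_eq0 => /andP[/eqP + _]; have := @sub1_sqr_gt0 R h u.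
by move=> /(_ _)/lt0r_neq0/eqP h1 h2; case: h1 => //; rewrite /h /b; lra.
Qed.

(** * Polarization and positive definiteness *)

(** For smooth f, the sum of f(x + eps z) against such a measure is eps^N times the N-th derivative
    of f at x, to leading order. *)
Definition difference_measure (R : realType) (N : nat) (c : seq (R * R)) : Prop :=
  (forall k, (k < N)%N -> wsum c (fun z => z ^+ k) = 0) /\ wsum c (fun z => z ^+ N) = N`!%:R.

(** A forward difference of step 1 raises the order by one. *)
Lemma difference_measure_exists (R : realType) (N : nat) : exists c : seq (R * R), difference_measure N c.
Proof.
elim: N => [|N [c [c0 cN]]].
  by exists [:: (1, 0)]; split => //; rewrite /wsum big_seq1 expr0 mulr1.
exists ([seq (p.1, p.2 + 1) | p <- c] ++ [seq (- p.1, p.2) | p <- c]).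
have H k : wsum ([seq (p.1, p.2 + 1) | p <- c] ++ [seq (- p.1, p.2) | p <- c]) (fun z => z ^+ k) =
  \sum_(i < k) 'C(k, i)%:R * wsum c (fun z => z ^+ i).
  rewrite wsum_cat {1 2}/wsum !big_map /=.
  under [X in _ + X]eq_bigr do rewrite mulNr.
  rewrite sumrN -sumrB; under [in RHS]eq_bigr do rewrite -wsumZ.
  rewrite -wsum_sum; apply: eq_bigr => p _; rewrite -mulrBr (addrC p.2) exprDn big_ord_recr /= subnn expr0 mul1r binn.
  by rewrite mulr1n addrK; congr (_ * _); apply: eq_bigr => i _; rewrite expr1n mul1r mulr_natl.
split=> [k kN|]; rewrite H.
  by rewrite big1// => i _; rewrite c0 ?mulr0//; have := ltn_ord i; lia.
rewrite big_ord_recr /= big1 ?add0r; last by move=> i _; rewrite c0 ?mulr0//; have := ltn_ord i; lia.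
by rewrite cN binSn -natrM factS.
Qed.

Lemma difference_measure_shift (R : realType) (N k : nat) (c : seq (R * R)) (x eps : R) :
  difference_measure N c -> (k < N)%N -> wsum c (fun z => (x + eps * z) ^+ k) = 0.
Proof.
move=> [c0 _] kN; transitivity (wsum c (fun z => \sum_(i < k.+1) ('C(k, i)%:R * x ^+ (k - i) * eps ^+ i) * z ^+ i)).
  by apply: eq_wsum => z; rewrite exprDn; apply: eq_bigr => i _; rewrite exprMn -mulr_natl !mulrA.
by rewrite wsum_sum big1// => i _; rewrite wsumZ c0 ?mulr0//; have := ltn_ord i; lia.
Qed.

Lemma prod_rising_fact (R : comPzRingType) (j N : nat) :
  (\prod_(k < N) (j + k).+1%:R) * j`!%:R = (j + N)`!%:R :> R.
Proof.
elim: N => [|N IH]; first by rewrite big_ord0 mul1r addn0.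
by rewrite big_ord_recr /= mulrAC IH addnS factS natrM mulrC.
Qed.

Lemma smoothing_momentE (R : realType) (d N j : nat) : (0 < d)%N ->
  moment R d (uphalf j) * smoothing_moment R d N j = j`!%:R / (j + N)`!%:R.
Proof.
move=> d0; rewrite /smoothing_moment -(prod_rising_fact R j N).
have m0 : moment R d (uphalf j) != 0 by rewrite gt_eqF// moment_gt0.
have j0 : j`!%:R != 0 :> R by rewrite pnatr_eq0 -lt0n fact_gt0.
have p0 : \prod_(k < N) (j + k).+1%:R != 0 :> R.
  by apply/prodf_neq0 => i _; rewrite pnatr_eq0.
move: m0 j0 p0; move: (moment _ _ _) (j`!%:R) (\prod_(k < N) _) => a b e m0 j0 p0.
by field; rewrite m0 j0 p0.
Qed.

Lemma wsumM (R : comPzRingType) (T U : Type) (l : seq (R * T)) (k : seq (R * U)) (f : T -> R) (g : U -> R) :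
  wsum l (fun t => wsum k (fun u => f t * g u)) = wsum l f * wsum k g.
Proof. by rewrite [RHS]mulrC -wsumZ; apply: eq_wsum => t; rewrite wsumZ mulrC. Qed.

(* Only the products x^i y^j with i, j >= N survive two N-th order differences, and on those the kernel of
   order 2 N factors into kernels of order N. *)
Lemma smoothing_polarization (R : realType) (d N m : nat) (c : seq (R * R)) (x eps y del : R) : (0 < d)%N -> ~~ odd N ->
  difference_measure N c ->
  wsum c (fun z => wsum c (fun z' => ((x + eps * z) - (y + del * z')) ^+ (2 * m + 2 * N))) * smoothing_moment R d (2 * N) (2 * m) =
  (moment R d m)^-1 * \sum_(j < (2 * m).+1) 'C(2 * m, j)%:R * (-1) ^+ j *
    (moment R d (uphalf j) * moment R d (uphalf (2 * m - j))) *
    ((wsum c (fun z => (x + eps * z) ^+ (j + N)) * smoothing_moment R d N j) *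
     (wsum c (fun z => (y + del * z) ^+ (2 * m - j + N)) * smoothing_moment R d N (2 * m - j))).
Proof.
move=> d0 oN hc.
pose A i := wsum c (fun z => (x + eps * z) ^+ i); pose B i := wsum c (fun z => (y + del * z) ^+ i).
have A0 i : (i < N)%N -> A i = 0 by exact: difference_measure_shift.
have B0 i : (i < N)%N -> B i = 0 by exact: difference_measure_shift.
pose n := (2 * m + 2 * N)%N.
have -> : wsum c (fun z => wsum c (fun z' => ((x + eps * z) - (y + del * z')) ^+ n)) =
   \sum_(i < n.+1) 'C(n, i)%:R * (-1) ^+ (n - i) * (A i * B (n - i)%N).
  transitivity (wsum c (fun z => wsum c (fun z' => \sum_(i < n.+1) 'C(n, i)%:R * (-1) ^+ (n - i) *
      ((x + eps * z) ^+ i * (y + del * z') ^+ (n - i))))).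
    apply: eq_wsum => z; apply: eq_wsum => z'; rewrite addrC exprDn; apply: eq_bigr => i _.
    by rewrite -mulr_natl (exprNn (y + _)); ring.
  under eq_wsum do rewrite wsum_sum.
  rewrite wsum_sum; apply: eq_bigr => i _; under eq_wsum do rewrite wsumZ.
  by rewrite wsumZ wsumM.
have nE : n.+1 = (N + ((2 * m).+1 + N))%N by rewrite /n; lia.
rewrite -(big_mkord xpredT (fun i => 'C(n, i)%:R * (-1) ^+ (n - i) * (A i * B (n - i)%N))) nE.
rewrite (big_cat_nat (n := N)) ?leq_addr//= [X in X + _]big_nat_cond [X in X + _]big1 ?add0r; last first.
  by move=> i /andP[/andP[_ iN] _]; rewrite A0// mul0r mulr0.
rewrite (big_cat_nat (n := (N + (2 * m).+1)%N)) ?leq_addr//=; last by rewrite addnA leq_addr.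
rewrite [X in (_ + X)]big_nat_cond [X in (_ + X)]big1 ?addr0; last first.
  by move=> i /andP[/andP[iN i2] _]; rewrite B0 ?mulr0// /n; lia.
rewrite -{1}[N]add0n big_addn addKn big_mkord mulr_suml mulr_sumr; apply: eq_bigr => j _.
have jm : (j <= 2 * m)%N by have := ltn_ord j; rewrite ltnS.
have -> : (n - (j + N) = 2 * m - j + N)%N by rewrite /n; lia.
(* Here N must be even: an odd N would reverse the sign of every term. *)
have -> : (-1) ^+ (2 * m - j + N) = (-1) ^+ j :> R.
  by rewrite -signr_odd oddD oddB// (negbTE oN) addbF oddM /= signr_odd.
have h1 := smoothing_momentE R N j d0; have h2 := smoothing_momentE R N (2 * m - j) d0.
have h3 := smoothing_momentE R (2 * N) (2 * m) d0; rewrite mul2n uphalf_double -mul2n in h3.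
have fn k : k`!%:R != 0 :> R by rewrite pnatr_eq0 -lt0n fact_gt0.
have b1 : 'C(2 * m, j)%:R = (2 * m)`!%:R / (j`!%:R * (2 * m - j)`!%:R) :> R.
  by rewrite -(bin_fact jm) !natrM mulfK// mulf_neq0.
have b2 : 'C(n, j + N)%:R = (2 * m + 2 * N)`!%:R / ((j + N)`!%:R * (2 * m - j + N)`!%:R) :> R.
  have jn : (j + N <= n)%N by rewrite /n; lia.
  rewrite -/n -(bin_fact jn) (_ : (n - (j + N) = 2 * m - j + N)%N); last by rewrite /n; lia.
  by rewrite !natrM mulfK// mulf_neq0.
have m0 : moment R d m != 0 by rewrite gt_eqF// moment_gt0.
rewrite -/(A _) -/(B _).
transitivity ((moment R d m)^-1 * ('C(2 * m, j)%:R * ((j`!%:R / (j + N)`!%:R) * ((2 * m - j)`!%:R / (2 * m - j + N)`!%:R))) *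
   ((-1) ^+ j * (A (j + N)%N * B (2 * m - j + N)%N))); last by rewrite -h1 -h2; ring.
have -> : smoothing_moment R d (2 * N) (2 * m) = (moment R d m)^-1 * ((2 * m)`!%:R / (2 * m + 2 * N)`!%:R).
  by rewrite -h3 mulKf.
rewrite b1 b2.
have := fn (2 * m - j)%N; have := fn (2 * m - j + N)%N; have := fn (j + N)%N; have := fn j; have := fn (2 * m + 2 * N)%N.
move: (A _) (B _) ((moment R d m)^-1) ((-1) ^+ j) => a b e s.
move: ((2 * m)`!%:R) ((2 * m - j)`!%:R) ((2 * m - j + N)`!%:R) ((j + N)`!%:R) (j`!%:R) ((2 * m + 2 * N)`!%:R).
by move=> q1 q2 q3 q4 q5 q6 n1 n2 n3 n4 n5; field; rewrite n1 n2 n3 n4 n5.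
Qed.

Lemma cvgn_norm_bound (R : realType) (u : nat -> R) (l C : R) :
  (forall n, `|u n| <= C) -> u n @[n --> \oo] --> l -> `|l| <= C.
Proof.
move=> H ul; rewrite -[l]subr0 distrC; apply: (cvgn_norm_le _ ul) => n.
by rewrite sub0r normrN.
Qed.

(* Maps a measure l of dilations to the measure of radii occurring in the N-th order difference of step eps at x. *)
Definition smear (R : pzRingType) (l c : seq (R * R)) (N : nat) (x eps : R) : seq (R * R) :=
  [seq (p.1 * (x + eps * p.2) ^+ N * q.1, (x + eps * p.2) * q.2) | p <- c, q <- l].

Lemma wsum_smear (R : comPzRingType) (l c : seq (R * R)) (N : nat) (x eps : R) (f : R -> R) :
  wsum (smear l c N x eps) f = wsum c (fun z => (x + eps * z) ^+ N * wsum l (fun a => f ((x + eps * z) * a))).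
Proof.
rewrite /wsum /smear big_allpairs_dep /=; apply: eq_bigr => p _.
by rewrite mulrA mulr_sumr; apply: eq_bigr => q _; rewrite mulrA.
Qed.

Lemma smear_exprn (R : comPzRingType) (l c : seq (R * R)) (N j : nat) (x eps : R) :
  wsum (smear l c N x eps) (fun r => r ^+ j) =
  wsum c (fun z => (x + eps * z) ^+ (j + N)) * wsum l (fun a => a ^+ j).
Proof.
rewrite wsum_smear [RHS]mulrC -wsumZ; apply: eq_wsum => z.
by rewrite exprD; under eq_wsum do rewrite exprMn; rewrite wsumZ; ring.
Qed.

Lemma smear_variation (R : realDomainType) (l c : seq (R * R)) (N : nat) (x eps A C : R) :
  (forall p, p \in c -> `|x + eps * p.2| <= A) -> \sum_(q <- l) `|q.1| <= C ->
  \sum_(p <- smear l c N x eps) `|p.1| <= (\sum_(p <- c) `|p.1|) * C * A ^+ N.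
Proof.
move=> cA lC; have C0 : 0 <= C by apply: le_trans lC; apply: sumr_ge0.
rewrite /smear big_allpairs_dep /= !mulr_suml big_seq [X in _ <= X]big_seq; apply: ler_sum => p pc.
under eq_bigr do rewrite !normrM.
rewrite -mulr_sumr -!mulrA ler_wpM2l// (mulrC C) ler_pM ?sumr_ge0//.
by rewrite normrX lerXn2r ?nnegrE ?cA// (le_trans _ (cA _ pc)).
Qed.

Lemma smear_radius (R : realDomainType) (l c : seq (R * R)) (N : nat) (x eps A : R) :
  (forall p, p \in c -> `|x + eps * p.2| <= A) -> (forall q, q \in l -> `|q.2| <= 1) ->
  forall p, p \in smear l c N x eps -> `|p.2| <= A.
Proof.
move=> cA l1 _ /allpairsPdep[p [q [pc ql ->]]] /=; rewrite normrM.
by apply: le_trans (cA _ pc); rewrite ler_piMr// l1.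
Qed.

Lemma cvgn_wsum (R : realType) (T : eqType) (l : seq (R * T)) (u : T -> nat -> R) (v : T -> R) :
  (forall p, p \in l -> u p.2 n @[n --> \oo] --> v p.2) ->
  wsum l (u^~ n) @[n --> \oo] --> wsum l v.
Proof.
move=> H; rewrite /wsum big_seq; apply: (cvgn_ext (u := fun n => \sum_(p <- l | p \in l) p.1 * u p.2 n)).
  by move=> n; rewrite -big_seq.
by apply: cvgn_sum => p pl; apply: cvgnZ; exact: H.
Qed.

Lemma cvgnM (R : realType) (u v : nat -> R) (l k : R) :
  u n @[n --> \oo] --> l -> v n @[n --> \oo] --> k -> u n * v n @[n --> \oo] --> l * k.
Proof. by move=> H H'; apply: cvgM. Qed.

Definition zonal_poly (R : fieldType) (d : nat) (P : {poly R}) (r t : R) : R :=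
  \sum_(m < size P) P`_m * zonal_kernel d m r t.

Definition zonal_average (R : pzRingType) (d : nat) (s : seq (R * 'rV[R]_d)) (g : 'rV[R]_d -> R) (r t : R) : R :=
  wsum s (fun xi => wsum s (fun eta => (1 + dotp xi eta) * g (r *: xi - t *: eta))).

Lemma zonal_poly_cvg (R : realType) (d : nat) (P : {poly R}) (r t : R) (s : nat -> seq (R * 'rV[R]_d)) : (0 < d)%N ->
  zonal_sequence s -> `|r| + `|t| <= 1 ->
  zonal_average (s n) (fun v => P.[euclidean_norm v ^+ 2]) r t @[n --> \oo] --> zonal_poly d P r t.
Proof.
move=> d0 hs rt; apply: (cvgn_ext (u := fun n => \sum_(m < size P) P`_m * wsum (s n) (fun xi => wsum (s n) (fun eta =>
    (1 + dotp xi eta) * dotp (r *: xi - t *: eta) (r *: xi - t *: eta) ^+ m)))).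
  move=> n; rewrite /zonal_average.
  under [in RHS]eq_wsum => xi do under eq_wsum => eta do rewrite euclidean_norm_sqr horner_coef mulr_sumr.
  under [in RHS]eq_wsum => xi do rewrite wsum_sum.
  rewrite wsum_sum; apply: eq_bigr => m _; rewrite -wsumZ; apply: eq_wsum => xi; rewrite -wsumZ.
  by apply: eq_wsum => eta; rewrite mulrCA.
by apply: cvgn_sum => m _; apply: cvgnZ; apply: zonal_kernel_cvg.
Qed.

Lemma euclidean_normB_le (R : realType) (d : nat) (r t : R) (xi eta : 'rV[R]_d) : dotp xi xi = 1 -> dotp eta eta = 1 ->
  0 <= euclidean_norm (r *: xi - t *: eta) <= `|r| + `|t|.
Proof.
move=> x1 e1; rewrite euclidean_norm_ge0 -(ler_pXn2r (n := 2)) ?nnegrE ?euclidean_norm_ge0 ?addr_ge0//.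
have /andP[h1 h2] := dotp_le1 x1 e1.
rewrite euclidean_norm_sqr dotpB_sqr// sqrrD !real_normK ?num_real//.
have := ler_norm (- (r * t * dotp xi eta)); rewrite normrN !normrM.
have : `|r| * `|t| * `|dotp xi eta| <= `|r| * `|t| by rewrite ler_piMr ?mulr_ge0// ler_norml h1.
lra.
Qed.

Lemma zonal_average_bound (R : realType) (d n : nat) (e : R) (s : seq (R * 'rV[R]_d)) (g : R -> R) (r t h M : R) :
  sphere_quadrature n e s -> `|r| + `|t| <= h -> (forall v, 0 <= v <= h -> `|g v| <= M) ->
  `|zonal_average s (fun v => g (euclidean_norm v)) r t| <= 2 * M.
Proof.
move=> [s0 s1 _] rt gM; apply: wsum_prob_bound => // p /s0[p0 p1]; split => //.
apply: wsum_prob_bound => // q /s0[q0 q1]; split => //.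
have /andP[h1 h2] := dotp_le1 p1 q1.
rewrite normrM; apply: ler_pM => //; first by rewrite ger0_norm; lra.
by apply: gM; have /andP[-> /=] := euclidean_normB_le r t p1 q1; move/le_trans; apply.
Qed.

(** Not visible on the coefficients; it is inherited from the averages, which are taken against
    probabilities and whose factor 1 + <xi, eta> lies in [0, 2]. *)
Lemma zonal_poly_bound (R : realType) (d : nat) (P : {poly R}) (r t h M : R) : (0 < d)%N ->
  h <= 1 -> `|r| + `|t| <= h -> (forall v, 0 <= v <= h -> `|P.[v ^+ 2]| <= M) ->
  `|zonal_poly d P r t| <= 2 * M.
Proof.
move=> d0 h1 rt HP; have [s hs] := @sphere_quadrature_sequence R d d0.
have H := @zonal_poly_cvg R d P r t s d0 hs (le_trans rt h1).
apply: (cvgn_norm_bound _ H) => n.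
by apply: (zonal_average_bound (g := fun v => P.[v ^+ 2]) (hs n) rt HP).
Qed.

Definition smoothing_sequence (R : realType) (d N : nat) (l : nat -> seq (R * R)) (C : R) : Prop :=
  [/\ forall n, \sum_(p <- l n) `|p.1| <= C, forall n p, p \in l n -> `|p.2| <= 1 &
      forall j, wsum (l n) (fun s => s ^+ j) @[n --> \oo] --> smoothing_moment R d N j].

Definition smoothed_poly (R : realType) (d N : nat) (P : {poly R}) (x : R) : R :=
  x ^+ (2 * N) * even_apply (fun m => smoothing_moment R d (2 * N) (2 * m)) P x.

(** The minus sign comes from differencing E(x - y) in x with step eps and in y with step del. *)
Definition double_difference (R : pzRingType) (c : seq (R * R)) (E : R -> R) (x eps del : R) : R :=
  wsum c (fun z => wsum c (fun z' => E (x + eps * z - del * z'))).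

(** A smeared measure integrates r^j to the difference of x^(j + N) times a moment of [l n]. In the
    limit the zonal kernels thus become the right-hand side of [smoothing_polarization]. *)
Lemma smear_zonal_poly_cvg (R : realType) (d N : nat) (c : seq (R * R)) (l : nat -> seq (R * R)) (C : R) (P : {poly R})
    (x y eps del : R) : (0 < d)%N -> ~~ odd N -> difference_measure N c -> smoothing_sequence d N l C ->
  wsum (smear (l n) c N x eps) (fun r => wsum (smear (l n) c N y del) (zonal_poly d P r)) @[n --> \oo] -->
  double_difference c (smoothed_poly d N P) (x - y) eps del.
Proof.
move=> d0 oN hc [_ _ hl].
have -> : double_difference c (smoothed_poly d N P) (x - y) eps del = \sum_(m < size P) P`_m *
   ((moment R d m)^-1 * \sum_(j < (2 * m).+1) 'C(2 * m, j)%:R * (-1) ^+ j *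
    (moment R d (uphalf j) * moment R d (uphalf (2 * m - j))) *
    ((wsum c (fun z => (x + eps * z) ^+ (j + N)) * smoothing_moment R d N j) *
     (wsum c (fun z => (y + del * z) ^+ (2 * m - j + N)) * smoothing_moment R d N (2 * m - j)))).
  under [in RHS]eq_bigr do rewrite -smoothing_polarization//.
  transitivity (wsum c (fun z => wsum c (fun z' => \sum_(m < size P) (P`_m * smoothing_moment R d (2 * N) (2 * m)) *
      (x + eps * z - (y + del * z')) ^+ (2 * m + 2 * N)))).
    apply: eq_wsum => z; apply: eq_wsum => z'.
    have -> : x - y + eps * z - del * z' = x + eps * z - (y + del * z') by ring.
    rewrite /smoothed_poly /even_apply mulr_sumr; apply: eq_bigr => m _.
    by rewrite exprD; ring.
  under eq_wsum do rewrite wsum_sum.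
  rewrite wsum_sum; apply: eq_bigr => m _; under eq_wsum do rewrite wsumZ.
  by rewrite wsumZ -mulrA; congr (_ * _); rewrite mulrC.
apply: (cvgn_ext (u := fun n => \sum_(m < size P) P`_m *
   ((moment R d m)^-1 * \sum_(j < (2 * m).+1) 'C(2 * m, j)%:R * (-1) ^+ j *
    (moment R d (uphalf j) * moment R d (uphalf (2 * m - j))) *
    (wsum (smear (l n) c N x eps) (fun r => r ^+ j) * wsum (smear (l n) c N y del) (fun r => r ^+ (2 * m - j)))))).
  move=> n; rewrite /zonal_poly.
  under [in RHS]eq_wsum => r do rewrite wsum_sum.
  rewrite wsum_sum; apply: eq_bigr => m _; under [in RHS]eq_wsum => r do rewrite wsumZ.
  rewrite wsumZ /zonal_kernel; congr (_ * _); under [in RHS]eq_wsum => r do rewrite wsumZ wsum_sum.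
  rewrite wsumZ wsum_sum; congr (_ * _); apply: eq_bigr => j _.
  by under [in RHS]eq_wsum => r do rewrite wsumZ; rewrite wsumZ wsumM.
apply: cvgn_sum => m _; apply: cvgnZ; apply: cvgnZ; apply: cvgn_sum => j _; apply: cvgnZ.
apply: cvgnM.
  by under eq_fun do rewrite smear_exprn; apply: cvgnZ; exact: hl.
by under eq_fun do rewrite smear_exprn; apply: cvgnZ; exact: hl.
Qed.

(** The factors A^N and B^N are the point: at the origin A and B are proportional to eps and del,
    and the division by (eps del)^N cancels. *)
Lemma double_difference_poly_bound (R : realType) (d N : nat) (c : seq (R * R)) (l : nat -> seq (R * R)) (C : R)
    (P : {poly R}) (x y eps del A B h M : R) :
  (0 < d)%N -> ~~ odd N -> difference_measure N c -> smoothing_sequence d N l C ->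
  (forall p, p \in c -> `|x + eps * p.2| <= A) -> (forall p, p \in c -> `|y + del * p.2| <= B) ->
  A + B <= h -> h <= 1 -> (forall v, 0 <= v <= h -> `|P.[v ^+ 2]| <= M) -> 0 <= M ->
  `|double_difference c (smoothed_poly d N P) (x - y) eps del| <=
    (\sum_(p <- c) `|p.1|) * C * A ^+ N * ((\sum_(p <- c) `|p.1|) * C * B ^+ N * (2 * M)).
Proof.
move=> d0 oN hc hl cA cB ABh h1 HP M0; have [l1 l2 _] := hl.
have H := @smear_zonal_poly_cvg R d N c l C P x y eps del d0 oN hc hl.
apply: (cvgn_norm_bound _ H) => n.
pose D := (\sum_(p <- c) `|p.1|) * C; rewrite -/D.
have B0 : 0 <= D * B ^+ N.
  by apply: le_trans (smear_variation (l := l n) N cB (l1 n)); apply: sumr_ge0.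
apply: wsum_bound; first by rewrite mulr_ge0// mulr_ge0.
  exact: smear_variation.
move=> p /(smear_radius cA (l2 n)) pA; apply: wsum_bound; first by rewrite mulr_ge0.
  exact: smear_variation.
move=> q /(smear_radius cB (l2 n)) qB; apply: (@zonal_poly_bound _ _ _ _ _ h) => //.
lra.
Qed.

Lemma positive_definite_wsum (R : realType) (T : eqType) (X : set T) (K : T -> T -> R) (l : seq (R * T)) :
  positive_definite_on X K -> (forall p, p \in l -> X p.2) ->
  0 <= wsum l (fun p => wsum l (K p)).
Proof.
move=> HK lX; have := HK (size l) (fun i => (tnth (in_tuple l) i).1) (fun i => (tnth (in_tuple l) i).2) _.
have Ht i : X (tnth (in_tuple l) i).2 by apply: lX; have := mem_tnth i (in_tuple l).
move=> /(_ Ht)/le_trans; apply.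
rewrite /wsum [X in _ <= X](big_tnth _ _ l); apply: ler_sum => i _.
rewrite [X in _ <= _ * X](big_tnth _ _ l) mulr_sumr; apply: ler_sum => j _.
by rewrite mulrA.
Qed.

(** Since 1 + <xi, eta> is 1 plus the sum of the products xi_i eta_i, the form is a sum of d + 1
    quadratic forms of phi at the points r xi, with weights multiplied by 1 or by xi_i. These points
    lie in the half ball because |r| < 1/2. *)
Lemma zonal_form_ge0 (R : realType) (d d' K : nat) (phi : R * R -> R) (b : 'I_K -> R) (y : 'I_K -> 'rV[R]_d')
    (kap : 'I_K -> seq (R * R)) (s : seq (R * 'rV[R]_d)) :
  positive_definite_on (half_ball R d `*` [set: 'rV[R]_d'])
    (fun p q => phi (euclidean_norm (p.1 - q.1), euclidean_norm (p.2 - q.2))) ->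
  (forall k p, p \in kap k -> `|p.2| < 2^-1) -> (forall q, q \in s -> dotp q.2 q.2 = 1) ->
  0 <= \sum_(k < K) \sum_(j < K) b k * b j * wsum (kap k) (fun r => wsum (kap j) (fun t =>
    zonal_average s (fun v => phi (euclidean_norm v, euclidean_norm (y k - y j))) r t)).
Proof.
move=> pphi kap1 s1.
pose Kf (p q : 'rV[R]_d * 'rV[R]_d') := phi (euclidean_norm (p.1 - q.1), euclidean_norm (p.2 - q.2)).
pose L (f : 'rV[R]_d -> R) := flatten [seq [seq (b k * p.1 * (q.1 * f q.2), (p.2 *: q.2, y k)) | p <- kap k, q <- s] | k <- enum 'I_K].
have LE f F : wsum (L f) F = \sum_(k < K) b k * wsum (kap k) (fun r => wsum s (fun xi => f xi * F (r *: xi, y k))).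
  rewrite /wsum /L big_flatten big_map big_enum; apply: eq_bigr => k _.
  rewrite big_allpairs_dep /= mulr_sumr; apply: eq_bigr => p _.
  by rewrite !mulr_sumr; apply: eq_bigr => q _; rewrite !mulrA.
have Lge0 f : 0 <= wsum (L f) (fun p => wsum (L f) (Kf p)).
  apply: positive_definite_wsum pphi _ => p /flattenP[_ /mapP[k _ ->] /allpairsPdep[r [q [rk qs ->]]]] /=.
  split => //=; rewrite /half_ball /= /euclidean_norm.
  have -> : \sum_(i < d) (r.2 *: q.2) ord0 i ^+ 2 = r.2 ^+ 2.
    transitivity (dotp (r.2 *: q.2) (r.2 *: q.2)); first by apply: eq_bigr => i _; rewrite expr2.
    by rewrite dotpZl dotpZr s1// mulr1 expr2.
  by rewrite sqrtr_sqr (kap1 k).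
have LLE f : wsum (L f) (fun p => wsum (L f) (Kf p)) = \sum_(k < K) \sum_(j < K) b k * b j *
   wsum (kap k) (fun r => wsum (kap j) (fun t => wsum s (fun xi => wsum s (fun eta =>
     f xi * f eta * phi (euclidean_norm (r *: xi - t *: eta), euclidean_norm (y k - y j)))))).
  rewrite LE; apply: eq_bigr => k _.
  under [in RHS]eq_bigr do rewrite -mulrA.
  rewrite -mulr_sumr; congr (_ * _).
  under [in RHS]eq_bigr do rewrite -wsumZ.
  rewrite -wsum_sum; apply: eq_wsum => r.
  under eq_wsum do rewrite LE mulr_sumr.
  rewrite wsum_sum; apply: eq_bigr => j _.
  rewrite wsum_exchange -wsumZ; apply: eq_wsum => xi.
  rewrite mulrCA; congr (_ * _); rewrite -wsumZ; apply: eq_wsum => t; rewrite -wsumZ.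
  by apply: eq_wsum => eta; rewrite mulrA.
have -> : \sum_(k < K) \sum_(j < K) b k * b j * wsum (kap k) (fun r => wsum (kap j) (fun t =>
    zonal_average s (fun v => phi (euclidean_norm v, euclidean_norm (y k - y j))) r t)) =
  wsum (L (fun=> 1)) (fun p => wsum (L (fun=> 1)) (Kf p)) +
  \sum_(i < d) wsum (L (fun xi => xi ord0 i)) (fun p => wsum (L (fun xi => xi ord0 i)) (Kf p)).
  rewrite LLE; under [X in _ = _ + X]eq_bigr do rewrite LLE.
  rewrite [X in _ = _ + X]exchange_big /= -big_split; apply: eq_bigr => k _ /=.
  rewrite [X in _ = _ + X]exchange_big /= -big_split; apply: eq_bigr => j _ /=.
  rewrite -mulr_sumr -mulrDr; congr (_ * _).
  rewrite -wsum_sum -wsumD; apply: eq_wsum => r.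
  rewrite -wsum_sum -wsumD; apply: eq_wsum => t.
  rewrite -wsum_sum -wsumD; apply: eq_wsum => xi.
  rewrite -wsum_sum -wsumD; apply: eq_wsum => eta.
  by rewrite -mulr_suml -mulrDl mulr1.
by rewrite addr_ge0// sumr_ge0.
Qed.

(* The averaged forms are nonnegative for phi itself; replacing phi by polynomials costs a multiple of eta, and the
   polynomial forms converge to the double differences. *)
Lemma double_difference_psd (R : realType) (d d' K N : nat) (phi : R * R -> R) (c : seq (R * R)) (l : nat -> seq (R * R))
    (C h : R) (b x eps : 'I_K -> R) (y : 'I_K -> 'rV[R]_d') :
  (0 < d)%N -> ~~ odd N -> difference_measure N c -> smoothing_sequence d N l C ->
  positive_definite_on (half_ball R d `*` [set: 'rV[R]_d'])
    (fun p q => phi (euclidean_norm (p.1 - q.1), euclidean_norm (p.2 - q.2))) ->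
  h < 1 -> (forall k p, p \in c -> `|x k + eps k * p.2| <= h / 2) ->
  exists M : R, forall (P : 'I_K -> 'I_K -> {poly R}) (eta : R), 0 <= eta ->
    (forall k j v, 0 <= v <= h -> `|phi (v, euclidean_norm (y k - y j)) - (P k j).[v ^+ 2]| <= eta) ->
    - (M * eta) <= \sum_(k < K) \sum_(j < K) b k * b j *
      double_difference c (smoothed_poly d N (P k j)) (x k - x j) (eps k) (eps j).
Proof.
move=> d0 oN hc hl pphi h1 cA; have [l1 l2 _] := hl.
have [s hs] := @sphere_quadrature_sequence R d d0.
pose D := (\sum_(p <- c) `|p.1|) * C * (h / 2) ^+ N.
pose kap n k := smear (l n) c N (x k) (eps k).
have kapD n k : \sum_(p <- kap n k) `|p.1| <= D by exact: (@smear_variation _ _ _ N _ _ _ _ (cA k) (l1 n)).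
have kap1 n k p : p \in kap n k -> `|p.2| <= h / 2 by exact: (smear_radius (cA k) (l2 n)).
(* [D] bounds the variation of each smeared measure, and 2 bounds 1 + <xi, eta>. *)
exists (\sum_(k < K) \sum_(j < K) `|b k * b j| * (D * (D * 2))) => P eta eta0 HP.
have H2 n n' : - (\sum_(k < K) \sum_(j < K) `|b k * b j| * (D * (D * 2)) * eta) <=
   \sum_(k < K) \sum_(j < K) b k * b j * wsum (kap n k) (fun r => wsum (kap n j) (fun t =>
    zonal_average (s n') (fun v => (P k j).[euclidean_norm v ^+ 2]) r t)).
  have [s0 s1 _] := hs n'.
  have := @zonal_form_ge0 R d d' K phi b y (kap n) (s n') pphi _ (fun q qs => proj2 (s0 q qs)).
  move=> /(_ _)/le_trans H; rewrite -subr_ge0 opprK; apply: H.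
    by move=> k p /kap1/le_lt_trans; apply; lra.
  rewrite -big_split; apply: ler_sum => k _; rewrite -big_split; apply: ler_sum => j _ /=.
  rewrite -lerBlDl -mulrBr.
  have -> : wsum (kap n k) (fun r => wsum (kap n j) (fun t =>
      zonal_average (s n') (fun v => phi (euclidean_norm v, euclidean_norm (y k - y j))) r t)) -
    wsum (kap n k) (fun r => wsum (kap n j) (fun t =>
      zonal_average (s n') (fun v => (P k j).[euclidean_norm v ^+ 2]) r t)) =
    wsum (kap n k) (fun r => wsum (kap n j) (fun t => zonal_average (s n')
      (fun v => phi (euclidean_norm v, euclidean_norm (y k - y j)) - (P k j).[euclidean_norm v ^+ 2]) r t)).
    rewrite -mulN1r -wsumZ -wsumD; apply: eq_wsum => r.
    rewrite -wsumZ -wsumD; apply: eq_wsum => t.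
    rewrite /zonal_average -wsumZ -wsumD; apply: eq_wsum => xi; rewrite -wsumZ -wsumD; apply: eq_wsum => e.
    by rewrite mulN1r mulrBr.
  apply: (le_trans (ler_norm _)); rewrite normrM -[X in _ <= X]mulrA; apply: ler_wpM2l => //.
  have D0 : 0 <= D by apply: le_trans (kapD n j); apply: sumr_ge0.
  have -> : D * (D * 2) * eta = D * (D * (2 * eta)) by ring.
  apply: wsum_bound => //; first by rewrite mulr_ge0// mulr_ge0.
  move=> p /kap1 pr; apply: wsum_bound => //; first by rewrite mulr_ge0.
  move=> q /kap1 qr.
  apply: (zonal_average_bound (g := fun v => phi (v, euclidean_norm (y k - y j)) - (P k j).[v ^+ 2]) (h := h) (hs n')).
    lra.
  exact: HP.
rewrite mulr_suml; under eq_bigr do rewrite mulr_suml.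
(* The quadrature is refined with the smeared measures fixed; the limit in the latter comes
   afterwards. *)
have H1 n : - (\sum_(k < K) \sum_(j < K) `|b k * b j| * (D * (D * 2)) * eta) <=
   \sum_(k < K) \sum_(j < K) b k * b j * wsum (kap n k) (fun r => wsum (kap n j) (zonal_poly d (P k j) r)).
  apply: (cvgn_ge (H2 n)); apply: cvgn_sum => k _; apply: cvgn_sum => j _; apply: cvgnZ.
  apply: cvgn_wsum => p /kap1 pr; apply: cvgn_wsum => q /kap1 qr.
  by apply: zonal_poly_cvg => //; lra.
apply: (cvgn_ge H1); apply: cvgn_sum => k _; apply: cvgn_sum => j _; apply: cvgnZ.
exact: (@smear_zonal_poly_cvg R d N c l C (P k j) (x k) (x j) (eps k) (eps j) d0 oN hc hl).
Qed.

(** * The functions f_{eps,del} *)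

Lemma cvgn_dist_le (R : realType) (u v : nat -> R) (a b C : R) :
  u n @[n --> \oo] --> a -> v n @[n --> \oo] --> b -> (forall n, `|u n - v n| <= C) -> `|a - b| <= C.
Proof. by move=> ua vb H; apply: (cvgn_norm_bound H); exact: cvgnB. Qed.

Lemma ge0_of_small (R : realFieldType) (S M : R) : (forall eta, 0 < eta -> - (M * eta) <= S) -> 0 <= S.
Proof.
move=> H; rewrite leNgt; apply/negP => S0.
have D0 : 0 < `|M| + 1 by rewrite ltr_wpDl.
have := H (- S / 2 / (`|M| + 1)); rewrite divr_gt0; [|lra|by []] => /(_ isT).
have : M * (- S / 2 / (`|M| + 1)) <= - S / 2.
  rewrite mulrCA ler_piMr//; first by lra.
  by rewrite ler_pdivrMr// mul1r; have := ler_norm M; lra.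
lra.
Qed.

(** The function E(., t) of the overview; [smoothed_poly] is its analogue for P(v^2). *)
Definition smoothed (R : realType) (lam : nat -> seq (R * R)) (N : nat) (phi : R * R -> R) (x t : R) : R :=
  x ^+ (2 * N) * lim (wsum (lam n) (fun s => phi (`|x * s|, t)) @[n --> \oo]).

Lemma smoothedN (R : realType) (lam : nat -> seq (R * R)) (N : nat) (phi : R * R -> R) (x t : R) :
  smoothed lam N phi (- x) t = smoothed lam N phi x t.
Proof.
rewrite /smoothed exprM sqrrN -exprM; under eq_fun do under eq_wsum do rewrite mulNr normrN.
by [].
Qed.

(** Polynomial approximation makes the sequence in [smoothed] Cauchy, so that its [lim] is a genuine
    limit and not a default value. The error then passes through measures of variation at most C. *)
Lemma smoothed_approx (R : realType) (d N : nat) (lam : nat -> seq (R * R)) (C : R) (phi : R * R -> R) (x t eta : R)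
    (P : {poly R}) : smoothing_sequence d (2 * N) lam C -> {within strip R, continuous phi} ->
  `|x| < 1 -> 0 <= t -> (forall v, 0 <= v <= `|x| -> `|phi (v, t) - P.[v ^+ 2]| <= eta) ->
  `|smoothed lam N phi x t - smoothed_poly d N P x| <= C * eta * x ^+ (2 * N).
Proof.
move=> [l1 l2 l3] cphi x1 t0 HP.
have C0 : 0 <= C by apply: le_trans (l1 0%N); apply: sumr_ge0.
pose u n := wsum (lam n) (fun s => phi (`|x * s|, t)).
pose v (Q : {poly R}) n := wsum (lam n) (fun s => Q.[(x * s) ^+ 2]).
pose L Q := even_apply (fun m => smoothing_moment R d (2 * N) (2 * m)) Q x.
have vL Q : v Q n @[n --> \oo] --> L Q.
  apply: (cvgn_ext (u := fun n => \sum_(m < size Q) (Q`_m * x ^+ (2 * m)) * wsum (lam n) (fun s => s ^+ (2 * m)))).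
    move=> n; under eq_bigr do rewrite -wsumZ; rewrite -wsum_sum; apply: eq_wsum => s.
    by rewrite horner_coef; apply: eq_bigr => m _; rewrite -exprM exprMn mulrA.
  have -> : L Q = \sum_(m < size Q) (Q`_m * x ^+ (2 * m)) * smoothing_moment R d (2 * N) (2 * m).
    by apply: eq_bigr => m _; rewrite mulrAC.
  by apply: cvgn_sum => m _; apply: cvgnZ.
have uv Q e n : 0 <= e -> (forall v, 0 <= v <= `|x| -> `|phi (v, t) - Q.[v ^+ 2]| <= e) -> `|u n - v Q n| <= C * e.
  move=> e0 HQ; rewrite -mulN1r -wsumZ -wsumD; apply: wsum_bound => // p pl.
  rewrite mulN1r -[(x * p.2) ^+ 2]real_normK ?num_real//; apply: HQ.
  by rewrite normr_ge0 normrM ler_piMr// (l2 n).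
have ul : u n @[n --> \oo] --> lim (u n @[n --> \oo]).
  have [|l ul] := @cvgn_cauchy_approx R u; last by apply/cvg_ex; exists l.
  move=> e e0; have e1 : 0 < e / (C + 1) by rewrite divr_gt0// ltr_wpDl.
  have [Q HQ] := even_approximation (normr_ge0 x) (strip_slice_continuous cphi x1 t0) e1.
  exists (v Q), (L Q); split => // n; apply: (le_trans (uv Q _ n (ltW e1) HQ)).
  by rewrite mulrCA ler_piMr ?(ltW e0)// ler_pdivrMr ?ltr_wpDl// mul1r; lra.
have eta0 : 0 <= eta by apply: le_trans (HP 0 _); rewrite ?normr_ge0// lexx.
rewrite /smoothed /smoothed_poly -mulrBr normrM mulrC.
have x20 : 0 <= x ^+ (2 * N) by rewrite exprM exprn_ge0// sqr_ge0.
rewrite (ger0_norm x20); apply: ler_wpM2r => //.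
apply: (cvgn_dist_le ul (vL P)) => n; exact: uv.
Qed.

(** The function f_{eps,del}(x, t) of the overview. *)
Definition restored (R : realType) (lam : nat -> seq (R * R)) (c : seq (R * R)) (N : nat) (phi : R * R -> R)
    (eps del x t : R) : R :=
  ((eps * del) ^+ N)^-1 * double_difference c (smoothed lam N phi ^~ t) x eps del.

Lemma double_differenceB (R : comPzRingType) (c : seq (R * R)) (E F : R -> R) (x eps del : R) :
  double_difference c E x eps del - double_difference c F x eps del =
  double_difference c (fun u => E u - F u) x eps del.
Proof.
rewrite /double_difference -mulN1r -wsumZ -wsumD; apply: eq_wsum => z.
by rewrite -wsumZ -wsumD; apply: eq_wsum => z'; rewrite mulN1r.
Qed.

Lemma restored_approx (R : realType) (d N : nat) (lam : nat -> seq (R * R)) (c : seq (R * R)) (C : R) (phi : R * R -> R)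
    (eps del x t h eta : R) (P : {poly R}) :
  smoothing_sequence d (2 * N) lam C -> {within strip R, continuous phi} ->
  0 < eps -> 0 < del -> (forall p q, p \in c -> q \in c -> `|x + eps * p.2 - del * q.2| <= h) -> h < 1 -> 0 <= t ->
  0 <= eta -> (forall v, 0 <= v <= h -> `|phi (v, t) - P.[v ^+ 2]| <= eta) ->
  `|restored lam c N phi eps del x t - ((eps * del) ^+ N)^-1 * double_difference c (smoothed_poly d N P) x eps del| <=
  ((eps * del) ^+ N)^-1 * ((\sum_(p <- c) `|p.1|) * ((\sum_(p <- c) `|p.1|) * C)) * eta.
Proof.
move=> hlam cphi e0 d0 ch h1 t0 eta0 HP.
have C0 : 0 <= C by case: hlam => l1 _ _; apply: le_trans (l1 0%N); apply: sumr_ge0.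
have k0 : 0 <= ((eps * del) ^+ N)^-1 by rewrite invr_ge0 exprn_ge0// mulr_ge0// ltW.
rewrite /restored -mulrBr normrM (ger0_norm k0) -!mulrA ler_wpM2l// double_differenceB.
have S0 : 0 <= \sum_(p <- c) `|p.1| by exact: sumr_ge0.
apply: wsum_bound => //; first by rewrite !mulr_ge0.
move=> p pc; apply: wsum_bound => //; first by rewrite !mulr_ge0.
move=> q qc; have xh := ch p q pc qc; have x1 := le_lt_trans xh h1.
apply: (le_trans (smoothed_approx (eta := eta) hlam cphi x1 t0 _)).
  by move=> v /andP[v0 vx]; apply: HP; rewrite v0 (le_trans vx).
rewrite ler_piMr ?mulr_ge0// exprM exprn_ile1//; first by rewrite sqr_ge0.
by rewrite -real_normK ?num_real// exprn_ile1// ltW.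
Qed.

(** Dividing the k-th coefficient by the N-th power of its step turns double differences into values
    of [restored]. The polynomial error disappears because its constant does not depend on eta. *)
Lemma restored_psd (R : realType) (d d' K N : nat) (lam l : nat -> seq (R * R)) (c : seq (R * R)) (C C' h : R)
    (phi : R * R -> R) (b x eps : 'I_K -> R) (y : 'I_K -> 'rV[R]_d') :
  (0 < d)%N -> ~~ odd N -> difference_measure N c -> smoothing_sequence d N l C ->
  smoothing_sequence d (2 * N) lam C' -> class_P R d d' phi ->
  (forall k, 0 < eps k) -> 0 <= h < 1 -> (forall k p, p \in c -> `|x k + eps k * p.2| <= h / 2) ->
  0 <= \sum_(k < K) \sum_(j < K) b k * b j *
    restored lam c N phi (eps k) (eps j) (x k - x j) (euclidean_norm (y k - y j)).
Proof.
move=> d0 oN hc hl hlam [_ cphi _ pphi] e0 /andP[h0 h1] cA.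
have [M HM] := @double_difference_psd R d d' K N phi c l C h (fun k => b k / eps k ^+ N) x eps y d0 oN hc hl pphi h1 cA.
pose D := (\sum_(p <- c) `|p.1|) * ((\sum_(p <- c) `|p.1|) * C').
pose M' := \sum_(k < K) \sum_(j < K) `|b k * b j| * (((eps k * eps j) ^+ N)^-1 * D).
apply: (@ge0_of_small _ _ (M + M')) => eta eta0.
have H (kj : 'I_K * 'I_K) : exists P : {poly R}, forall v, 0 <= v <= h ->
    `|phi (v, euclidean_norm (y kj.1 - y kj.2)) - P.[v ^+ 2]| <= eta.
  apply: (even_approximation (g := fun v => phi (v, _))) => //.
  by apply: strip_slice_continuous => //; exact: euclidean_norm_ge0.
have [P HP] := boolp.choice H.
have := HM (fun k j => P (k, j)) eta (ltW eta0) (fun k j => HP (k, j)).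
rewrite mulrDl opprD -lerBrDr opprK => /le_trans; apply.
rewrite -lerBlDl mulr_suml -sumrB; apply: ler_sum => k _.
rewrite mulr_suml -sumrB; apply: ler_sum => j _ /=.
have -> : b k / eps k ^+ N * (b j / eps j ^+ N) = b k * b j * ((eps k * eps j) ^+ N)^-1.
  by rewrite exprMn invfM; ring.
rewrite -[X in X - _]mulrA -mulrBr; apply: (le_trans (ler_norm _)); rewrite normrM -[X in _ <= X]mulrA ler_wpM2l// distrC.
apply: (@restored_approx R d N lam c C' phi _ _ _ _ h) => //; last 2 first.
- exact: ltW.
- exact: (HP (k, j)).
- move=> p q pc qc; have := cA k p pc; have := cA j q qc.
  have -> : x k - x j + eps k * p.2 - eps j * q.2 = x k + eps k * p.2 - (x j + eps j * q.2) by ring.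
  have := ler_normB (x k + eps k * p.2) (x j + eps j * q.2); lra.
- exact: euclidean_norm_ge0.
Qed.

(** For phi = 1 the value at the origin is exactly 1, so only phi - 1 matters. [M] does not depend
    on eps and del, because the bound on the double difference carries the factor (eps Z)^N (del
    Z)^N. *)
Lemma restored_origin (R : realType) (d N : nat) (lam l : nat -> seq (R * R)) (c : seq (R * R)) (C C' Z : R)
    (phi : R * R -> R) :
  (0 < d)%N -> ~~ odd N -> difference_measure N c -> smoothing_sequence d N l C ->
  smoothing_sequence d (2 * N) lam C' -> {within strip R, continuous phi} ->
  (forall p, p \in c -> `|p.2| <= Z) -> 0 <= Z ->
  exists2 M : R, 0 <= M & forall eps del t kappa, 0 < eps -> 0 < del -> 0 <= t -> 0 <= kappa -> Z * (eps + del) < 1 ->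
    (forall v, 0 <= v <= Z * (eps + del) -> `|phi (v, t) - 1| <= kappa) ->
    `|restored lam c N phi eps del 0 t - 1| <= M * kappa.
Proof.
move=> d0 oN hc hl hlam cphi cZ Z0.
pose D := (\sum_(p <- c) `|p.1|) * C.
exists (D * D * (Z ^+ N) ^+ 2 * 2) => [|eps del t kappa e0 l0 t0 k0 h1 Hk].
  by rewrite mulr_ge0// mulr_ge0 ?sqr_ge0// -expr2 sqr_ge0.
pose h := Z * (eps + del).
have h0 : 0 <= h by rewrite mulr_ge0// addr_ge0// ltW.
pose w := (eps * del) ^+ N; have w0 : 0 < w by rewrite exprn_gt0// mulr_gt0.
pose D' := w^-1 * ((\sum_(p <- c) `|p.1|) * ((\sum_(p <- c) `|p.1|) * C')).
(* [D'] contains (eps del)^(-N), which is harmless: eps and del are fixed while eta tends to 0. *)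
rewrite -subr_ge0; apply: (@ge0_of_small _ _ (D' + D * D * (Z ^+ N) ^+ 2 * 2)) => eta eta0.
have [P HP] := even_approximation h0 (strip_slice_continuous cphi h1 t0) eta0.
have cA p : p \in c -> `|0 + eps * p.2| <= eps * Z.
  by move=> pc; rewrite add0r normrM (gtr0_norm e0) ler_wpM2l ?(ltW e0) ?cZ.
have cB p : p \in c -> `|0 + del * p.2| <= del * Z.
  by move=> pc; rewrite add0r normrM (gtr0_norm l0) ler_wpM2l ?(ltW l0) ?cZ.
have ch p q : p \in c -> q \in c -> `|0 + eps * p.2 - del * q.2| <= h.
  move=> pc qc; apply: (le_trans (ler_normB _ _)); have := cB q qc; have := cA p pc.
  by rewrite !add0r /h; lra.
have := restored_approx hlam cphi e0 l0 ch h1 t0 (ltW eta0) HP.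
have HP1 v : 0 <= v <= h -> `|(P - 1%:P).[v ^+ 2]| <= kappa + eta.
  move=> vh; rewrite hornerD hornerN hornerC; have := HP v vh; have := Hk v vh.
  have := ler_distD (phi (v, t)) P.[v ^+ 2] 1; rewrite (distrC P.[_] (phi _)); lra.
have hAB : eps * Z + del * Z <= h by rewrite /h; lra.
have := double_difference_poly_bound d0 oN hc hl cA cB hAB (ltW h1) HP1 (addr_ge0 k0 (ltW eta0)).
rewrite subrr -/D.
(* The polarization identity for m = 0. *)
have dd1 : double_difference c (smoothed_poly d N 1%:P) 0 eps del = w.
  have := smoothing_polarization 0 0 eps 0 del d0 oN hc.
  rewrite !muln0 big_ord1 !moment0 !expr0 bin0 add0n invr1 !mul1r => E.
  transitivity (wsum c (fun z => wsum c (fun z' => ((0 + eps * z) - (0 + del * z')) ^+ (0 + 2 * N))) * smoothing_moment R d (2 * N) 0).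
    rewrite mulrC -wsumZ; apply: eq_wsum => z; rewrite -wsumZ; apply: eq_wsum => z'.
    by rewrite !add0r /smoothed_poly even_applyC muln0 mul1r mulrC.
  rewrite E.
  have [_ cN] := hc.
  have pw a : wsum c (fun z => (0 + a * z) ^+ N) = a ^+ N * N`!%:R.
    by rewrite -cN -wsumZ; apply: eq_wsum => z; rewrite add0r exprMn.
  have s0 : smoothing_moment R d N 0 = (N`!%:R)^-1.
    by have := smoothing_momentE R N 0 d0; rewrite /= moment0 mul1r add0n => ->; rewrite fact0 mul1r.
  have f0 : N`!%:R != 0 :> R by rewrite pnatr_eq0 -lt0n fact_gt0.
  by rewrite !pw s0 !mulfK// /w exprMn.
have ddB : double_difference c (smoothed_poly d N (P - 1%:P)) 0 eps del =
  double_difference c (smoothed_poly d N P) 0 eps del - w.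
  rewrite -dd1 double_differenceB; apply: eq_wsum => z; apply: eq_wsum => z'.
  by rewrite /smoothed_poly even_applyB mulrBr.
rewrite ddB -/w -/D'.
move: (double_difference _ _ _ _ _) (restored _ _ _ _ _ _ _ _) => X Y H1 H2.
have H3 : `|w^-1 * X - 1| <= D * D * (Z ^+ N) ^+ 2 * 2 * (kappa + eta).
  have -> : w^-1 * X - 1 = w^-1 * (X - w) by rewrite mulrBr mulVf// gt_eqF.
  rewrite normrM gtr0_norm ?invr_gt0// mulrC ler_pdivrMr//; apply: (le_trans H1).
  by rewrite le_eqVlt; apply/orP; left; apply/eqP; rewrite /w !exprMn; ring.
have := ler_distD (w^-1 * X) Y 1; lra.
Qed.

(** * Convergence of f_{eps,eps} *)

Lemma restored_sym (R : realType) (lam : nat -> seq (R * R)) (c : seq (R * R)) (N : nat) (phi : R * R -> R)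
    (eps del x t : R) :
  restored lam c N phi eps del (- x) t = restored lam c N phi del eps x t.
Proof.
rewrite /restored (mulrC eps); congr (_ * _); rewrite /double_difference wsum_exchange.
apply: eq_wsum => z; apply: eq_wsum => z'; rewrite -smoothedN; congr (smoothed _ _ _ _ _).
ring.
Qed.

Lemma euclidean_norm0 (R : realType) (d : nat) : euclidean_norm (0 : 'rV[R]_d) = 0.
Proof. by rewrite /euclidean_norm big1 ?sqrtr0// => i _; rewrite mxE expr0n. Qed.

Lemma euclidean_normN (R : realType) (d : nat) (x : 'rV[R]_d) : euclidean_norm (- x) = euclidean_norm x.
Proof. by congr Num.sqrt; apply: eq_bigr => i _; rewrite mxE sqrrN. Qed.

Lemma euclidean_norm_exists (R : realType) (d : nat) (t : R) : (0 < d)%N -> 0 <= t ->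
  exists y : 'rV[R]_d, euclidean_norm y = t.
Proof.
case: d => // d _ t0; exists (\row_i if i == ord0 then t else 0).
rewrite /euclidean_norm big_ord_recl big1 => [|i _]; rewrite mxE //=; last by rewrite expr0n.
by rewrite addr0 sqrtr_sqr ger0_norm.
Qed.

(* In the Hilbert space of the kernel, with unit vectors up to kappa, Cauchy-Schwarz for <U_eps - U_del, V_eps>. *)
Lemma restored_gram (R : realType) (d d' N : nat) (lam l : nat -> seq (R * R)) (c : seq (R * R)) (C C' Z : R)
    (phi : R * R -> R) (eps del x t h kappa s : R) :
  (0 < d)%N -> (0 < d')%N -> ~~ odd N -> difference_measure N c -> smoothing_sequence d N l C ->
  smoothing_sequence d (2 * N) lam C' -> class_P R d d' phi -> (forall p, p \in c -> `|p.2| <= Z) -> 0 <= Z ->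
  0 < eps -> 0 < del -> 0 <= t -> h < 1 ->
  `|x| + 2 * eps * Z <= h -> `|x| + 2 * del * Z <= h -> 0 < s ->
  let f a b := restored lam c N phi a b 0 0 in
  `|f eps eps - 1| <= kappa -> `|f del del - 1| <= kappa -> `|f eps del - 1| <= kappa -> `|f del eps - 1| <= kappa ->
  2 * s * `|restored lam c N phi eps eps x t - restored lam c N phi del eps x t| <= 4 * kappa * s ^+ 2 + 1 + kappa.
Proof.
move=> d0 d'0 oN hc hl hlam cphi cZ Z0 e0 l0 t0 h1 xe xd s0 f f11 f22 f12 f21.
have [y yt] := euclidean_norm_exists d'0 t0.
have h0 : 0 <= h < 1.
  by rewrite h1 andbT; apply: le_trans xe; rewrite addr_ge0// !mulr_ge0// ltW.
have cA a u p' : 0 < a -> `|u| = `|x| / 2 -> `|x| + 2 * a * Z <= h -> p' \in c -> `|u + a * p'.2| <= h / 2.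
  move=> a0 ux xh pc'; apply: (le_trans (ler_normD _ _)); rewrite ux normrM (gtr0_norm a0).
  have : a * `|p'.2| <= a * Z by rewrite ler_wpM2l ?(ltW a0)// cZ.
  lra.
have half : `|x / 2| = `|x| / 2 by rewrite normrM (@ger0_norm _ 2^-1).
have halfN : `|- (x / 2)| = `|x| / 2 by rewrite normrN.
(* The points (x/2, eps, y), (x/2, del, y) and (-x/2, eps, 0) with |y| = t: the first two differ
   from the third by x and y, and halving x keeps the nodes within h/2. *)
pose e_ (i : 'I_3) := [:: eps; del; eps]`_i.
pose x_ (i : 'I_3) := [:: x / 2; x / 2; - (x / 2)]`_i.
pose y_ (i : 'I_3) := [:: y; y; 0]`_i.
have H b : 0 <= \sum_(k < 3) \sum_(j < 3) b k * b j *
    restored lam c N phi (e_ k) (e_ j) (x_ k - x_ j) (euclidean_norm (y_ k - y_ j)).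
  apply: (restored_psd (l := l) (h := h) b y_ d0 oN hc hl hlam cphi) => //.
    by move=> [[|[|[|]]]].
  by move=> [[|[|[|]]]]// i q qc; apply: cA.
(* The coefficients are s, - s and [sg]. The scale s stays free, and the two signs of [sg] give the
   two-sided bound. *)
have H2 sg : sg ^+ 2 = 1 -> 0 <= s ^+ 2 * (f eps eps + f del del - f eps del - f del eps) + f eps eps +
    sg * (2 * s) * (restored lam c N phi eps eps x t - restored lam c N phi del eps x t).
  move=> sg1; have := H (fun i => [:: s; - s; sg]`_i).
  rewrite !big_ord_recl !big_ord0 /e_ /x_ /y_ /bump /= !subrr !sub0r !subr0 opprK euclidean_norm0 euclidean_normN yt.
  have -> : x / 2 + x / 2 = x by field.
  have -> : - (x / 2) - x / 2 = - x by field.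
  rewrite !restored_sym /f.
  move: (restored _ _ _ _ eps eps 0 0) (restored _ _ _ _ eps del 0 0) (restored _ _ _ _ del eps 0 0).
  move: (restored _ _ _ _ del del 0 0) (restored _ _ _ _ eps eps x t) (restored _ _ _ _ del eps x t) => a2 p q a1 a3 a4.
  congr (_ <= _); apply/eqP; rewrite -subr_eq0; apply/eqP.
  transitivity ((sg ^+ 2 - 1) * a1); last by rewrite sg1 subrr mul0r.
  ring.
have := H2 1 (expr1n _ _); have := H2 (-1) (etrans (sqrrN 1) (expr1n _ 2)).
move: (restored _ _ _ _ _ _ _ _) (restored _ _ _ _ _ _ _ _) => Y X.
have : s ^+ 2 * (f eps eps + f del del - f eps del - f del eps) <= s ^+ 2 * (4 * kappa).
  by apply: ler_wpM2l; [exact: sqr_ge0 | move: f11 f22 f12 f21; rewrite !ler_norml; lra].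
move: f11; rewrite ler_norml => f11 A1 A2 A3.
have -> : 2 * s * `|X - Y| = `|2 * s * (X - Y)| by rewrite normrM ger0_norm// mulr_ge0// ltW.
rewrite ler_norml; apply/andP; split; lra.
Qed.

(** [l], of order N, serves the two factors of the polarization; [lam], of order 2N, defines the
    smoothed function. *)
Definition restoration_data (R : realType) (d N : nat) (lam l : nat -> seq (R * R)) (c : seq (R * R)) (C C' Z : R) : Prop :=
  [/\ (0 < d)%N /\ ~~ odd N, difference_measure N c, smoothing_sequence d N l C, smoothing_sequence d (2 * N) lam C' &
      0 <= Z /\ forall p, p \in c -> `|p.2| <= Z].

Lemma restoration_data_exists (R : realType) (d : nat) : (0 < d)%N ->
  exists N lam l c C C' Z, @restoration_data R d N lam l c C C' Z.
Proof.
(* The order 2d is even, as polarization requires, and exceeds d, as boundedness requires. *)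
move=> d0; have [c hc] := difference_measure_exists R (2 * d).
have [l [C hl]] : bounded_moments (smoothing_moment R d (2 * d)).
  by apply: bounded_smoothing_moment; lia.
have [lam [C' hlam]] : bounded_moments (smoothing_moment R d (2 * (2 * d))).
  by apply: bounded_smoothing_moment; lia.
exists (2 * d)%N, lam, l, c, C, C', (\sum_(p <- c) `|p.2|); split => //.
  by rewrite oddM.
split=> [|p pc]; first exact: sumr_ge0.
by rewrite (big_rem p pc) /= lerDl sumr_ge0.
Qed.

Lemma restored_origin_cvg (R : realType) (d d' N : nat) (lam l : nat -> seq (R * R)) (c : seq (R * R)) (C C' Z : R)
    (phi : R * R -> R) (kappa : R) : restoration_data d N lam l c C C' Z -> class_P R d d' phi -> 0 < kappa ->
  exists2 rho : R, 0 < rho & forall eps del, 0 < eps < rho -> 0 < del < rho ->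
    `|restored lam c N phi eps del 0 0 - 1| <= kappa.
Proof.
move=> [[d0 oN] hc hl hlam [Z0 cZ]] [_ cphi phi1 _] k0.
have [M M0 HM] := restored_origin d0 oN hc hl hlam cphi cZ Z0.
pose k1 := kappa / (M + 1); have k10 : 0 < k1 by rewrite divr_gt0// ltr_wpDl.
have zz : 0 <= (0 : R) < 1 by rewrite lexx ltr01.
move/strip_continuousE: cphi => /(_ 0 0 zz (lexx _) _ k10)[r r0 Hr].
pose q := Num.min r 1; have q0 : 0 < q by rewrite lt_min r0 ltr01.
have qr : q <= r by rewrite ge_min lexx.
have q1 : q <= 1 by rewrite ge_min lexx orbT.
have Z1 : 0 < Z + 1 by rewrite ltr_wpDl.
exists (q / 2 / (Z + 1)) => [|eps del /andP[e0 e1] /andP[l0 l1]]; first by rewrite !divr_gt0.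
have Zq : Z * (eps + del) < q.
  have : (Z + 1) * eps < q / 2 by rewrite mulrC -ltr_pdivlMr.
  have : (Z + 1) * del < q / 2 by rewrite mulrC -ltr_pdivlMr.
  lra.
apply: (@le_trans _ _ (M * k1)).
  apply: HM => //; [exact: ltW|lra|].
  move=> v /andP[v0 vZ]; rewrite -phi1; apply: ltW; apply: Hr => //; last by rewrite subrr normr0.
    by rewrite v0; lra.
  by rewrite sub0r normrN ger0_norm//; lra.
by rewrite /k1 mulrCA ler_piMr ?(ltW k0)// ler_pdivrMr ?mul1r ?ltr_wpDl//; lra.
Qed.

(** Both functions are compared with f_{del,eps}(x, t): the second comparison is made at - x with
    the steps exchanged, and turned back by [restored_sym]. *)
Lemma restored_cauchy (R : realType) (d d' N : nat) (lam l : nat -> seq (R * R)) (c : seq (R * R)) (C C' Z : R)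
    (phi : R * R -> R) (kappa : R) : (0 < d')%N -> restoration_data d N lam l c C C' Z -> class_P R d d' phi -> 0 < kappa ->
  exists2 rho : R, 0 < rho & forall eps del x t, 0 < eps < rho -> 0 < del < rho ->
    `|x| + 2 * eps * Z < 1 -> `|x| + 2 * del * Z < 1 -> 0 <= t ->
    `|restored lam c N phi eps eps x t - restored lam c N phi del del x t| <= kappa.
Proof.
move=> d'0 hD cphi k0.
(* With s = 4 / kappa this gives 4 k1 s^2 <= 2, so each comparison is at most 2 + 1 + k1 <= 4, and 4
   + 4 = 2 s kappa. *)
pose k1 := Num.min 1 (kappa ^+ 2 / 32).
have k11 : k1 <= 1 by rewrite ge_min lexx.
have k12 : k1 <= kappa ^+ 2 / 32 by rewrite ge_min lexx orbT.
have k10 : 0 < k1 by rewrite lt_min ltr01/= divr_gt0// exprn_gt0.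
have [rho r0 Hr] := restored_origin_cvg hD cphi k10.
exists rho => // eps del x t he hd xe xd t0.
have [[d0 oN] hc hl hlam [Z0 cZ]] := hD.
have [e0 _] := andP he; have [l0 _] := andP hd.
pose s := 4 / kappa; have s0 : 0 < s by rewrite divr_gt0.
pose h := Num.max (`|x| + 2 * eps * Z) (`|x| + 2 * del * Z).
have h1 : h < 1 by rewrite gt_max xe.
have he1 : `|x| + 2 * eps * Z <= h by rewrite le_max lexx.
have hd1 : `|x| + 2 * del * Z <= h by rewrite le_max lexx orbT.
have A := restored_gram d0 d'0 oN hc hl hlam cphi cZ Z0 e0 l0 t0 h1 he1 hd1 s0 (Hr _ _ he he) (Hr _ _ hd hd)
  (Hr _ _ he hd) (Hr _ _ hd he).
rewrite -(normrN x) in he1 hd1.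
have B := restored_gram d0 d'0 oN hc hl hlam cphi cZ Z0 l0 e0 t0 h1 hd1 he1 s0 (Hr _ _ hd hd) (Hr _ _ he he)
  (Hr _ _ hd he) (Hr _ _ he hd).
rewrite !restored_sym in B.
move: A B; move: (restored _ _ _ _ _ _ _ _) (restored _ _ _ _ _ _ _ _) (restored _ _ _ _ _ _ _ _) => e b a A B.
have tri := ler_distD b a e.
suff : 2 * s * `|a - e| <= 2 * s * kappa by rewrite ler_pM2l// mulr_gt0.
apply: (@le_trans _ _ (2 * s * `|a - b| + 2 * s * `|e - b|)).
  by rewrite (distrC b) in tri; rewrite -mulrDr ler_wpM2l// mulr_ge0// ltW.
have -> : 2 * s * kappa = 8 by rewrite /s -mulrA divfK ?gt_eqF//; ring.
have : 4 * k1 * s ^+ 2 <= 2.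
  have -> : 4 * k1 * s ^+ 2 = k1 * (64 / kappa ^+ 2) by rewrite /s; field; rewrite gt_eqF.
  apply: (@le_trans _ _ (kappa ^+ 2 / 32 * (64 / kappa ^+ 2))).
    by rewrite ler_wpM2r// divr_ge0// exprn_ge0// ltW.
  by rewrite le_eqVlt; apply/orP; left; apply/eqP; field; rewrite gt_eqF.
lra.
Qed.

Lemma cvgn_norm_le_eventually (R : realType) (u : nat -> R) (l a C : R) (n0 : nat) :
  (forall n, (n0 <= n)%N -> `|a - u n| <= C) -> u n @[n --> \oo] --> l -> `|a - l| <= C.
Proof.
move=> H ul; apply: (cvgn_norm_le (u := fun n => u (n + n0)%N)); first by move=> n; apply: H; rewrite leq_addl.
by rewrite (cvg_shiftn n0).
Qed.

(** The Cauchy bound is uniform in (x, t), hence so is the convergence. The limit is cut off outside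
    the strip to encode a function on it, and |x| may be taken because f_{eps,eps} is even in x. *)
Lemma restored_limit (R : realType) (d d' N : nat) (lam l : nat -> seq (R * R)) (c : seq (R * R)) (C C' Z : R)
    (phi : R * R -> R) : (0 < d')%N -> restoration_data d N lam l c C C' Z -> class_P R d d' phi ->
  exists2 F : R * R -> R, (forall p, ~ strip R p -> F p = 0) & forall kappa, 0 < kappa ->
    exists2 rho : R, 0 < rho & forall eps x t, 0 < eps < rho -> `|x| + 2 * eps * Z < 1 -> 0 <= t ->
      `|F (`|x|, t) - restored lam c N phi eps eps x t| <= kappa.
Proof.
move=> d'0 hD cphi.
pose u x t n := restored lam c N phi n.+1%:R^-1 n.+1%:R^-1 x t.
have [_ _ _ _ [Z0 _]] := hD.
have small (r x : R) : 0 < r -> `|x| < 1 -> exists n0, forall n, (n0 <= n)%N -> 0 < (n.+1%:R^-1 : R) < r /\ `|x| + 2 * n.+1%:R^-1 * Z < 1.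
  move=> r0 x1; pose q := Num.min r ((1 - `|x|) / 2 / (Z + 1)).
  have q0 : 0 < q by rewrite lt_min r0 !divr_gt0// ?subr_gt0// ltr_wpDl.
  have /cvgrPdist_lt/(_ _ q0) [n0 _ H] := @cvg_harmonic R.
  exists n0 => n /H /=; rewrite sub0r normrN /harmonic /= ger0_norm ?invr_ge0// /q lt_min => /andP[nr nZ].
  split; first by rewrite invr_gt0 ltr0n.
  have : n.+1%:R^-1 * (Z + 1) < (1 - `|x|) / 2 by rewrite -ltr_pdivlMr// ltr_wpDl.
  have : 0 < (n.+1%:R^-1 : R) by rewrite invr_gt0 ltr0n.
  by move: (n.+1%:R^-1) => z; lra.
have ul x t : `|x| < 1 -> 0 <= t -> exists l : R, u x t n @[n --> \oo] --> l.
  move=> x1 t0; apply: cvgn_cauchy => e e0.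
  have [rho r0 Hr] := restored_cauchy d'0 hD cphi e0.
  have [n0 Hn] := small _ _ r0 x1; exists n0 => m n /Hn[m1 m2] /Hn[n1 n2].
  exact: Hr.
exists ((fun p => lim (u p.1 p.2 n @[n --> \oo])) \_ (strip R)).
  by move=> p np; rewrite patchE memNset.
move=> kappa k0; have [rho r0 Hr] := restored_cauchy d'0 hD cphi k0.
exists rho => // eps x t he xe t0; have [e0 _] := andP he.
have x1 : `|x| < 1 by apply: le_lt_trans xe; rewrite lerDl !mulr_ge0// ltW.
rewrite patchE /= mem_set; last by rewrite /strip /= normr_ge0.
have uN : u `|x| t = u x t.
  by apply/funext => n; rewrite /u; case: (ler0P x) => // _; rewrite restored_sym.
rewrite uN distrC; have [n0 Hn] := small _ _ r0 x1.
have [a ua] := ul x t x1 t0.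
have uc : u x t n @[n --> \oo] --> lim (u x t n @[n --> \oo]) by apply/cvg_ex; exists a.
apply: (cvgn_norm_le_eventually (n0 := n0) _ uc) => n /Hn[n1 n2].
exact: Hr.
Qed.

(** * The lift of the restored function *)

(** For equal steps, a double difference is a single difference against this symmetric measure. *)
Definition self_difference (R : pzRingType) (c : seq (R * R)) : seq (R * R) :=
  [seq (p.1 * q.1, p.2 - q.2) | p <- c, q <- c].

Lemma wsum_self_difference (R : comPzRingType) (c : seq (R * R)) (f : R -> R) :
  wsum (self_difference c) f = wsum c (fun z => wsum c (fun z' => f (z - z'))).
Proof.
rewrite /wsum big_allpairs_dep /=; apply: eq_bigr => p _; rewrite mulr_sumr.
by apply: eq_bigr => q _; rewrite mulrA.
Qed.

Lemma double_difference_self (R : comPzRingType) (c : seq (R * R)) (E : R -> R) (x eps : R) :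
  double_difference c E x eps eps = wsum (self_difference c) (fun z => E (x + eps * z)).
Proof.
rewrite wsum_self_difference; apply: eq_wsum => z; apply: eq_wsum => z'.
by congr E; ring.
Qed.

Lemma self_difference_exprn (R : comPzRingType) (c : seq (R * R)) (n : nat) :
  wsum (self_difference c) (fun z => z ^+ n) =
  \sum_(i < n.+1) 'C(n, i)%:R * (-1) ^+ (n - i) * (wsum c (fun z => z ^+ i) * wsum c (fun z => z ^+ (n - i))).
Proof.
rewrite wsum_self_difference.
transitivity (wsum c (fun z => wsum c (fun z' => \sum_(i < n.+1) 'C(n, i)%:R * (-1) ^+ (n - i) *
    (z ^+ i * z' ^+ (n - i))))).
  apply: eq_wsum => z; apply: eq_wsum => z'; rewrite addrC exprDn; apply: eq_bigr => i _.
  by rewrite -mulr_natl (exprNn z'); ring.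
under eq_wsum do rewrite wsum_sum.
rewrite wsum_sum; apply: eq_bigr => i _; under eq_wsum do rewrite wsumZ.
by rewrite wsumZ wsumM.
Qed.

(** Only the term i = N survives, and it contributes C(2N, N) N! N! = (2N)!, with sign + because N
    is even. *)
Lemma self_difference_measure (R : realType) (N : nat) (c : seq (R * R)) : ~~ odd N ->
  difference_measure N c -> difference_measure (2 * N) (self_difference c).
Proof.
move=> oN [c0 cN]; split=> [k kN|]; rewrite self_difference_exprn.
  rewrite big1// => i _; have [iN|Ni] := ltnP i N; first by rewrite c0// mul0r mulr0.
  by rewrite [X in _ * (_ * X)]c0 ?mulr0//; lia.
have NN : (N < (2 * N).+1)%N by lia.
rewrite (bigD1 (Ordinal NN))//= big1 ?addr0 => [|i /eqP iN].
  have -> : (2 * N - N = N)%N by lia.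
  rewrite cN -signr_odd (negbTE oN) expr0 mulr1.
  have NN' : (N <= 2 * N)%N by lia.
  by rewrite -(bin_fact NN') (_ : 2 * N - N = N)%N ?natrM//; lia.
have [iltN|Ni] := ltnP i N; first by rewrite c0// mul0r mulr0.
rewrite [X in _ * (_ * X)]c0 ?mulr0//; have := ltn_ord i.
suff : (i : nat) != N by lia.
by apply/eqP => E; apply: iN; apply: val_inj.
Qed.

Lemma self_difference_odd (R : realType) (c : seq (R * R)) (eps : R) (n : nat) : odd n ->
  wsum (self_difference c) (fun z => (0 + eps * z) ^+ n) = 0.
Proof.
move=> on; have : wsum (self_difference c) (fun z => (0 + eps * z) ^+ n) = - wsum (self_difference c) (fun z => (0 + eps * z) ^+ n).
  rewrite {1}wsum_self_difference wsum_exchange -mulN1r -wsumZ wsum_self_difference; apply: eq_wsum => z; apply: eq_wsum => z'.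
  have -> : 0 + eps * (z' - z) = - (0 + eps * (z - z')) by ring.
  by rewrite exprNn -signr_odd on expr1.
move: (wsum _ _) => w; lra.
Qed.

(** The moments of order below 2N vanish, and the odd ones vanish by symmetry; what remains is even
    in u. *)
Lemma self_difference_shift (R : realType) (N m : nat) (c : seq (R * R)) (u eps : R) : ~~ odd N ->
  difference_measure N c ->
  wsum (self_difference c) (fun z => (u + eps * z) ^+ (2 * m + 2 * N)) =
  \sum_(k < m.+1) 'C(2 * m + 2 * N, 2 * k)%:R *
    wsum (self_difference c) (fun z => (0 + eps * z) ^+ (2 * (m - k) + 2 * N)) * u ^+ (2 * k).
Proof.
move=> oN hc; have hcc := self_difference_measure oN hc.
pose n := (2 * m + 2 * N)%N; rewrite -/n.
pose A i := wsum (self_difference c) (fun z => (0 + eps * z) ^+ i).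
have A0 i : (i < 2 * N)%N -> A i = 0 by exact: difference_measure_shift.
transitivity (\sum_(i < n.+1) 'C(n, i)%:R * A (n - i)%N * u ^+ i).
  transitivity (wsum (self_difference c) (fun z => \sum_(i < n.+1) ('C(n, i)%:R * u ^+ i) * (0 + eps * z) ^+ (n - i))).
    apply: eq_wsum => z; rewrite addrC exprDn; apply: eq_bigr => i _.
    by rewrite -[LHS]mulr_natl add0r; ring.
  rewrite wsum_sum; apply: eq_bigr => i _; rewrite wsumZ -/(A _).
  by ring.
rewrite -(big_mkord xpredT (fun i => 'C(n, i)%:R * A (n - i)%N * u ^+ i)).
have nE : n.+1 = ((2 * m).+1 + 2 * N)%N by rewrite /n; lia.
rewrite nE (big_cat_nat (n := (2 * m).+1)) ?leq_addr//= [X in (_ + X)]big_nat_cond [X in (_ + X)]big1 ?addr0; last first.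
  by move=> i /andP[/andP[i1 i2] _]; rewrite A0 ?mulr0 ?mul0r// /n; lia.
rewrite big_mkord (bigID (fun i : 'I__ => ~~ odd i)) /= [X in _ + X]big1 ?addr0; last first.
  move=> i; rewrite negbK => oi; rewrite [A _]self_difference_odd ?mulr0 ?mul0r//.
  have := ltn_ord i; rewrite ltnS => im; rewrite oddB; last by rewrite /n; lia.
  by rewrite /n oddD !oddM /= oi.
rewrite (sum_even_indices m (fun i => 'C(n, i)%:R * A (n - i)%N * u ^+ i)); apply: eq_bigr => k _.
by have := ltn_ord k => km; rewrite (_ : n - 2 * k = 2 * (m - k) + 2 * N)%N// /n; lia.
Qed.

(** Its value at u^2 is f_{eps,eps}(u) computed for P(v^2) in place of phi. Through it the limit and
    the lift of the limit become accessible to polynomial approximation. *)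
Definition restored_poly (R : realType) (d N : nat) (c : seq (R * R)) (eps : R) (P : {poly R}) : {poly R} :=
  \poly_(k < size P) (((eps * eps) ^+ N)^-1 * \sum_(m < size P | (k <= m)%N)
    P`_m * smoothing_moment R d (2 * N) (2 * m) * ('C(2 * m + 2 * N, 2 * k)%:R *
    wsum (self_difference c) (fun z => (0 + eps * z) ^+ (2 * (m - k) + 2 * N)))).

Lemma even_apply_restored_poly (R : realType) (d N : nat) (c : seq (R * R)) (eps u : R) (om : nat -> R) (P : {poly R}) :
  even_apply om (restored_poly d N c eps P) u =
  ((eps * eps) ^+ N)^-1 * \sum_(m < size P) P`_m * smoothing_moment R d (2 * N) (2 * m) *
    \sum_(k < m.+1) 'C(2 * m + 2 * N, 2 * k)%:R *
      wsum (self_difference c) (fun z => (0 + eps * z) ^+ (2 * (m - k) + 2 * N)) * (om k * u ^+ (2 * k)).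
Proof.
pose g m k := P`_m * smoothing_moment R d (2 * N) (2 * m) * ('C(2 * m + 2 * N, 2 * k)%:R *
      wsum (self_difference c) (fun z => (0 + eps * z) ^+ (2 * (m - k) + 2 * N)) * (om k * u ^+ (2 * k))).
transitivity (((eps * eps) ^+ N)^-1 * \sum_(k < size P) \sum_(m < size P | (k <= m)%N) g m k).
  rewrite (@even_apply_widen _ (size P)) ?size_poly// mulr_sumr; apply: eq_bigr => k _.
  rewrite coef_poly ltn_ord -!mulrA; congr (_ * _); rewrite mulr_suml; apply: eq_bigr => m _.
  by rewrite /g !mulrA.
congr (_ * _); rewrite (exchange_big_dep xpredT)//=; apply: eq_bigr => m _.
rewrite mulr_sumr (big_ord_widen_cond (size P) xpredT (g m) (ltn_ord m)).
by apply: eq_bigl => k; rewrite ltnS.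
Qed.

Lemma horner_restored_poly (R : realType) (d N : nat) (c : seq (R * R)) (eps u : R) (P : {poly R}) : ~~ odd N ->
  difference_measure N c ->
  (restored_poly d N c eps P).[u ^+ 2] = ((eps * eps) ^+ N)^-1 * double_difference c (smoothed_poly d N P) u eps eps.
Proof.
move=> oN hc; rewrite -even_apply1 even_apply_restored_poly; congr (_ * _).
rewrite double_difference_self.
transitivity (wsum (self_difference c) (fun z => \sum_(m < size P) P`_m * smoothing_moment R d (2 * N) (2 * m) *
   (u + eps * z) ^+ (2 * m + 2 * N))).
  rewrite wsum_sum; apply: eq_bigr => m _; rewrite wsumZ self_difference_shift//; congr (_ * _).
  by apply: eq_bigr => k _; rewrite mul1r.
apply: eq_wsum => z; rewrite /smoothed_poly /even_apply mulr_sumr; apply: eq_bigr => m _.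
by rewrite exprD; ring.
Qed.

Definition zonal_even_poly (R : fieldType) (d : nat) (P : {poly R}) (r t : R) : R :=
  \sum_(m < size P) P`_m * zonal_even d m r t.

(** All distances |x xi - r eta| lie between x - |r| and x + |r|, so only values of P at squares of
    points near x enter the mean. *)
Lemma zonal_even_poly_close (R : realType) (d : nat) (P : {poly R}) (x r rho h p0 M : R) : (0 < d)%N ->
  0 <= x -> x + rho <= h -> h <= 1 -> `|r| <= rho ->
  (forall v, 0 <= v <= h -> `|v - x| <= rho -> `|P.[v ^+ 2] - p0| <= M) ->
  `|zonal_even_poly d P x r - p0| <= M.
Proof.
move=> d0 x0 xh h1 rr HP; have [s hs] := @sphere_quadrature_sequence R d d0.
have xr : `|x| + `|r| <= 1 by rewrite ger0_norm//; lra.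
have H : wsum (s n) (fun xi => wsum (s n) (fun eta => P.[euclidean_norm (x *: xi - r *: eta) ^+ 2]))
    @[n --> \oo] --> zonal_even_poly d P x r.
  apply: (cvgn_ext (u := fun n => \sum_(m < size P) P`_m * wsum (s n) (fun xi => wsum (s n) (fun eta =>
      dotp (x *: xi - r *: eta) (x *: xi - r *: eta) ^+ m)))).
    move=> n; under [in RHS]eq_wsum => xi do under eq_wsum => eta do rewrite euclidean_norm_sqr horner_coef.
    under [in RHS]eq_wsum => xi do rewrite wsum_sum.
    rewrite wsum_sum; apply: eq_bigr => m _; rewrite -wsumZ; apply: eq_wsum => xi; by rewrite -wsumZ.
  by apply: cvgn_sum => m _; apply: cvgnZ; apply: zonal_even_cvg.
rewrite distrC; apply: (cvgn_norm_le _ H) => n; have [s0 s1 _] := hs n.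
have -> : p0 = wsum (s n) (fun=> wsum (s n) (fun=> p0)).
  have E (a : R) : wsum (s n) (fun=> a) = a by rewrite -[RHS]mulr1 -s1 -wsumZ; apply: eq_wsum => ?; rewrite mulr1.
  by rewrite !E.
rewrite distrC -mulN1r -wsumZ -wsumD; apply: wsum_prob_bound => // p /s0[p0' p1]; split => //.
rewrite -wsumZ -wsumD; apply: wsum_prob_bound => // q /s0[q0 q1]; split => //.
rewrite mulN1r; have /andP[v0 v1] := euclidean_normB_le x r p1 q1.
have hv : `|euclidean_norm (x *: p.2 - r *: q.2) - x| <= rho.
  apply: le_trans rr; have /andP[h2 h3] := dotp_le1 p1 q1.
  rewrite ler_norml; apply/andP; split; last by move: v1; rewrite (ger0_norm x0); lra.
  have [xr0|rx0] := lerP x `|r|; first by lra.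
  have : x - `|r| <= euclidean_norm (x *: p.2 - r *: q.2); last by lra.
  rewrite -(ler_pXn2r (n := 2)) ?nnegrE//; last by lra.
  rewrite euclidean_norm_sqr dotpB_sqr// sqrrB real_normK ?num_real//.
  have : x * (r * dotp p.2 q.2) <= x * `|r|.
    rewrite ler_wpM2l//; apply: (le_trans (ler_norm _)); rewrite normrM ler_piMr// ler_norml h2 h3//.
  lra.
apply: HP => //; rewrite v0; move: v1; rewrite (ger0_norm x0); lra.
Qed.

(** The lift multiplies x^(2k) by mu_k, and the factorials recombine into the coefficients of
    [zonal_even]. So the lifted polynomial is a mean of P(|x xi - r eta|^2) with r distributed by
    the smeared measure of order 2N at the origin. *)
Lemma lift_restored_poly_cvg (R : realType) (d N : nat) (c : seq (R * R)) (lam : nat -> seq (R * R)) (C eps x : R)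
    (P : {poly R}) : (0 < d)%N -> ~~ odd N -> difference_measure N c -> smoothing_sequence d (2 * N) lam C ->
  ((eps * eps) ^+ N)^-1 * wsum (smear (lam n) (self_difference c) (2 * N) 0 eps) (zonal_even_poly d P x) @[n --> \oo] -->
  even_apply (moment R d) (restored_poly d N c eps P) x.
Proof.
move=> d0 oN hc [_ _ hl]; rewrite even_apply_restored_poly; apply: cvgnZ.
apply: (cvgn_ext (u := fun n => \sum_(m < size P) P`_m * ((moment R d m)^-1 * \sum_(k < m.+1)
     'C(2 * m, 2 * k)%:R * (moment R d k * moment R d (m - k)) * (x ^+ (2 * k)) *
     (wsum (self_difference c) (fun z => (0 + eps * z) ^+ (2 * (m - k) + 2 * N)) * wsum (lam n) (fun a => a ^+ (2 * (m - k))))))).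
  move=> n; rewrite wsum_sum; apply: eq_bigr => m _; rewrite wsumZ; congr (_ * _).
  rewrite /zonal_even wsumZ; congr (_ * _); rewrite wsum_sum; apply: eq_bigr => k _.
  by rewrite -smear_exprn -wsumZ; apply: eq_wsum => r; rewrite -!mulrA.
apply: cvgn_sum => m _; rewrite -mulrA; apply: cvgnZ.
have m0 : moment R d m != 0 by rewrite gt_eqF// moment_gt0.
have -> : smoothing_moment R d (2 * N) (2 * m) *
    \sum_(k < m.+1) 'C(2 * m + 2 * N, 2 * k)%:R *
      wsum (self_difference c) (fun z => (0 + eps * z) ^+ (2 * (m - k) + 2 * N)) * (moment R d k * x ^+ (2 * k)) =
  (moment R d m)^-1 * \sum_(k < m.+1)
     'C(2 * m, 2 * k)%:R * (moment R d k * moment R d (m - k)) * (x ^+ (2 * k)) *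
     (wsum (self_difference c) (fun z => (0 + eps * z) ^+ (2 * (m - k) + 2 * N)) * smoothing_moment R d (2 * N) (2 * (m - k))).
  rewrite !mulr_sumr; apply: eq_bigr => k _.
  have km : (k <= m)%N by have := ltn_ord k; rewrite ltnS.
  have h1 := smoothing_momentE R (2 * N) (2 * m) d0; have h2 := smoothing_momentE R (2 * N) (2 * (m - k)) d0.
  rewrite !mul2n !uphalf_double -!mul2n in h1 h2.
  have E : smoothing_moment R d (2 * N) (2 * m) * 'C(2 * m + 2 * N, 2 * k)%:R =
    (moment R d m)^-1 * ('C(2 * m, 2 * k)%:R * (moment R d (m - k) * smoothing_moment R d (2 * N) (2 * (m - k)))).
    have -> : smoothing_moment R d (2 * N) (2 * m) = (moment R d m)^-1 * ((2 * m)`!%:R / (2 * m + 2 * N)`!%:R).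
      by rewrite -h1 mulKf.
    rewrite h2 -mulrA; congr (_ * _).
    have fn j : j`!%:R != 0 :> R by rewrite pnatr_eq0 -lt0n fact_gt0.
    have k1 : (2 * k <= 2 * m)%N by lia.
    have k2 : (2 * k <= 2 * m + 2 * N)%N by lia.
    have b1 : 'C(2 * m, 2 * k)%:R = (2 * m)`!%:R / ((2 * k)`!%:R * (2 * (m - k))`!%:R) :> R.
      by rewrite -(bin_fact k1) !natrM mulnBr mulfK// mulf_neq0.
    have b2 : 'C(2 * m + 2 * N, 2 * k)%:R = (2 * m + 2 * N)`!%:R / ((2 * k)`!%:R * (2 * (m - k) + 2 * N)`!%:R) :> R.
      rewrite -(bin_fact k2) (_ : 2 * m + 2 * N - 2 * k = 2 * (m - k) + 2 * N)%N; last by lia.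
      by rewrite !natrM mulfK// mulf_neq0.
    rewrite b1 b2; have := fn (2 * k)%N; have := fn (2 * (m - k))%N; have := fn (2 * m + 2 * N)%N.
    have := fn (2 * (m - k) + 2 * N)%N.
    move: ((2 * k)`!%:R) ((2 * (m - k))`!%:R) ((2 * m + 2 * N)`!%:R) ((2 * m)`!%:R) ((2 * (m - k) + 2 * N)`!%:R).
    by move=> q1 q2 q3 q4 q5 n1 n2 n3 n4; field; rewrite n1 n2 n3 n4.
  move: E; move: (wsum _ _) => w E.
  transitivity (smoothing_moment R d (2 * N) (2 * m) * 'C(2 * m + 2 * N, 2 * k)%:R * (w * (moment R d k * x ^+ (2 * k)))).
    by rewrite !mulrA.
  by rewrite E; ring.
by apply: cvgnZ; apply: cvgn_sum => k _; apply: cvgnZ; apply: cvgnZ; exact: hl.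
Qed.

(** [K] does not depend on eps: the variation of the smeared measure is of order eps^(2N), which the
    prefactor divides out. After this normalization its total mass tends to 1, so the constant p0 is
    reproduced. *)
Lemma lift_restored_poly_close (R : realType) (d N : nat) (lam l : nat -> seq (R * R)) (c : seq (R * R)) (C C' Z : R) :
  restoration_data d N lam l c C C' Z ->
  exists2 K : R, 0 <= K & forall (eps x h p0 M : R) (P : {poly R}), 0 < eps -> 0 <= x -> x + 2 * eps * Z <= h -> h <= 1 -> 0 <= M ->
    (forall v, 0 <= v <= h -> `|v - x| <= 2 * eps * Z -> `|P.[v ^+ 2] - p0| <= M) ->
    `|even_apply (moment R d) (restored_poly d N c eps P) x - p0| <= K * M.
Proof.
move=> [[d0 oN] hc _ hlam [Z0 cZ]]; have hcc := self_difference_measure oN hc.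
have [l1 l2 l3] := hlam.
have C0 : 0 <= C' by apply: le_trans (l1 0%N); apply: sumr_ge0.
pose S := \sum_(p <- self_difference c) `|p.1|; have S0 : 0 <= S by exact: sumr_ge0.
exists (S * C' * (2 * Z) ^+ (2 * N)) => [|eps x h p0 M P e0 x0 xh h1 M0 HP].
  by rewrite !mulr_ge0// exprn_ge0// mulr_ge0.
have W0 : 0 < (eps * eps) ^+ N by rewrite exprn_gt0// mulr_gt0.
have ccZ p : p \in self_difference c -> `|0 + eps * p.2| <= 2 * eps * Z.
  move=> /allpairsPdep[a [b [ac bc ->]]] /=; rewrite add0r normrM (gtr0_norm e0).
  have -> : 2 * eps * Z = eps * (Z + Z) by ring.
  by rewrite ler_wpM2l ?(ltW e0)//; apply: (le_trans (ler_normB _ _)); rewrite lerD ?cZ.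
pose sm n := smear (lam n) (self_difference c) (2 * N) 0 eps.
have one : ((eps * eps) ^+ N)^-1 * wsum (sm n) (fun=> p0) @[n --> \oo] --> p0.
  have E0 : p0 = ((eps * eps) ^+ N)^-1 * (p0 * wsum (self_difference c) (fun z => (0 + eps * z) ^+ (0 + 2 * N)) * smoothing_moment R d (2 * N) 0).
    have -> : wsum (self_difference c) (fun z => (0 + eps * z) ^+ (0 + 2 * N)) = (eps * eps) ^+ N * (2 * N)`!%:R.
      rewrite -(proj2 hcc) -wsumZ; apply: eq_wsum => z; rewrite !add0r exprMn.
      by rewrite -expr2 -exprM.
    have -> : smoothing_moment R d (2 * N) 0 = ((2 * N)`!%:R)^-1.
      by have := smoothing_momentE R (2 * N) 0 d0; rewrite /= moment0 mul1r add0n => ->; rewrite fact0 mul1r.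
    have f0 : (2 * N)`!%:R != 0 :> R by rewrite pnatr_eq0 -lt0n fact_gt0.
    have w0 := lt0r_neq0 W0.
    by rewrite mulrA mulfK// mulrCA mulVf// mulr1.
  rewrite {2}E0.
  apply: cvgnZ; apply: (cvgn_ext (u := fun n => p0 * wsum (self_difference c) (fun z => (0 + eps * z) ^+ (0 + 2 * N)) * wsum (lam n) (fun a => a ^+ 0))).
    by move=> n; rewrite -mulrA -smear_exprn -wsumZ; apply: eq_wsum => r; rewrite expr0 mulr1.
  by apply: cvgnZ; exact: l3.
have H := @lift_restored_poly_cvg R d N c lam C' eps x P d0 oN hc hlam.
apply: (cvgn_dist_le H one) => n; rewrite -mulrBr normrM gtr0_norm ?invr_gt0// mulrC ler_pdivrMr//.
rewrite -mulN1r -wsumZ -wsumD.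
have -> : S * C' * (2 * Z) ^+ (2 * N) * M * (eps * eps) ^+ N = S * C' * (2 * eps * Z) ^+ (2 * N) * M.
  have -> : (2 * eps * Z) ^+ (2 * N) = (2 * Z) ^+ (2 * N) * (eps * eps) ^+ N.
    by rewrite -expr2 -exprM -exprMn; congr (_ ^+ _); ring.
  by ring.
apply: wsum_bound => //; first exact: (@smear_variation _ _ _ (2 * N) _ _ _ _ ccZ (l1 n)).
move=> p /(smear_radius ccZ (l2 n)) pr; rewrite mulN1r.
by apply: (zonal_even_poly_close d0 x0 xh h1 pr).
Qed.

(** Here [K] contains (eps eps)^(-N), so eps has to be fixed before the accuracy eta of the
    polynomial. *)
Lemma restored_limit_approx (R : realType) (d N : nat) (lam l : nat -> seq (R * R)) (c : seq (R * R)) (C C' Z : R)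
    (phi F : R * R -> R) (kappa rho eps : R) : restoration_data d N lam l c C C' Z -> {within strip R, continuous phi} ->
  (forall eps x t, 0 < eps < rho -> `|x| + 2 * eps * Z < 1 -> 0 <= t ->
      `|F (`|x|, t) - restored lam c N phi eps eps x t| <= kappa) ->
  0 < eps < rho ->
  exists2 K : R, 0 <= K & forall x t h eta P, 0 <= x -> x + 2 * eps * Z <= h -> h < 1 -> 0 <= t -> 0 <= eta ->
    (forall v, 0 <= v <= h -> `|phi (v, t) - P.[v ^+ 2]| <= eta) ->
    `|F (x, t) - (restored_poly d N c eps P).[x ^+ 2]| <= kappa + K * eta.
Proof.
move=> [[d0 oN] hc _ hlam [Z0 cZ]] cphi HF he; have [e0 _] := andP he.
have C0 : 0 <= C' by case: hlam => l1 _ _; apply: le_trans (l1 0%N); apply: sumr_ge0.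
exists (((eps * eps) ^+ N)^-1 * ((\sum_(p <- c) `|p.1|) * ((\sum_(p <- c) `|p.1|) * C'))).
  by rewrite mulr_ge0 ?invr_ge0 ?exprn_ge0 ?mulr_ge0 ?sumr_ge0// ltW.
move=> x t h eta P x0 xh h1 t0 eta0 HP.
have H1 : `|F (x, t) - restored lam c N phi eps eps x t| <= kappa.
  have := HF eps x t he; rewrite (ger0_norm x0); apply => //; lra.
have ch p q : p \in c -> q \in c -> `|x + eps * p.2 - eps * q.2| <= h.
  move=> pc qc; have : `|eps * p.2 - eps * q.2| <= 2 * eps * Z.
    rewrite -mulrBr normrM (gtr0_norm e0).
    have -> : 2 * eps * Z = eps * (Z + Z) by ring.
    by rewrite ler_wpM2l ?(ltW e0)//; apply: (le_trans (ler_normB _ _)); rewrite lerD ?cZ.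
  have := ler_normD x (eps * p.2 - eps * q.2); rewrite addrA (ger0_norm x0); lra.
have := restored_approx hlam cphi e0 e0 ch h1 t0 eta0 HP.
rewrite horner_restored_poly//; move: H1; move: (restored _ _ _ _ _ _ _ _) => a H1 H2.
by have := ler_distD a (F (x, t)) (((eps * eps) ^+ N)^-1 * double_difference c (smoothed_poly d N P) x eps eps); lra.
Qed.

Lemma scale_between (R : realFieldType) (rho g Z : R) : 0 < rho -> 0 < g -> 0 <= Z ->
  exists2 eps, 0 < eps < rho & 2 * eps * Z <= g.
Proof.
move=> r0 g0 Z0; have Z1 : 0 < Z + 1 by lra.
pose eps := Num.min (rho / 2) (g / 2 / (Z + 1)).
have e0 : 0 < eps by rewrite lt_min !divr_gt0.
have e1 : eps <= rho / 2 by rewrite ge_min lexx.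
have e2 : eps <= g / 2 / (Z + 1) by rewrite ge_min lexx orbT.
exists eps; first by rewrite e0/=; lra.
by move: e2; rewrite ler_pdivlMr//; lra.
Qed.

Lemma restored_limit_continuous (R : realType) (d N : nat) (lam l : nat -> seq (R * R)) (c : seq (R * R)) (C C' Z : R)
    (phi F : R * R -> R) : restoration_data d N lam l c C C' Z -> {within strip R, continuous phi} ->
  (forall kappa, 0 < kappa -> exists2 rho : R, 0 < rho & forall eps x t, 0 < eps < rho -> `|x| + 2 * eps * Z < 1 ->
      0 <= t -> `|F (`|x|, t) - restored lam c N phi eps eps x t| <= kappa) ->
  {within strip R, continuous F}.
Proof.
move=> hD cphi HF; apply: (approx_strip_continuous cphi) => x0 e /andP[x00 x01] e0.
have [rho r0 Hr] := HF e e0; have [_ _ _ _ [Z0 _]] := hD.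
pose a := (1 + x0) / 2; pose h := (1 + a) / 2.
have ha : 0 < h - a by rewrite /h /a; lra.
have [eps he eZ] := scale_between r0 ha Z0.
have [K K0 HK] := restored_limit_approx hD cphi Hr he.
exists h, a, K, (restored_poly d N c eps); split => //; [rewrite /h /a; lra|rewrite /a; lra|].
move=> x t eta P /andP[x0' xa] t0 eta0 HP; apply: (HK x t h) => //; first by lra.
by rewrite /h /a; lra.
Qed.

Lemma dist_eq_of_small (R : realFieldType) (a b : R) : (forall e, 0 < e -> `|a - b| <= e) -> a = b.
Proof.
move=> H; apply/eqP; rewrite -subr_eq0 -normr_le0; apply/ler_addgt0Pr => e e0; rewrite add0r; exact: H.
Qed.

(** Lifting the restored polynomial averages P over distances within 2 eps Z of x, where continuity
    keeps phi close to phi(x, t). *)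
Lemma restored_limit_lift (R : realType) (d d' N : nat) (lam l : nat -> seq (R * R)) (c : seq (R * R)) (C C' Z : R)
    (phi F : R * R -> R) : (2 <= d)%N -> restoration_data d N lam l c C C' Z -> class_P R d d' phi ->
  (forall kappa, 0 < kappa -> exists2 rho : R, 0 < rho & forall eps x t, 0 < eps < rho -> `|x| + 2 * eps * Z < 1 ->
      0 <= t -> `|F (`|x|, t) - restored lam c N phi eps eps x t| <= kappa) ->
  dimension_lift d F = phi.
Proof.
move=> d2 hD [phi0 cphi _ _] HF; apply/funext => -[x t].
have [[/= x01 t0]|nxt] := pselect (strip R (x, t)); last first.
  by rewrite /dimension_lift patchE memNset// phi0.
have cF := restored_limit_continuous hD cphi HF.
apply: dist_eq_of_small => e e0; have [x0 x1] := andP x01.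
have [_ _ _ _ [Z0 _]] := hD.
have [K' K'0 HK'] := lift_restored_poly_close hD.
have e8 : 0 < e / 8 by lra.
pose e1 := e / 8 / (K' + 1); have e10 : 0 < e1 by rewrite divr_gt0// ltr_wpDl.
have K'e : K' * e1 <= e / 8 by rewrite mulrCA ler_piMr ?(ltW e8)// ler_pdivrMr ?ltr_wpDl// mul1r; lra.
have [rho r0 Hr] := HF _ e8.
move/strip_continuousE: (cphi) => /(_ x t x01 t0 _ e10)[r rr0 Hrr].
pose h := (1 + x) / 2; have h01 : 0 <= h < 1 by rewrite /h; lra.
have [h0 h1] := andP h01.
pose g := Num.min (r / 2) (h - x).
have g0 : 0 < g by rewrite lt_min; apply/andP; split; rewrite /h; lra.
have gr : g <= r / 2 by rewrite ge_min lexx.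
have gh : g <= h - x by rewrite ge_min lexx orbT.
have [eps he eZ] := scale_between r0 g0 Z0.
have [eps0 _] := andP he.
have [K K0 HK] := restored_limit_approx hD cphi Hr he.
(* [K] depends on eps, so eta comes last; [e1] is the oscillation of phi allowed near x. *)
pose eta := Num.min (e / 8 / (K + 1)) e1.
have eta0 : 0 < eta by rewrite lt_min e10 andbT divr_gt0// ltr_wpDl.
have eta1 : eta <= e1 by rewrite ge_min lexx orbT.
have Keta : K * eta <= e / 8.
  apply: (@le_trans _ _ (K * (e / 8 / (K + 1)))); first by rewrite ler_wpM2l// ge_min lexx.
  by rewrite mulrCA ler_piMr ?(ltW e8)// ler_pdivrMr ?ltr_wpDl// mul1r; lra.
have e1e : e1 <= e / 8 by rewrite ler_pdivrMr ?ltr_wpDl// mulrDr mulr1 lerDr mulr_ge0// ltW.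
have [P HP] := even_approximation h0 (strip_slice_continuous cphi h1 t0) eta0.
have H1 : `|dimension_lift d F (x, t) - even_apply (moment R d) (restored_poly d N c eps P) x| <= e / 8 + K * eta.
  apply: dimension_lift_approx => //; first exact: strip_slice_continuous.
  by move=> u /andP[u0 ux]; apply: (HK u t h) => //; [lra|exact: ltW].
have xh : 0 <= x <= h by rewrite x0 /h; lra.
have H2 : `|even_apply (moment R d) (restored_poly d N c eps P) x - phi (x, t)| <= K' * (2 * e1).
  apply: (HK' eps x h) => //; [lra|exact: ltW|by rewrite mulr_ge0// ltW|].
  move=> v vh vx; have := HP v vh; have [v0 v1] := andP vh.
  have v01 : 0 <= v < 1 by rewrite v0; lra.
  have xvr : `|x - v| < r by rewrite distrC; lra.
  have := Hrr v t v01 t0 xvr; rewrite subrr normr0 => /(_ rr0).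
  move: (phi _) (phi _) P.[_] => a b p; rewrite ltr_norml !ler_norml; lra.
rewrite mulrCA in H2; move: H1 H2.
move: (even_apply _ _ _) (dimension_lift _ _ _) (phi _) => a b p H1 H2.
have := ler_distD a b p; lra.
Qed.

Lemma restored_limit_class (R : realType) (d d' N : nat) (lam l : nat -> seq (R * R)) (c : seq (R * R)) (C C' Z : R)
    (phi F : R * R -> R) : restoration_data d N lam l c C C' Z -> class_P R d d' phi ->
  (forall p, ~ strip R p -> F p = 0) ->
  (forall kappa, 0 < kappa -> exists2 rho : R, 0 < rho & forall eps x t, 0 < eps < rho -> `|x| + 2 * eps * Z < 1 ->
      0 <= t -> `|F (`|x|, t) - restored lam c N phi eps eps x t| <= kappa) ->
  class_P R 1 d' F.
Proof.
move=> hD cP F0 HF; have [phi0 cphi phi1 _] := cP; have [[d0 oN] hc hl hlam [Z0 cZ]] := hD; split => //.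
- exact: restored_limit_continuous hD cphi HF.
- apply: dist_eq_of_small => e e0; have e2 : 0 < e / 2 by lra.
  have [rho r0 Hr] := HF _ e2; have [rho' r0' Hr'] := restored_origin_cvg hD cP e2.
  have rr : 0 < Num.min rho rho' by rewrite lt_min r0.
  have half : 0 < 2^-1 :> R by [].
  have [eps /andP[eps0 eps1] eZ] := scale_between rr half Z0.
  move: eps1; rewrite lt_min => /andP[er er'].
  have er2 : 0 < eps < rho by rewrite eps0.
  have er2' : 0 < eps < rho' by rewrite eps0.
  have := Hr eps 0 0 er2; rewrite normr0 add0r => /(_ _ (lexx _)) H1.
  have {}H1 := H1 ltac:(lra); have := Hr' _ _ er2' er2'.
  by have := ler_distD (restored lam c N phi eps eps 0 0) (F (0, 0)) 1; lra.
- move=> K a p Hp; pose x i := (p i).1 ord0 ord0.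
  have xi i : `|x i| < 2^-1 by have [] := Hp i; rewrite /half_ball /= euclidean_norm1.
  (* Finitely many points stay within some b < 1/2, which leaves room for the nodes of the
     differences once eps is small. *)
  pose b := \big[Num.max/0]_(i < K) `|x i|.
  have b1 : b < 2^-1 by apply: bigmax_lt.
  have xb i : `|x i| <= b by apply: le_bigmax_cond.
  have b0 : 0 <= b by exact: bigmax_ge_id.
  apply: (@ge0_of_small _ _ (\sum_(i < K) \sum_(j < K) `|a i * a j|)) => kappa k0.
  have [rho r0 Hr] := HF _ k0.
  have g0 : 0 < (1 - 2 * b) / 2 by lra.
  have [eps he eZ] := scale_between r0 g0 Z0.
  have [eps0 _] := andP he.
  pose h := 2 * b + 2 * eps * Z.
  have h01 : 0 <= h < 1 by rewrite /h addr_ge0 ?mulr_ge0 ?(ltW eps0)//=; lra.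
  have cA i q : q \in c -> `|x i + eps * q.2| <= h / 2.
    move=> qc; apply: (le_trans (ler_normD _ _)); rewrite normrM (gtr0_norm eps0).
    have : eps * `|q.2| <= eps * Z by rewrite ler_wpM2l ?(ltW eps0)// cZ.
    by have := xb i; rewrite /h; lra.
  have := restored_psd (eps := fun=> eps) a (fun i => (p i).2) d0 oN hc hl hlam cP (fun=> eps0) h01 cA.
  move=> H; rewrite -subr_ge0 opprK; apply: (le_trans H).
  rewrite mulr_suml -big_split; apply: ler_sum => i _; rewrite mulr_suml -big_split; apply: ler_sum => j _ /=.
  rewrite euclidean_norm1 -lerBlDl -mulrBr; apply: (le_trans (ler_norm _)); rewrite normrM distrC ler_wpM2l//.
  rewrite !mxE; apply: Hr => //; last exact: euclidean_norm_ge0.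
  have := ler_normB (x i) (x j); have := xb i; have := xb j; move: h01; rewrite /h -/(x i) -/(x j); lra.
Qed.

Theorem mainTheorem5 (R : realType) (d d' : nat)
    (hd : (2 <= d)%N) (hd' : (1 <= d')%N) :
  set_bij (class_P R 1 d') (class_P R d d') (dimension_lift d).
Proof.
split.
- by move=> phi; exact: dimension_lift_class.
- move=> phi psi; rewrite !inE => -[phi0 cphi _ _] [psi0 cpsi _ _] E.
  apply/funext => -[x t]; have [[/= x01 t0]|nxt] := pselect (strip R (x, t)).
    exact: lift_injective_slice hd cphi cpsi t0 E _ x01.
  by rewrite phi0// psi0.
- move=> phi cP; have [N [lam [l [c [C [C' [Z hD]]]]]]] := restoration_data_exists R (ltnW hd).
  have [F F0 HF] := restored_limit hd' hD cP.
  exists F; first exact: restored_limit_class hD cP F0 HF.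
  exact: restored_limit_lift hd hD cP HF.
Qed.
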